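(* Let $I$ be an index set, let $\Pi=(\Pi_{ij})_{i,j\in I}$ be a stochastic matrix, and let $\pi=(\pi_j)_{j\in I}$ be a stationary (i.e. invariant) probability distribution for $\Pi$, with $\Lambda_\pi\neq\emptyset$, where $\Lambda_\pi$ denotes the set of recurrent-positive classes of $\Pi$ to which $\pi$ gives strictly positive mass. Let $\omega$ be the entangled Markov chain on $\mathfrak{M}$ generated by the triplet $(\mathbb{M}_I,\mathcal{E},Q(\pi))$. Then: (i) The state $\omega$ is ergodic with respect to the spatial translations if and only if the set $\Lambda_\pi$ is a singleton. (ii) The state $\omega$ is strongly clustering with respect to the spatial translations if and only if the set $\Lambda_\pi$ is a singleton and, in addition, the corresponding block of $\Pi$ (the restriction of $\Pi$ to the indices of the unique class in $\Lambda_\pi$) is aperiodic.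
   Context: Matrices. $\mathbb{M}_I$ denotes the von Neumann algebra of all bounded operators on $\ell^2(I)$, viewed as $I\times I$ complex matrices with respect to the canonical basis $\{e_i\}_{i\in I}$; $\mathbb{M}_I\overline{\otimes}\mathbb{M}_I\cong\mathbb{M}_{I\times I}$ via $(A\otimes B)_{(i,j)(k,l)}=A_{ik}B_{jl}$. $\mathbb{1}$ is the identity. A stochastic matrix has nonnegative entries with $\sum_j\Pi_{ij}=1$ for all $i$. Transition expectation. $\mathcal{E}:\mathbb{M}_{I\times I}\to\mathbb{M}_I$ is $\mathcal{E}(X)=V^*XV$, where $V:\ell^2(I)\to\ell^2(I\times I)$ is the isometry $Ve_i=\sum_{j\in I}\sqrt{\Pi_{ij}}\,e_i\otimes e_j$. Equivalently $\mathcal{E}(A\otimes B)_{ij}=A_{ij}P(B)_{ij}$ with $P(B)_{ij}=\sum_{k,l}\sqrt{\Pi_{ik}\Pi_{jl}}\,B_{kl}$. Put $\mathcal{E}_A(B):=\mathcal{E}(A\otimes B)$. Initial state. $Q(\pi)$ is the positive trace-class matrix $Q(\pi)_{ij}=\sum_{k\in I}\pi_k\sqrt{\Pi_{ki}\Pi_{kj}}$, of trace one, identified with the normal state $A\mapsto\mathrm{Tr}(Q(\pi)A)$ on $\mathbb{M}_I$; this state is invariant under $\mathcal{E}_{\mathbb{1}}$. Infinite tensor product. For a finite $J\subset\mathbb{Z}$, $\mathfrak{M}_J:=\overline{\bigotimes}_{j\in J}\mathcal{M}_j$ is the von Neumann tensor product of copies $\mathcal{M}_j$ of $\mathbb{M}_I$;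 for $J\subset K$ one embeds $\mathfrak{M}_J$ in $\mathfrak{M}_K$ by $a\mapsto a\otimes\mathbb{1}_{K\setminus J}$. $\mathfrak{M}$ is the $C^*$-inductive limit of the $\mathfrak{M}_J$ over finite $J\subset\mathbb{Z}$. $\tau$ is the one-step shift automorphism of $\mathfrak{M}$. Entangled Markov chain. The entangled Markov chain generated by $(\mathbb{M}_I,\mathcal{E},Q(\pi))$ is the unique translation invariant, locally normal (i.e. normal on every $\mathfrak{M}_J$) state $\omega$ on $\mathfrak{M}$ such that, for $A_1,\dots,A_n\in\mathbb{M}_I$ placed on $n$ consecutive sites, $$\omega(A_1\otimes\cdots\otimes A_n)=Q(\pi)\big(\mathcal{E}_{A_1}\circ\cdots\circ\mathcal{E}_{A_n}(\mathbb{1})\big).$$ Classes. The index set $I$ is the state space of the classical Markov chain with transition matrix $\Pi$; recurrent-positive classes are the communicating classes of positive recurrent states (also called ergodic classes). Each invariant probability distribution is a unique convex combination $\pi=\sum_\lambda\alpha_\lambda x_\lambda$ over the recurrent-positive classes $\lambda$, with $x_\lambda$ the unique stationary distribution of the restriction $\Pi_\lambda$ of $\Pi$ to the class $\lambda$; $\Lambda_\pi$ is the set of $\lambda$ with $\alpha_\lambda>0$. The block $\Pi_\lambda$ is aperiodic if the period of its states is $1$. Ergodicity and clustering. A $\tau$-invariant state $\omega$ on $\mathfrak{M}$ is ergodic if it is an extreme point of the set of $\tau$-invariant states; equivalently in this setting, $\lim_n\frac1n\sum_{k=1}^n\omega(A\tau^k(B))=\omega(A)\omega(B)$ for all $A,B\in\mathfrak{M}$.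 It is strongly clustering if $\lim_{n\to\infty}\omega(A\tau^n(B))=\omega(A)\omega(B)$ for all $A,B\in\mathfrak{M}$. *)

(* Defs.v *)
From HB Require Import structures.
From mathcomp Require Import all_boot all_order all_algebra finmap.
From mathcomp Require Import all_classical all_reals all_analysis.
From mathcomp Require Import complex.
From mathcomp Require summability.

Set Implicit Arguments.
Unset Strict Implicit.
Unset Printing Implicit Defensive.

Import Order.TTheory GRing.Theory Num.Theory.
Import numFieldNormedType.Exports.

Local Open Scope classical_set_scope.
Local Open Scope complex_scope.
Local Open Scope ring_scope.

Section MarkovChain.
Context {R : realType}.
Implicit Types (S : choiceType).

Definition stochastic S (P : S -> S -> R) : Prop :=
  (forall i j, 0 <= P i j) /\
  (forall i, (\esum_(j in [set: S]) (P i j)%:E = 1)%E).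

Definition stationary S (P : S -> S -> R) (p : S -> R) : Prop :=
  [/\ forall j, 0 <= p j,
      (\esum_(j in [set: S]) (p j)%:E = 1)%E &
      forall j, (\esum_(i in [set: S]) (p i * P i j)%:E = (p j)%:E)%E].

Fixpoint step_prob S (P : S -> S -> R) (n : nat) (i j : S) : \bar R :=
  if n is m.+1 then
    (\esum_(k in [set: S]) ((P i k)%:E * step_prob P m k j))%E
  else (i == j)%:R%:E.

(* Probability that the chain started at [i] hits [j] at time [n] for the
   first time after time 0. *)
Fixpoint first_passage S (P : S -> S -> R) (n : nat) (i j : S) : \bar R :=
  match n with
  | 0 => 0%E
  | 1 => (P i j)%:E
  | m.+1 => (\esum_(k in [set k | k != j])
               ((P i k)%:E * first_passage P m k j))%E
  end.

Definition positive_recurrent S (P : S -> S -> R) (i : S) : Prop :=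
  (\sum_(1 <= n <oo) first_passage P n i i = 1)%E /\
  (\sum_(1 <= n <oo) (n%:R%:E * first_passage P n i i) < +oo)%E.

Definition communicate S (P : S -> S -> R) (i j : S) : Prop :=
  (exists n, (0 < step_prob P n i j)%E) /\
  (exists n, (0 < step_prob P n j i)%E).

Definition positive_class S (P : S -> S -> R) (L : set S) : Prop :=
  exists2 i, positive_recurrent P i & L = [set j | communicate P i j].

Definition Lambda S (P : S -> S -> R) (p : S -> R) : set (set S) :=
  [set L | positive_class P L /\ (0 < \esum_(i in L) (p i)%:E)%E].

Definition block S (P : S -> S -> R) (L : set S) : L -> L -> R :=
  fun i j => P (val i) (val j).

(* [d] is the gcd of the lengths of the loops at [i]. *)
Definition has_period S (P : S -> S -> R) (i : S) (d : nat) : Prop :=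
  forall e : nat, (e %| d)%N <->
    (forall n, (0 < n)%N -> (0 < step_prob P n i i)%E -> (e %| n)%N).

Definition aperiodic S (P : S -> S -> R) : Prop := forall i, has_period P i 1.

End MarkovChain.

Section Operators.
Context {R : realType}.
Local Notation C := R[i].

(* Unconditional sums: limits along the directed set of finite subsets. *)
Definition usummable (K : numFieldType) (S : choiceType) (f : S -> K) : Prop :=
  cvg (@summability.partial_sum S K^o f @ summability.totally).

Definition usum (K : numFieldType) (S : choiceType) (f : S -> K) : K :=
  @summability.sum S K K^o f.

Definition mat (S T : choiceType) := S -> T -> C.

Definition l2norm2 (S : choiceType) (v : S -> C) : \bar R :=
  (\esum_(s in [set: S]) (ComplexField.Normc.normc (v s) ^+ 2)%:E)%E.

Definition l2 (S : choiceType) : set (S -> C) :=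
  [set v | (l2norm2 v < +oo)%E].

Definition mat_apply (S T : choiceType) (A : mat S T) (v : T -> C) : S -> C :=
  fun s => usum (fun t => A s t * v t).

(* [A] is the matrix of an operator l^2(T) -> l^2(S) of norm at most [M]. *)
Definition norm_le (S T : choiceType) (A : mat S T) (M : R) : Prop :=
  0 <= M /\
  forall v, l2 v ->
    (forall s, usummable (fun t => A s t * v t)) /\
    (l2norm2 (mat_apply A v) <= (M ^+ 2)%:E * l2norm2 v)%E.

Definition bounded (S T : choiceType) (A : mat S T) : Prop :=
  exists M : R, norm_le A M.

Definition mat_id (S : choiceType) : mat S S := fun s t => (s == t)%:R.

Definition mat_add (S T : choiceType) (A B : mat S T) : mat S T :=
  fun s t => A s t + B s t.

Definition mat_sub (S T : choiceType) (A B : mat S T) : mat S T :=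
  fun s t => A s t - B s t.

Definition mat_scale (S T : choiceType) (c : C) (A : mat S T) : mat S T :=
  fun s t => c * A s t.

Definition mat_mul (S T U : choiceType) (A : mat S T) (B : mat T U) : mat S U :=
  fun s u => usum (fun t => A s t * B t u).

Definition mat_adj (S T : choiceType) (A : mat S T) : mat T S :=
  fun t s => (A s t)^*.

Definition mat_trace (S : choiceType) (A : mat S S) : C :=
  usum (fun s => A s s).

Definition mat_tensor (S T : choiceType) (A : mat S S) (B : mat T T)
    : mat (S * T)%type (S * T)%type :=
  fun p q => A p.1 q.1 * B p.2 q.2.

(* The order of R[i] makes [0 <= z] say that [z] is real and nonnegative. *)
Definition positive_op (S : choiceType) (A : mat S S) : Prop :=
  bounded A /\
  forall v, l2 v -> 0 <= usum (fun s => (v s)^* * mat_apply A v s).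

Definition op_le (S : choiceType) (A B : mat S S) : Prop :=
  positive_op (mat_sub B A).

Definition op_lub (S : choiceType) (D : set (mat S S)) (X : mat S S) : Prop :=
  [/\ positive_op X, forall A, D A -> op_le A X &
      forall Y, positive_op Y -> (forall A, D A -> op_le A Y) -> op_le X Y].

(* Normality, for a positive functional on the bounded operators on l^2(S):
   preservation of suprema of bounded upward directed sets of positive
   operators.  The bound [f A <= f X] for [A] in [D] is automatic. *)
Definition normal (S : choiceType) (f : mat S S -> C) : Prop :=
  forall (D : set (mat S S)) (X : mat S S),
    D !=set0 -> (forall A, D A -> positive_op A) ->
    (forall A B, D A -> D B -> exists2 Z, D Z & op_le A Z /\ op_le B Z) ->
    op_lub D X ->
    forall c : C, (forall A, D A -> f A <= c) -> f X <= c.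

End Operators.

Arguments mat_id {R} S.

(* A finite von Neumann tensor product of copies of the algebra of bounded
   operators on l^2(I), indexed by J, is the algebra of bounded matrices over
   J -> I.  All of these act on the (nonseparable) space l^2(int -> I): a matrix
   over J -> I acts on the coordinates in J and as the identity on the others.
   This representation is faithful, hence isometric, on each local algebra, and
   sends a and a (x) 1 to the same operator.  So the C*-inductive limit is
   the norm closure of the union of the images, with the operations of
   bounded operators on l^2(int -> I). *)
Section QuasiLocal.
Context {R : realType} {I : choiceType}.
Local Notation C := R[i].
Local Notation conf := (int -> I).

Definition embed (J : {fset int}) (a : @mat R (J -> I) (J -> I))
    : @mat R conf conf :=
  fun s t => if `[< forall x, x \notin J -> s x = t x >]
             then a (fun j => s (val j)) (fun j => t (val j)) else 0.

Definition local_algebra (J : {fset int}) : set (@mat R conf conf) :=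
  [set X | exists2 a : mat (J -> I) (J -> I), bounded a & X = embed a].

Definition quasilocal : set (@mat R conf conf) :=
  [set X | forall e : R, 0 < e ->
     exists J : {fset int}, exists2 A, local_algebra J A &
       norm_le (mat_sub X A) e].

(* The shift sends a copy of an operator at site j to its copy at j + 1. *)
Definition shift (X : @mat R conf conf) : @mat R conf conf :=
  fun s t => X (fun x => s (x + 1)) (fun x => t (x + 1)).

(* Functionals on the quasi-local algebra are represented by functions on all
   matrices, of which only the values on [quasilocal] are meaningful. *)
Definition state (w : @mat R conf conf -> C) : Prop :=
  [/\ forall c X Y, quasilocal X -> quasilocal Y ->
        w (mat_add (mat_scale c X) Y) = c * w X + w Y,
      forall X, quasilocal X -> 0 <= w (mat_mul (mat_adj X) X) &
      w (mat_id conf) = 1].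

Definition invariant_state (w : @mat R conf conf -> C) : Prop :=
  state w /\ forall X, quasilocal X -> w (shift X) = w X.

Definition locally_normal (w : @mat R conf conf -> C) : Prop :=
  forall J : {fset int},
    normal (fun a : mat (J -> I) (J -> I) => w (embed a)).

Definition ergodic (w : @mat R conf conf -> C) : Prop :=
  invariant_state w /\
  forall (w1 w2 : @mat R conf conf -> C) (t : R),
    invariant_state w1 -> invariant_state w2 -> 0 < t < 1 ->
    (forall X, quasilocal X -> w X = t%:C * w1 X + (1 - t)%:C * w2 X) ->
    forall X, quasilocal X -> w1 X = w X /\ w2 X = w X.

Definition strongly_clustering (w : @mat R conf conf -> C) : Prop :=
  forall A B, quasilocal A -> quasilocal B ->
    ((fun n : nat => w (mat_mul A (iter n shift B)) : C^o) @ \oo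
       --> (w A * w B : C^o)).

Definition site_tensor (J : {fset int}) (B : int -> @mat R I I)
    : @mat R (J -> I) (J -> I) :=
  fun s t => \prod_(j : J) B (val j) (s j) (t j).

Definition sites (k : int) (n : nat) : {fset int} :=
  [fset (k + i%:Z)%R | i in iota 0 n]%fset.

End QuasiLocal.

Section Entangled.
Context {R : realType} {I : choiceType}.
Local Notation C := R[i].

Definition isometryV (P : I -> I -> R) : @mat R (I * I)%type I :=
  fun p i => if p.1 == i then (Num.sqrt (P i p.2))%:C else 0.

Definition transition (P : I -> I -> R)
    (X : @mat R (I * I)%type (I * I)%type) : @mat R I I :=
  mat_mul (mat_adj (isometryV P)) (mat_mul X (isometryV P)).

Definition transition_at (P : I -> I -> R) (A B : @mat R I I) : @mat R I I :=
  transition P (mat_tensor A B).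

Definition Qmat (P : I -> I -> R) (p : I -> R) : @mat R I I :=
  fun i j => (usum (fun k => p k * Num.sqrt (P k i * P k j)))%:C.

Definition Qstate (P : I -> I -> R) (p : I -> R) (A : @mat R I I) : C :=
  mat_trace (mat_mul (Qmat P p) A).

Definition entangled_markov_chain (P : I -> I -> R) (p : I -> R)
    (w : @mat R (int -> I) (int -> I) -> C) : Prop :=
  [/\ invariant_state w, locally_normal w &
      forall (B : int -> @mat R I I) (k : int) (n : nat),
        (0 < n)%N -> (forall j, bounded (B j)) ->
        w (embed (site_tensor (J := sites k n) B)) =
        Qstate P p (foldr (fun (i : nat) X => transition_at P (B (k + i%:Z)) X)
                          (mat_id I) (iota 0 n))].

End Entangled.

(* Main.v *)
(** On matrix units the state [w] is a classical correlation: for local operators [A], [B]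
    with finitely many entries and [d] large,
      [w (A * tau^d B) = \sum_k a_k (P^(d - m) b)_k]
    with [a] summable and carried by the support of [p], and [b] bounded with
    [\sum_k p_k b_k = w B].  Normality and Cauchy-Schwarz reduce arbitrary quasi-local
    operators to these, so clustering and ergodicity become the pointwise convergence on the
    support of [p] of [P^n b], respectively of its Cesaro means, to [\sum_k p_k b_k].

    That convergence comes from energy dissipation: [p (f^2) - p ((P f)^2)] is the [p]-average
    of the variances of [f] under the rows of [P].  When it tends to zero along a sequence
    [f_n], the differences [f_n j - (P f_n) i] vanish in the limit on every edge [i -> j] of
    the support, hence, by connectedness (and aperiodicity, for [f_n = P^n b]), [f_n] becomes
    constant.

    In the case of the means, an invariant state [v] with [t v <= w] sees the averages of the
    translates of [A - w A] in mean square, so it agrees with [w].  Conversely, the projection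
    on a class, placed at one site, is indistinguishable by [w] from its translates: cutting
    [w] down to this projection decomposes [w], and clustering forces the mass of the class to
    be [0] or [1].  Aperiodicity is read off the return probabilities
    [w (e_ii tau^n e_ii) = p_i (P^n)_ii -> p_i^2]. *)
Require Import Defs.
From mathcomp Require Import all_boot all_order all_algebra finmap.
From mathcomp Require Import all_classical all_reals all_analysis.
From mathcomp Require Import complex zify ring lra.
From mathcomp Require summability.

Set Implicit Arguments.
Unset Strict Implicit.
Unset Printing Implicit Defensive.

Import Order.TTheory GRing.Theory Num.Theory.
Import numFieldNormedType.Exports.

Local Open Scope classical_set_scope.
Local Open Scope ring_scope.

(** * Unconditional sums *)

#[local] Existing Instance summability.totally_filter.

(** A [state] is assumed positive on products of an adjoint with its operator, and nothing is
    assumed about its continuity. Boundedness is therefore derived: for [H] self-adjoint of norm at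
    most 1/2, [1 - H] is a square, which yields a norm bound with a constant 2 and makes norm
    approximation usable. Since [l2 (int -> I)] is nonseparable, bounds are read on finite bilinear
    forms ([opb]), where sums can be exchanged freely. Normality is applied to one family of
    projections, those on finitely many local configurations: cutting by them leaves finite
    combinations of matrix units, whose correlations can be computed. Matrix units are in general
    off-diagonal, but a single free site between two of them already makes the right-hand factor
    diagonal, and on diagonal matrices the transition expectation is the Markov operator; this is
    how a noncommutative correlation becomes classical. In the ergodic part the competing state is
    not assumed locally normal; its domination by a multiple of [w] transfers the approximation to
    it. *)

Lemma le_of_eq (R : numDomainType) (x y : R) : x = y -> x <= y.
Proof. by move=> ->. Qed.

Section UnconditionalSums.
Context {K : numFieldType} {S : choiceType}.
Implicit Types (f g : S -> K) (l m : K).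

(** Convergence to a named value. [usum] picks a limit and says nothing when there is none, so sums
    are established as [hsum] and read off by [hsum_usum]. *)
Definition hsum f l : Prop :=
  (fun A : {fset S} => \sum_(i <- A) f i) @ summability.totally --> (l : K^o).

Lemma partial_sumE f (A : {fset S}) :
  @summability.partial_sum S K^o f A = \sum_(i <- A) f i.
Proof. by rewrite [RHS]big_seq_fsetE. Qed.

Lemma hsumE f l :
  hsum f l = (@summability.partial_sum S K^o f @ summability.totally --> (l : K^o)).
Proof.
rewrite /hsum (_ : (fun A : {fset S} => _) = @summability.partial_sum S K^o f)//.
by apply/funext => A; rewrite partial_sumE.
Qed.

Lemma hsum_usum f l : hsum f l -> usum f = l.
Proof. by rewrite hsumE => h; apply: (@cvg_lim K^o (@norm_hausdorff K K^o) _ _ (@summability.totally_filter S) _ _ h). Qed.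

Lemma hsum_usummable f l : hsum f l -> usummable f.
Proof. by rewrite hsumE => h; apply/cvg_ex; exists l. Qed.

Lemma usummable_hsum f : usummable f -> hsum f (usum f).
Proof. by rewrite hsumE. Qed.

Lemma hsum_eq f g l m : f =1 g -> l = m -> hsum f l -> hsum g m.
Proof. by move=> /funext -> ->. Qed.

Lemma hsum_unique f l m : hsum f l -> hsum f m -> l = m.
Proof. by move=> /hsum_usum <- /hsum_usum. Qed.

Lemma hsumP f l :
  hsum f l <-> forall e, 0 < e ->
    exists A : {fset S}, forall B : {fset S}, (A `<=` B)%fset ->
      `|l - \sum_(i <- B) f i| < e.
Proof.
split=> [h e e0|h].
  move/cvgrPdist_lt: h => /(_ e e0) [A _ hA].
  by exists A => B AB; exact: hA.
apply/cvgrPdist_lt => e e0; have [A hA] := h e e0.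
by exists A => // B /= AB; exact: hA.
Qed.

Lemma hsumD f g l m : hsum f l -> hsum g m -> hsum (fun i => f i + g i) (l + m).
Proof.
move=> hf hg; rewrite /hsum.
under eq_fun do rewrite big_split /=.
exact: cvgD hf hg.
Qed.

Lemma hsumZ c f l : hsum f l -> hsum (fun i => c * f i) (c * l).
Proof.
move=> hf; rewrite /hsum.
under eq_fun do rewrite -mulr_sumr.
exact: cvgMr hf.
Qed.

Lemma hsumB f g l m : hsum f l -> hsum g m -> hsum (fun i => f i - g i) (l - m).
Proof.
move=> hf hg; have := hsumD hf (hsumZ (c := -1) hg).
by under eq_fun do rewrite mulN1r; rewrite mulN1r.
Qed.

Lemma hsum_fin (A : {fset S}) f :
  (forall i, i \notin A -> f i = 0) -> hsum f (\sum_(i <- A) f i).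
Proof.
move=> h; apply/hsumP => e e0; exists A => B AB.
rewrite (big_fset_incl _ AB) ?subrr ?normr0// => x _ xA; exact: h.
Qed.

Lemma hsum0 : hsum (fun _ => 0) 0.
Proof.
have := @hsum_fin fset0 (fun _ => 0) (fun _ _ => erefl).
by rewrite big_seq_fset0.
Qed.

Lemma hsum1 j f : (forall i, i != j -> f i = 0) -> hsum f (f j).
Proof.
move=> h; have := @hsum_fin [fset j]%fset f.
by rewrite big_seq_fset1; apply => i; rewrite inE => /h.
Qed.

Lemma hsum_sum (J : Type) (s : seq J) (F : J -> S -> K) (G : J -> K) :
  (forall j, hsum (F j) (G j)) ->
  hsum (fun i => \sum_(j <- s) F j i) (\sum_(j <- s) G j).
Proof.
move=> h; elim: s => [|j s IH].
  by under eq_fun do rewrite big_nil; rewrite big_nil; exact: hsum0.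
by under eq_fun do rewrite big_cons; rewrite big_cons; exact: hsumD.
Qed.

End UnconditionalSums.

(** A finite subset of [S] and its preimage in [T] carry the same partial sum, because [f] vanishes
    off the image of [h]; this transfers convergence both ways. *)
Lemma hsum_inj (K : numFieldType) (S T : choiceType) (h : T -> S) (f : S -> K) l :
  injective h -> (forall i, (forall j, h j <> i) -> f i = 0) ->
  hsum f l <-> hsum (f \o h) l.
Proof.
move=> hI h0.
have key (B : {fset S}) : exists C : {fset T},
    (forall j, (j \in C) = (h j \in B)) /\
    \sum_(i <- B) f i = \sum_(j <- C) f (h j).
  (* A partial inverse of [h] lets the preimage of [B] be built as a finite set by [pmap]. *)
  pose hinv x := if pselect (exists j, h j = x) is left p then Some (sval (cid p)) else None.
  have hK j : hinv (h j) = Some j.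
    rewrite /hinv; case: pselect => [p|[]]; last by exists j.
    by case: (cid p) => k /= /hI ->.
  have [C hC] : exists C : {fset T}, forall j, (j \in C) = (h j \in B).
    exists [fset j in pmap hinv B]%fset => j; rewrite inE /= mem_pmap; apply/mapP/idP => [[x xB]|hj]; last by exists (h j).
    by rewrite /hinv; case: pselect => // p; case: (cid p) => k /= e [->]; rewrite e.
  exists C; split => //.
  have -> : \sum_(j <- C) f (h j) = \sum_(i <- [fset h j | j in C]%fset) f i.
    by rewrite big_imfset//= => x y _ _; exact: hI.
  symmetry; apply: big_fset_incl.
    by apply/fsubsetP => _ /imfsetP[j /= jC ->]; rewrite -hC.
  move=> x xB xC; apply: h0 => j E; move: xC; rewrite -E in_imfset//= hC E //.
split=> /hsumP hf; apply/hsumP => e e0; have [A hA] := hf e e0.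
- have [C [CP _]] := key A; exists C => B CB.
  have := hA (A `|` [fset h j | j in B])%fset (fsubsetUl _ _).
  suff -> : \sum_(i <- (A `|` [fset h j | j in B])%fset) f i = \sum_(j <- B) f (h j).
    by [].
  transitivity (\sum_(i <- [fset h j | j in B]%fset) f i); last first.
    by rewrite big_imfset//= => x y _ _; exact: hI.
  symmetry; apply: big_fset_incl; first exact: fsubsetUr.
  move=> x; rewrite in_fsetU => /orP[xA|->//] xB; apply: h0 => j E.
  move: xB; rewrite -E in_imfset//=; apply: (fsubsetP CB); rewrite CP E //.
- exists [fset h j | j in A]%fset => B AB; have [C [CP ->]] := key B.
  apply: hA; apply/fsubsetP => j jA; rewrite CP; apply: (fsubsetP AB).
  by rewrite in_imfset.
Qed.

(** Covers divergent sums as well: [usum] is chosen from the set of limits, and [hsum_inj] makes the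
    two sets of limits equal. *)
Lemma usum_inj (K : numFieldType) (S T : choiceType) (h : T -> S) (f : S -> K) :
  injective h -> (forall i, (forall j, h j <> i) -> f i = 0) ->
  usum f = usum (f \o h).
Proof.
move=> hI h0.
have E (X : choiceType) (g : X -> K) : usum g = get (fun l : K^o => hsum g l).
  rewrite /usum /summability.sum /lim /lim_in; congr (xget _ _).
  by apply/funext => l; rewrite hsumE.
rewrite !E; congr (xget _ _); apply/funext => l; apply/propext; exact: hsum_inj.
Qed.

Section RealSums.
Context {R : realType} {S : choiceType}.
Implicit Types (f g : S -> R) (l m : R).

Lemma hsum_nneg_le f l (A : {fset S}) :
  (forall i, 0 <= f i) -> hsum f l -> \sum_(i <- A) f i <= l.
Proof.
move=> f0 /hsumP h; apply/ler_addgt0Pr => e e0; have [B hB] := h e e0.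
have := hB (A `|` B)%fset (fsubsetUr _ _).
rewrite ltr_distlC => /andP[_ h2].
apply: le_trans (ltW h2).
have AB : (A `<=` A `|` B)%fset by exact: fsubsetUl.
rewrite (big_fsetID _ [pred x | x \in A] (A `|` B)%fset) /=.
rewrite (_ : [fset x | x in (A `|` B)%fset & x \in A]%fset = A) ?lerDl ?sumr_ge0//.
by apply/fsetP => x; rewrite !inE andbC /=; case: (x \in A).
Qed.

(** The bridge between the two kinds of sums in the statement: extended real sums for the chain,
    unconditional limits for matrices. *)
Lemma hsum_nneg f l : (forall i, 0 <= f i) ->
  hsum f l <-> (\esum_(i in [set: S]) (f i)%:E = l%:E)%E.
Proof.
move=> f0; have esumA (A : {fset S}) :
    ((\sum_(i <- A) f i)%:E <= \esum_(i in [set: S]) (f i)%:E)%E.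
  apply: esum_ge; exists [set` A] => //.
  rewrite fsbig_finite//= set_fsetK sumEFin //.
split=> h.
- apply/eqP; rewrite eq_le; apply/andP; split.
    apply: ge_ereal_sup => _ [A [finA _] <-].
    by rewrite fsbig_finite//= sumEFin lee_fin; exact: hsum_nneg_le.
  apply/lee_addgt0Pr => e e0; move/hsumP: h => /(_ e e0)[A /(_ A (fsubset_refl _))].
  rewrite ltr_distlC => /andP[+ _]; rewrite ltrBlDr => /ltW h2.
  apply: (@le_trans _ _ ((\sum_(i <- A) f i)%:E + e%:E)%E).
    by rewrite -EFinD lee_fin; lra.
  by rewrite leeD2r.
- apply/hsumP => e e0.
  have : (l%:E - e%:E < \esum_(i in [set: S]) (f i)%:E)%E.
    by rewrite h -EFinB lte_fin ltrBlDr ltrDl.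
  move=> /ereal_sup_gt[_ [A [finA _] <-]].
  rewrite fsbig_finite//= sumEFin -EFinB lte_fin => hA.
  exists (fset_set A) => B AB; have := esumA B; rewrite h lee_fin => hB.
  rewrite ltr_distlC; apply/andP; split; last first.
    by apply: le_lt_trans hB _; rewrite ltrDl.
  apply: lt_le_trans hA _.
  rewrite (big_fsetID _ [pred x | x \in fset_set A] B) /=.
  rewrite (_ : [fset x | x in B & x \in fset_set A]%fset = fset_set A) ?lerDl ?sumr_ge0//.
  apply/fsetP => x; rewrite !inE /= andbC; case: (boolP (x \in fset_set A)) => //=.
  by move=> xA; apply: (fsubsetP AB).
Qed.

Lemma hsum_bounded f M : (forall i, 0 <= f i) ->
  (forall A : {fset S}, \sum_(i <- A) f i <= M) -> exists2 l, hsum f l & l <= M.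
Proof.
move=> f0 h.
have hM : (\esum_(i in [set: S]) (f i)%:E <= M%:E)%E.
  apply: ge_ereal_sup => _ [A [finA _] <-].
  by rewrite fsbig_finite//= sumEFin lee_fin.
have fn : (\esum_(i in [set: S]) (f i)%:E)%E \is a fin_num.
  rewrite ge0_fin_numE ?(le_lt_trans hM) ?ltry//.
  by apply: esum_ge0 => i _; rewrite lee_fin.
exists (fine (\esum_(i in [set: S]) (f i)%:E)%E).
  by apply/hsum_nneg => //; rewrite fineK.
by rewrite -lee_fin fineK.
Qed.

Lemma hsum_le f g l m : (forall i, f i <= g i) -> hsum f l -> hsum g m -> l <= m.
Proof.
move=> fg /hsumP hf /hsumP hg; apply/ler_addgt0Pr => e e0.
have e2 : 0 < e / 2 by lra.
have [A hA] := hf _ e2; have [B hB] := hg _ e2.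
have := hA (A `|` B)%fset (fsubsetUl _ _); have := hB (A `|` B)%fset (fsubsetUr _ _).
have : \sum_(i <- (A `|` B)%fset) f i <= \sum_(i <- (A `|` B)%fset) g i.
  by apply: ler_sum => i _.
by rewrite !ltr_distlC => h1 /andP[h2 h3] /andP[h4 h5]; lra.
Qed.

Lemma hsum_ge0 f l : (forall i, 0 <= f i) -> hsum f l -> 0 <= l.
Proof. by move=> f0 hf; apply: hsum_le hsum0 hf. Qed.

Lemma hsum_nneg_dominated f g m :
  (forall i, 0 <= f i <= g i) -> hsum g m -> exists2 l, hsum f l & l <= m.
Proof.
move=> fg hg; apply: hsum_bounded => [i|A]; first by case/andP: (fg i).
apply: (@le_trans _ _ (\sum_(i <- A) g i)).
  by apply: ler_sum => i _; case/andP: (fg i).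
by apply: hsum_nneg_le => // i; case/andP: (fg i) => /le_trans; apply.
Qed.

Lemma hsum_dominated f g m :
  (forall i, `|f i| <= g i) -> hsum g m -> exists2 l, hsum f l & `|l| <= m.
Proof.
move=> fg hg.
have /hsum_nneg_dominated - /(_ _ hg)[l1 h1 _] : forall i, 0 <= `|f i| <= g i.
  by move=> i; rewrite normr_ge0 fg.
(* [f + |f|] lies between 0 and [2 |f|], so its sum exists by comparison of nonnegative terms;
   subtracting the sum of [|f|] gives that of [f]. *)
have [l2 h2 _] : exists2 l, hsum (fun i => f i + `|f i|) l & l <= l1 + l1.
  apply: hsum_nneg_dominated (hsumD h1 h1) => i.
  have := ler_norm (f i); have := ler_norm (- f i); rewrite normrN => ? ?.
  by apply/andP; split; lra.
have h3 : hsum f (l2 - l1).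
  by have := hsumB h2 h1; under eq_fun do rewrite addrK.
exists (l2 - l1) => //; rewrite ler_norml; apply/andP; split.
  rewrite lerNl; have := hsumZ (c := -1) h3; rewrite mulN1r => h4.
  apply: hsum_le h4 hg => i; rewrite mulN1r; apply: le_trans (fg i).
  by rewrite -normrN ler_norm.
by apply: hsum_le h3 hg => i; apply: le_trans (fg i); rewrite ler_norm.
Qed.

End RealSums.

Section ComplexSums.
Context {R : realType}.
Local Notation C := R[i].
Local Notation nc := ComplexField.Normc.normc.
Implicit Types (S : choiceType) (z : C).

Lemma normcEnc z : `|z| = (nc z)%:C%C. Proof. by []. Qed.

Lemma nc_ge0 z : 0 <= nc z. Proof. by case: z => a b /=; rewrite sqrtr_ge0. Qed.

Lemma ncM z1 z2 : nc (z1 * z2) = nc z1 * nc z2.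
Proof. exact: ComplexField.Normc.normcM. Qed.

Lemma ncD z1 z2 : nc (z1 + z2) <= nc z1 + nc z2.
Proof. exact: le_normcD. Qed.

Lemma ncN z : nc (- z) = nc z. Proof. exact: normcN. Qed.

Lemma ncB z1 z2 : nc (z1 - z2) <= nc z1 + nc z2.
Proof. by rewrite -(ncN z2); exact: ncD. Qed.

Lemma nc0 : nc (0 : C) = 0. Proof. exact: ComplexField.Normc.normc0. Qed.

Lemma nc1 : nc (1 : C) = 1. Proof. exact: ComplexField.Normc.normc1. Qed.

Lemma nc_eq0 z : nc z = 0 -> z = 0. Proof. exact: ComplexField.Normc.eq0_normc. Qed.

Lemma nc_real (x : R) : nc x%:C%C = `|x|.
Proof. by rewrite /= expr0n /= addr0 sqrtr_sqr. Qed.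

Lemma nc_conj z : nc (z^*)%C = nc z.
Proof. by case: z => a b /=; rewrite sqrrN. Qed.

Lemma nc_sqr z : ((nc z ^+ 2)%:C)%C = z * (z^*)%C.
Proof. by rewrite -sqr_normc rmorphXn. Qed.

Lemma nc_sqr' z : ((nc z ^+ 2)%:C)%C = (z^*)%C * z.
Proof. by rewrite nc_sqr mulrC. Qed.

Lemma nc_sum (J : Type) (s : seq J) (Q : pred J) (F : J -> C) :
  nc (\sum_(j <- s | Q j) F j) <= \sum_(j <- s | Q j) nc (F j).
Proof.
elim/big_rec2: _ => [|j x y _ IH]; first by rewrite nc0.
by apply: le_trans (ncD _ _) _; rewrite lerD2l.
Qed.

Lemma hsumCP S (f : S -> C) l :
  hsum f l <-> forall e : R, 0 < e ->
    exists A : {fset S}, forall B : {fset S}, (A `<=` B)%fset ->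
      nc (l - \sum_(i <- B) f i) < e.
Proof.
split=> [/hsumP h e e0|h].
  have [|A hA] := h (e%:C)%C; first by rewrite ltcR.
  by exists A => B AB; have := hA B AB; rewrite normcEnc ltcR.
apply/hsumP => -[e e']; rewrite ltcE /= => /andP[/eqP -> e0].
by have [A hA] := h e e0; exists A => B AB; have := hA B AB; rewrite normcEnc ltcR.
Qed.

Lemma hsum_real_complex S (f : S -> R) l :
  hsum f l -> hsum (fun i => (f i)%:C%C) (l%:C)%C.
Proof.
move=> /hsumP h; apply/hsumCP => e e0; have [A hA] := h e e0; exists A => B AB.
by rewrite -rmorph_sum -rmorphB nc_real hA.
Qed.

Lemma nc_ge_Re z : `|complex.Re z| <= nc z.
Proof. by have := normc_ge_Re z; rewrite normcEnc lecR. Qed.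

Lemma nc_ge_Im z : `|complex.Im z| <= nc z.
Proof. by case: z => a b /=; rewrite -sqrtr_sqr ler_wsqrtr // lerDr sqr_ge0. Qed.

Lemma hsum_complex_dominated S (f : S -> C) (g : S -> R) m :
  (forall i, nc (f i) <= g i) -> hsum g m -> exists2 l, hsum f l & nc l <= m.
Proof.
move=> fg hg.
have [a ha _] : exists2 l, hsum (fun i => complex.Re (f i)) l & `|l| <= m.
  by apply: hsum_dominated hg => i; apply: le_trans (fg i); exact: nc_ge_Re.
have [b hb _] : exists2 l, hsum (fun i => complex.Im (f i)) l & `|l| <= m.
  by apply: hsum_dominated hg => i; apply: le_trans (fg i); exact: nc_ge_Im.
have hf : hsum f (a%:C + 'i * b%:C)%C.
  have := hsumD (hsum_real_complex ha) (hsumZ (c := 'i%C) (hsum_real_complex hb)).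
  by under eq_fun do rewrite -complexE.
exists (a%:C + 'i * b%:C)%C => //.
(* Summing real and imaginary parts separately yields existence only; the bound [m] comes from the
   finite partial sums of [f] itself. *)
apply/ler_addgt0Pr => e e0; move/hsumCP: hf => /(_ e e0)[A /(_ A (fsubset_refl _)) hA].
set s := \sum_(i <- A) f i in hA.
rewrite -[X in nc X](subrK s) (le_trans (ncD _ _))// addrC lerD//; last exact: ltW.
apply: le_trans (nc_sum _ _ _) _.
apply: (@le_trans _ _ (\sum_(i <- A) g i)); first by apply: ler_sum => i _.
by apply: hsum_nneg_le hg => i; apply: le_trans (fg i); exact: nc_ge0.
Qed.

Lemma hsum_conj S (f : S -> C) l : hsum f l -> hsum (fun i => (f i)^*%C) (l^*%C).
Proof.
move=> /hsumCP h; apply/hsumCP => e e0; have [A hA] := h e e0; exists A => B AB.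
by rewrite -rmorph_sum -rmorphB nc_conj hA.
Qed.

Lemma nc_le_hsum S (f : S -> C) l M (A0 : {fset S}) : hsum f l ->
  (forall A : {fset S}, (A0 `<=` A)%fset -> nc (\sum_(i <- A) f i) <= M) -> nc l <= M.
Proof.
move=> /hsumCP hf h; apply/ler_addgt0Pr => e e0; have [A hA] := hf e e0.
have := hA (A `|` A0)%fset (fsubsetUl _ _); have := h _ (fsubsetUr A A0).
set s := \sum_(i <- _) _ => h1 h2.
by rewrite -[X in nc X](subrK s) (le_trans (ncD _ _))// addrC lerD// ltW.
Qed.

Lemma hsum_complex_ge0 S (f : S -> C) l : (forall i, 0 <= f i) -> hsum f l -> 0 <= l.
Proof.
move=> f0 hf.
have e i : f i = (nc (f i))%:C%C by rewrite -normcEnc ger0_norm.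
have [m hm _] : exists2 m, hsum (fun i => nc (f i)) m & m <= nc l + 1.
  apply: hsum_bounded => [i|A]; first exact: nc_ge0.
  move/hsumCP: hf => /(_ 1 ltr01)[B hB].
  (* Adding [B] to [A] brings the partial sum within 1 of [l], and sums of nonnegative terms only
     grow under this enlargement. *)
  apply: (@le_trans _ _ (\sum_(i <- (B `|` A)%fset) nc (f i))).
    rewrite [leRHS](big_fsetID _ [pred x | x \in A]) /=.
    rewrite (_ : [fset x | x in (B `|` A)%fset & x \in A]%fset = A).
      by rewrite lerDl sumr_ge0// => i _; exact: nc_ge0.
    by apply/fsetP => x; rewrite !inE andbC /=; case: (x \in A) => //=; rewrite orbT.
  have -> : \sum_(i <- (B `|` A)%fset) nc (f i) = nc (\sum_(i <- (B `|` A)%fset) f i).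
    rewrite (eq_bigr (fun i => (nc (f i))%:C%C)) => [|i _]; last exact: e.
    by rewrite -rmorph_sum nc_real ger0_norm// sumr_ge0// => i _; exact: nc_ge0.
  have := hB (B `|` A)%fset (fsubsetUl _ _); set s := \sum_(i <- _) _ => h.
  have -> : s = l - (l - s) by ring.
  by apply: le_trans (ncB _ _) _; rewrite lerD2l ltW.
have := hsum_real_complex hm; under eq_fun do rewrite -e.
move=> /(hsum_unique hf) ->; rewrite lecR.
by apply: hsum_ge0 hm => i; exact: nc_ge0.
Qed.

End ComplexSums.

(** * Averages of bounded functions *)

Section Means.
Context {R : realType} {I : choiceType}.
Implicit Types (mu f g : I -> R) (M m c : R).

Lemma hsum_exchange (J : choiceType) (a : I -> J -> R) (r : I -> R) (c : J -> R) m :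
  (forall i j, 0 <= a i j) -> (forall i, hsum (a i) (r i)) ->
  (forall j, hsum (a ^~ j) (c j)) -> hsum r m -> hsum c m.
Proof.
move=> a0 hr hc hm.
have r0 i : 0 <= r i by apply: hsum_ge0 (hr i).
have c0 j : 0 <= c j by apply: hsum_ge0 (hc j).
apply/hsum_nneg => //; move/hsum_nneg: hm => /(_ r0) <-.
under eq_esum => j _.
  by rewrite -(((hsum_nneg (c j) (fun i => a0 i j)).1 (hc j))); over.
under [RHS]eq_esum => i _.
  by rewrite -(((hsum_nneg (r i) (a0 i)).1 (hr i))); over.
rewrite !esum_esum ?[RHS]esum_esum; try by move=> *; rewrite lee_fin.
rewrite (@reindex_esum R _ _ ([set: I] `*`` fun=> [set: J]) _ (fun k => (k.2, k.1)))//.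
split=> [[]//|[x1 x2] [y1 y2] _ _ [-> ->]//|[j i] _]; by exists (i, j).
Qed.

Definition mean mu f : R := usum (fun i => mu i * f i).

(** The mass is left free: [p] and the rows of [P] have mass 1, but the off-diagonal weights
    [overlap i j] of the entangled chain only have mass at most 1. *)
Definition weight mu m : Prop := (forall i, 0 <= mu i) /\ hsum mu m.

Lemma mean_hsum mu m f M : weight mu m -> (forall i, `|f i| <= M) ->
  hsum (fun i => mu i * f i) (mean mu f).
Proof.
move=> [mu0 hmu] fM; have [l hl _] : exists2 l, hsum (fun i => mu i * f i) l & `|l| <= M * m.
  apply: hsum_dominated (hsumZ (c := M) hmu) => i.
  by rewrite normrM (ger0_norm (mu0 i)) mulrC ler_wpM2r.
exact/usummable_hsum/(hsum_usummable hl).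
Qed.

Lemma meanE mu f l : hsum (fun i => mu i * f i) l -> mean mu f = l.
Proof. exact: hsum_usum. Qed.

Lemma mean_cst mu m c : weight mu m -> mean mu (fun=> c) = c * m.
Proof.
move=> [_ h]; apply: meanE; have := hsumZ (c := c) h.
by under eq_fun do rewrite mulrC.
Qed.

Lemma meanD mu m f g M : weight mu m -> (forall i, `|f i| <= M) ->
  (forall i, `|g i| <= M) -> mean mu (fun i => f i + g i) = mean mu f + mean mu g.
Proof.
move=> hmu hf hg; apply: meanE.
have := hsumD (mean_hsum hmu hf) (mean_hsum hmu hg).
by under eq_fun do rewrite -mulrDr.
Qed.

Lemma meanZ mu m c f M : weight mu m -> (forall i, `|f i| <= M) ->
  mean mu (fun i => c * f i) = c * mean mu f.
Proof.
move=> hmu hf; apply: meanE; have := hsumZ (c := c) (mean_hsum hmu hf).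
by under eq_fun do rewrite mulrCA.
Qed.

Lemma meanB mu m f g M : weight mu m -> (forall i, `|f i| <= M) ->
  (forall i, `|g i| <= M) -> mean mu (fun i => f i - g i) = mean mu f - mean mu g.
Proof.
move=> hmu hf hg; apply: meanE.
have := hsumB (mean_hsum hmu hf) (mean_hsum hmu hg).
by under eq_fun do rewrite -mulrBr.
Qed.

Lemma mean_sum mu m (J : Type) (s : seq J) (F : J -> I -> R) M : weight mu m ->
  (forall j i, `|F j i| <= M) ->
  mean mu (fun i => \sum_(j <- s) F j i) = \sum_(j <- s) mean mu (F j).
Proof.
move=> hmu hF; apply: meanE.
have := @hsum_sum R I J s (fun j i => mu i * F j i) _ (fun j => mean_hsum hmu (hF j)).
by under eq_fun do rewrite -mulr_sumr.
Qed.

Lemma mean_le mu m f g M : weight mu m -> (forall i, `|f i| <= M) ->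
  (forall i, `|g i| <= M) -> (forall i, 0 < mu i -> f i <= g i) ->
  mean mu f <= mean mu g.
Proof.
move=> hmu hf hg fg; apply: hsum_le (mean_hsum hmu hf) (mean_hsum hmu hg) => i.
have := hmu.1 i; rewrite le_eqVlt => /orP[/eqP <-|h]; first by rewrite !mul0r.
by rewrite ler_wpM2l ?(ltW h)// fg.
Qed.

Lemma mean_ge_term mu m f M j : weight mu m -> (forall i, 0 <= f i <= M) ->
  mu j * f j <= mean mu f.
Proof.
move=> hmu hf.
have := @hsum_nneg_le R I (fun i => mu i * f i) (mean mu f) [fset j]%fset.
rewrite big_seq_fset1; apply => [i|].
  by rewrite mulr_ge0 ?(hmu.1 i)//; case/andP: (hf i).
apply: (mean_hsum hmu (M := M)) => i; case/andP: (hf i) => h ?.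
by rewrite ger0_norm.
Qed.

Lemma mean_norm_le mu m f M : weight mu m -> (forall i, `|f i| <= M) ->
  `|mean mu f| <= M * m.
Proof.
move=> hmu hf; rewrite ler_norml -mulNr -!(mean_cst _ hmu).
have hM c : `|c| = `|M| -> forall i : I, `|c| <= `|M| by move=> ->.
have hf' i : `|f i| <= `|M| by apply: le_trans (hf i) _; exact: ler_norm.
rewrite !(mean_le hmu (M := `|M|)) ?normrN// => i _.
  by have := hf i; rewrite ler_norml => /andP[].
by have := hf i; rewrite ler_norml => /andP[].
Qed.

Lemma bounded01 f : (forall i, 0 <= f i <= 1) -> forall i, `|f i| <= 1.
Proof. by move=> h i; case/andP: (h i) => ? ?; rewrite ger0_norm. Qed.

Lemma mean01 mu f : weight mu 1 -> (forall i, 0 <= f i <= 1) -> 0 <= mean mu f <= 1.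
Proof.
move=> hmu hf; have h1 := bounded01 hf.
have := mean_norm_le hmu h1; rewrite mulr1 => /(le_trans (ler_norm _)) ->.
rewrite andbT; apply: hsum_ge0 (mean_hsum hmu h1) => i.
by rewrite mulr_ge0 ?(hmu.1 i)//; case/andP: (hf i).
Qed.

Lemma bounded_sqr f M : (forall i, `|f i| <= M) -> forall i, `|f i ^+ 2| <= M ^+ 2.
Proof.
by move=> h i; rewrite normrX ler_sqr ?nnegrE// (le_trans (normr_ge0 _) (h i)).
Qed.

(** The right-hand side is the variance of [f] under [mu], a sum of nonnegative terms of which the
    left-hand side is one. *)
Lemma variance_ge mu f M j : weight mu 1 -> (forall i, `|f i| <= M) ->
  mu j * (f j - mean mu f) ^+ 2 <= mean mu (fun i => f i ^+ 2) - mean mu f ^+ 2.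
Proof.
move=> hmu hf; set m := mean mu f.
have h : hsum (fun i => mu i * (f i - m) ^+ 2) (mean mu (fun i => f i ^+ 2) - m ^+ 2).
  apply: hsum_eq (hsumD (hsumB (mean_hsum hmu (bounded_sqr hf))
    (hsumZ (c := 2 * m) (mean_hsum hmu hf))) (hsumZ (c := m ^+ 2) hmu.2)) => [i|].
    by ring.
  by rewrite -/m; ring.
have := @hsum_nneg_le _ _ _ _ [fset j]%fset _ h; rewrite big_seq_fset1; apply => i.
by rewrite mulr_ge0 ?sqr_ge0 ?(hmu.1 i).
Qed.

Lemma norm_le_cvg0 (u v : nat -> R) : (forall n, `|u n| <= v n) ->
  v @ \oo --> 0 -> u @ \oo --> 0.
Proof.
move=> uv v0; apply/cvgr0Pnorm_lt => e e0; move/cvgr0Pnorm_lt: v0 => /(_ e e0).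
by apply: filterS => n; apply: le_lt_trans; apply: le_trans (uv n) (ler_norm _).
Qed.

Lemma cvg_sum0 (s : seq I) (u : I -> nat -> R) :
  (forall i, i \in s -> u i @ \oo --> 0) ->
  (fun n => \sum_(i <- s) u i n) @ \oo --> 0.
Proof.
elim: s => [|i s IH] h.
  by under eq_fun do rewrite big_nil; exact: cvg_cst.
under eq_fun do rewrite big_cons.
have h1 : u i @ \oo --> 0 by apply: h; rewrite inE eqxx.
have h2 : (fun n => \sum_(j <- s) u j n) @ \oo --> 0.
  by apply: IH => j js; apply: h; rewrite inE js orbT.
have h3 := cvgD h1 h2; rewrite addr0 in h3; exact: h3.
Qed.

Lemma mean_dominated_cvg0 mu m (g : nat -> I -> R) M : weight mu m ->
  (forall n i, `|g n i| <= M) -> (forall i, 0 < mu i -> g ^~ i @ \oo --> 0) ->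
  (fun n => mean mu (g n)) @ \oo --> 0.
Proof.
move=> hmu gM g0; apply/cvgr0Pnorm_lt => e e0.
have M0 : 0 <= `|M| by [].
pose d := e / (2 * (`|M| + 1)).
have d0 : 0 < d by rewrite divr_gt0// mulr_gt0// ltr_wpDl.
have [A hA] := (hsumP _ _).1 hmu.2 d d0.
have {}hA := hA A (fsubset_refl _).
have hs : (fun n => \sum_(i <- A) mu i * `|g n i|) @ \oo --> 0.
  apply: (@cvg_sum0 A (fun i n => mu i * `|g n i|)) => i _.
  have := hmu.1 i; rewrite le_eqVlt => /orP[/eqP <-|h].
    by under eq_fun do rewrite mul0r; exact: cvg_cst.
  rewrite -(mulr0 (mu i)); apply: cvgMr; apply/norm_cvg0P; exact: g0.
have e2 : 0 < e / 2 by lra.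
move/cvgr0Pnorm_lt: hs => /(_ _ e2); apply: filterS => n hn.
(* [h] majorises [mu i * |g n i|]: the true value on the finite set [A], the constant bound
   [|M| * mu i] on the tail, whose mass is below [d]. *)
pose h i := (if i \in A then mu i * `|g n i| else 0) +
  `|M| * (mu i - (if i \in A then mu i else 0)).
have hh : hsum h (\sum_(i <- A) mu i * `|g n i| + `|M| * (m - \sum_(i <- A) mu i)).
  have hif (k : I -> R) : hsum (fun i => if i \in A then k i else 0) (\sum_(i <- A) k i).
    apply: hsum_eq (@hsum_fin R I A (fun i => if i \in A then k i else 0) _) => //.
      by rewrite [RHS]big_seq big_seq; apply: eq_bigr => i ->.
    by move=> i /negbTE ->.
  by apply: hsumD; [exact: hif | apply: hsumZ; apply: hsumB; [exact: hmu.2 | exact: hif]].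
have gM' i : `|g n i| <= `|M| by apply: le_trans (gM n i) (ler_norm _).
have [l hl le_l] : exists2 l, hsum (fun i => mu i * g n i) l &
    `|l| <= \sum_(i <- A) mu i * `|g n i| + `|M| * (m - \sum_(i <- A) mu i).
  apply: hsum_dominated hh => i; rewrite normrM (ger0_norm (hmu.1 i)) /h.
  case: ifP => _; first by rewrite subrr mulr0 addr0.
  by rewrite subr0 add0r mulrC ler_wpM2r// (hmu.1 i).
rewrite (meanE hl); apply: le_lt_trans le_l _.
have h1 : \sum_(i <- A) mu i * `|g n i| < e / 2 by apply: le_lt_trans hn; exact: ler_norm.
have h2 : `|M| * (m - \sum_(i <- A) mu i) <= e / 2.
  apply: (@le_trans _ _ ((`|M| + 1) * d)).
    apply: (@le_trans _ _ (`|M| * d)); last by rewrite ler_wpM2r ?(ltW d0)// lerDl.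
    by rewrite ler_wpM2l// (le_trans (ler_norm _) (ltW hA)).
  by apply: le_of_eq; rewrite /d; field; rewrite gt_eqF// ltr_wpDl.
lra.
Qed.

Lemma mean_dominated_cvg mu m (g : nat -> I -> R) M c : weight mu m ->
  (forall n i, `|g n i| <= M) -> (forall i, 0 < mu i -> g ^~ i @ \oo --> c) ->
  (fun n => mean mu (g n)) @ \oo --> c * m.
Proof.
move=> hmu gM gc; have M0 : `|M| <= `|M| + `|c| by rewrite lerDl.
have gM' n i : `|g n i| <= `|M| + `|c|.
  by apply: le_trans M0; apply: le_trans (gM n i) (ler_norm _).
have c' (i : I) : `|c| <= `|M| + `|c| by rewrite lerDr.
apply/subr_cvg0.
rewrite (_ : (fun n => mean mu (g n) - c * m) = fun n => mean mu (fun i => g n i - c)).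
  apply: (mean_dominated_cvg0 hmu (M := `|M| + `|c| + `|c|)) => [n i|i /gc h].
    by apply: le_trans (ler_normB _ _) _; rewrite lerD2r.
  exact/subr_cvg0.
apply/funext => n; rewrite -(mean_cst _ hmu).
by rewrite (meanB hmu (gM' n) c').
Qed.

End Means.

(** * The classical chain: recurrence of the support and convergence of averages *)

Section NumericalSemigroup.
Variable N : nat -> Prop.
Hypothesis N0 : N 0.
Hypothesis ND : forall a b, N a -> N b -> N (a + b).

Lemma semigroupM q a : N a -> N (q * a).
Proof. by move=> Na; elim: q => [|q IH]; rewrite ?mul0n// mulSn; exact: ND. Qed.

(* The least positive difference [d] of two elements divides every element: otherwise the remainder modulo [d] would be a smaller difference. *)
Lemma semigroup_cofinite :
  (forall e : nat, (forall n, (0 < n)%N -> N n -> (e %| n)%N) -> (e %| 1)%N) ->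
  exists M, forall n, (M <= n)%N -> N n.
Proof.
move=> gcd1.
pose D d := `[< (0 < d)%N /\ exists a, N a /\ N (a + d) >].
have exD : exists d, D d.
  apply: contrapT => noD.
  (* Without a positive difference [N] has no positive element, and then 2 meets the hypothesis
     [gcd1] vacuously although it does not divide 1. *)
  suff h2 : forall n, (0 < n)%N -> N n -> (2 %| n)%N by have := gcd1 _ h2.
  by move=> n n0 Nn; exfalso; apply: noD; exists n; apply/asboolP; split=> //; exists 0%N.
have [d /asboolP[d0 [b [Nb Nbd]]] dmin] := ex_minnP exD.
have d1 : d = 1%N.
  apply/eqP; rewrite -dvdn1; apply: gcd1 => n n0 Nn.
  rewrite /dvdn; case: (posnP (n %% d)) => [//|r0].
  have : D (n %% d)%N.
    apply/asboolP; split => //; exists (n %/ d * (b + d))%N.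
    split; first exact: semigroupM.
    suff -> : (n %/ d * (b + d) + n %% d)%N = (n %/ d * b + n)%N.
      by apply: ND => //; exact: semigroupM.
    by rewrite mulnDr -addnA -divn_eq.
  by move/dmin; rewrite leqNgt ltn_pmod.
rewrite d1 addn1 in Nbd.
have [b0|b0] := posnP b.
  by exists 0%N => n _; rewrite -(muln1 n); apply: semigroupM; rewrite -b0 in Nbd *.
(* Past [b * b] the quotient of [n] by [b] is at least its remainder [r], so that [r] copies of [b]
   can be traded for copies of [b.+1]. *)
exists (b * b)%N => n le_n.
have qr : (n %% b <= n %/ b)%N.
  by rewrite (leq_trans (ltnW (ltn_pmod _ b0)))// leq_divRL.
suff -> : n = ((n %/ b - n %% b) * b + n %% b * b.+1)%N.
  by apply: ND; exact: semigroupM.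
by rewrite mulnS addnCA -mulnDl subnK// addnC -divn_eq.
Qed.

End NumericalSemigroup.

Section Chain.
Context {R : realType} {I : choiceType}.
Variables (P : I -> I -> R) (p : I -> R).
Hypotheses (hP : stochastic P) (hp : stationary P p).
Implicit Types (f b : I -> R) (i j k : I).

Definition Pop f : I -> R := fun i => mean (P i) f.

Definition dl j : I -> R := fun k => (k == j)%:R.

Definition in01 f : Prop := forall i, 0 <= f i <= 1.

Lemma weight_row i : weight (P i) 1.
Proof. by case: hP => P0 P1; split => //; apply/hsum_nneg => //; exact: P1. Qed.

Lemma weight_stationary : weight p 1.
Proof. by case: hp => p0 p1 _; split => //; exact/hsum_nneg. Qed.

Let P0 i j : 0 <= P i j. Proof. exact: (weight_row i).1. Qed.
Let p0 i : 0 <= p i. Proof. exact: weight_stationary.1. Qed.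

Lemma dl01 j : in01 (dl j).
Proof. by move=> i; rewrite /dl ler0n lern1 leq_b1. Qed.

Lemma Pop01 f : in01 f -> in01 (Pop f).
Proof. by move=> h i; apply: mean01 => //; exact: weight_row. Qed.

Lemma iter_Pop01 n f : in01 f -> in01 (iter n Pop f).
Proof. by move=> h; elim: n => //= n; exact: Pop01. Qed.

Lemma Pop_cst c : Pop (fun=> c) = fun=> c.
Proof. by apply/funext => i; rewrite /Pop (mean_cst _ (weight_row i)) mulr1. Qed.

Lemma mean_dl mu m j : weight mu m -> mean mu (dl j) = mu j.
Proof.
move=> hmu; apply: meanE; have := @hsum1 R I j (fun i => mu i * dl j i).
rewrite /dl eqxx mulr1; apply => i /negbTE ->; exact: mulr0.
Qed.

Lemma mean_stationary f : in01 f -> mean p (Pop f) = mean p f.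
Proof.
move=> f01; have f1 := bounded01 f01.
apply/esym/meanE.
apply: (@hsum_exchange R I I (fun i j => p i * (P i j * f j)) (fun i => p i * Pop f i)).
- by move=> i j; rewrite !mulr_ge0//; case/andP: (f01 j).
- move=> i; apply: hsumZ; exact: mean_hsum (weight_row i) f1.
- move=> j; case: hp => _ _ /(_ j) /(hsum_nneg _ _).2 hj.
  apply: hsum_eq (hsumZ (c := f j) (hj _)) => [i||i]; [ring|ring|].
  by rewrite mulr_ge0.
- exact: mean_hsum weight_stationary (bounded01 (Pop01 f01)).
Qed.

Lemma mean_iter_Pop n f : in01 f -> mean p (iter n Pop f) = mean p f.
Proof.
by move=> f01; elim: n => //= n <-; rewrite mean_stationary//; exact: iter_Pop01.
Qed.

Lemma step_probE n i j : step_prob P n i j = (iter n Pop (dl j) i)%:E.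
Proof.
elim: n i => //= n IH i; under eq_esum do rewrite IH -EFinM.
apply/hsum_nneg => [k|]; last exact: mean_hsum (weight_row i) (bounded01 (iter_Pop01 n (dl01 j))).
by rewrite mulr_ge0//; case/andP: (iter_Pop01 n (dl01 j) k).
Qed.

Lemma Pop_gt0 f i : in01 f ->
  (0 < Pop f i) <-> exists k, 0 < P i k /\ 0 < f k.
Proof.
move=> f01; split=> [h|[k [Pik fk]]]; last first.
  apply: lt_le_trans (mean_ge_term k (weight_row i) f01); exact: mulr_gt0.
apply: contrapT => no; move: h; rewrite /Pop (@meanE _ _ _ _ 0) ?ltxx//.
apply: hsum_eq hsum0 => // k; apply/esym/eqP; rewrite mulf_eq0.
apply/negPn/negP => /norP[h1 h2]; apply: no; exists k; rewrite !lt_def h1 h2 /=.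
by split=> //; case/andP: (f01 k).
Qed.

Definition steps n i j : Prop := 0 < iter n Pop (dl j) i.

Definition reach i j : Prop := exists n, steps n i j.

Lemma steps0 i j : steps 0 i j <-> i = j.
Proof.
by rewrite /steps /= /dl; split => [|->]; rewrite ?eqxx// ltr0n lt0b => /eqP.
Qed.

Lemma stepsS n i j : steps n.+1 i j <-> exists k, 0 < P i k /\ steps n k j.
Proof. exact: Pop_gt0 (iter_Pop01 _ (dl01 _)). Qed.

Lemma steps_trans n m i j k : steps n i j -> steps m j k -> steps (n + m) i k.
Proof.
elim: n i => [|n IH] i; first by move/steps0 => ->.
by move=> /stepsS[l [il lj]] jk; apply/stepsS; exists l; split=> //; exact: IH.
Qed.

Lemma reach_refl i : reach i i. Proof. by exists 0%N; apply/steps0. Qed.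

Lemma reach_trans i j k : reach i j -> reach j k -> reach i k.
Proof. by move=> [n ij] [m jk]; exists (n + m)%N; exact: steps_trans ij jk. Qed.

Lemma communicateE i j : communicate P i j <-> reach i j /\ reach j i.
Proof.
by split=> -[[n hn] [m hm]]; (split; [exists n|exists m]); move: hn hm;
  rewrite !step_probE !lte_fin.
Qed.

(* The indicator [h] of the states from which [i] can be reached satisfies [Pop h <= h], and stationarity turns this into an equality on the support of [p]. *)
Lemma support_edge i j : 0 < p i -> 0 < P i j -> 0 < p j /\ reach j i.
Proof.
move=> pi Pij; split.
  case: hp => _ _ /(_ j) /(hsum_nneg _ _).2 hj.
  have := @hsum_nneg_le R I (fun i => p i * P i j) (p j) [fset i]%fset.
  rewrite big_seq_fset1 => h; apply: lt_le_trans (h _ (hj _)) => [|k|k]; by rewrite ?mulr_gt0 ?mulr_ge0.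
pose h k : R := (`[< reach k i >])%:R.
have h01 : in01 h by move=> k; rewrite /h ler0n lern1 leq_b1.
have hle k : Pop h k <= h k.
  rewrite {2}/h; case: asboolP => [_|no]; first by case/andP: (Pop01 h01 k).
  rewrite leNgt; apply/negP => /(Pop_gt0 _ h01)[l [kl]].
  rewrite /h ltr0n lt0b => /asboolP li; apply: no; apply: reach_trans li.
  by exists 1%N; apply/stepsS; exists l; split=> //; apply/steps0.
have g01 k : 0 <= h k - Pop h k <= 1.
  by have := hle k; have := Pop01 h01 k; have := h01 k; move=> /andP[? ?] /andP[? ?] ?; apply/andP; split; lra.
(* [h - Pop h] is nonnegative with [p]-mean zero, hence vanishes at [i]. As [h i = 1], the row [P i]
   gives no mass to [1 - h], which forces [h j = 1]. *)
have := mean_ge_term i weight_stationary g01.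
rewrite (meanB weight_stationary (bounded01 h01) (bounded01 (Pop01 h01))) mean_stationary// subrr.
rewrite pmulr_rle0// {1}/h asboolT; last exact: reach_refl.
move=> h1; have g01' k : 0 <= 1 - h k <= 1.
  by have := h01 k => /andP[? ?]; apply/andP; split; lra.
have := mean_ge_term j (weight_row i) g01'.
rewrite (meanB (weight_row i) (M := 1) _ (bounded01 h01)) ?normr1//.
rewrite (mean_cst _ (weight_row i)) mul1r -/(Pop h i).
move=> h2; have : P i j * (1 - h j) <= 0 by apply: le_trans h2 h1.
rewrite pmulr_rle0// /h; case: asboolP => // _; rewrite subr0; lra.
Qed.

Lemma support_reach i j : 0 < p i -> reach i j -> 0 < p j /\ reach j i.
Proof.
move=> + [n]; elim: n i => [|n IH] i pi; first by move/steps0 => <-; split => //; exact: reach_refl.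
move=> /stepsS[k [ik kj]]; have [pk ki] := support_edge pi ik.
by have [pj jk] := IH k pk kj; split => //; exact: reach_trans jk ki.
Qed.

(** The dissipation dominates [p i * P i j * (f n j - Pop (f n) i) ^+ 2]: keep one state in the
    [p]-average, then one term of the row variance. Both weights are positive, so the square must
    vanish. *)
Lemma edge_cvg (f : nat -> I -> R) i j : (forall n, in01 (f n)) ->
  (fun n => mean p (fun k => f n k ^+ 2) - mean p (fun k => Pop (f n) k ^+ 2))
    @ \oo --> 0 ->
  0 < p i -> 0 < P i j -> (fun n => f n j - Pop (f n) i) @ \oo --> 0.
Proof.
move=> f01 h pi Pij.
have sq01 g : in01 g -> in01 (fun k => g k ^+ 2).
  by move=> h01 k; case/andP: (h01 k) => ? ?; rewrite sqr_ge0 expr_le1.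
have key n : p i * (P i j * (f n j - Pop (f n) i) ^+ 2) <=
    mean p (fun k => f n k ^+ 2) - mean p (fun k => Pop (f n) k ^+ 2).
  have v01 k : 0 <= Pop (fun k => f n k ^+ 2) k - Pop (f n) k ^+ 2 <= 1.
    apply/andP; split; last first.
      have /andP[_ h1] := Pop01 (sq01 _ (f01 n)) k.
      by have := sqr_ge0 (Pop (f n) k); lra.
    apply: le_trans (variance_ge k (weight_row k) (bounded01 (f01 n))).
    by rewrite mulr_ge0 ?sqr_ge0.
  have := mean_ge_term i weight_stationary v01.
  rewrite (meanB weight_stationary (bounded01 (Pop01 (sq01 _ (f01 n))))
    (bounded01 (sq01 _ (Pop01 (f01 n))))) mean_stationary; last exact: sq01.
  apply: le_trans; rewrite ler_wpM2l//.
  exact: variance_ge (weight_row i) (bounded01 (f01 n)).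
have c0 : 0 < p i * P i j by exact: mulr_gt0.
apply/cvgr0Pnorm_lt => e e0; move/cvgr0Pnorm_lt: h.
have d0 : 0 < p i * P i j * e ^+ 2 by rewrite mulr_gt0// exprn_gt0.
move=> /(_ _ d0); apply: filterS => n /(le_lt_trans (ler_norm _)) /(le_lt_trans (key n)).
rewrite mulrA ltr_pM2l// => h2.
by rewrite -(@ltr_pXn2r _ 2)// ?nnegrE ?(ltW e0)// -normrX ger0_norm// sqr_ge0.
Qed.

Section Connected.
Hypothesis conn : forall i j, 0 < p i -> 0 < p j -> reach i j.

(** Dominated convergence under [p] turns the vanishing of each difference into that of their
    average, which is [c - f n j]; differences of functions in [[0, 1]] supply the bound. *)
Lemma oscillation_cvg (f : nat -> I -> R) c j : (forall n, in01 (f n)) ->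
  (forall n, mean p (f n) = c) -> 0 < p j ->
  (forall k, 0 < p k -> (fun n => f n k - f n j) @ \oo --> 0) ->
  (fun n => f n j) @ \oo --> c.
Proof.
move=> f01 fc pj h.
have := mean_dominated_cvg0 weight_stationary (g := fun n k => f n k - f n j) (M := 2).
move=> /(_ _ h) H; have {}H : (fun n => c - f n j) @ \oo --> 0.
  rewrite (_ : (fun n => _) = fun n => mean p (fun k => f n k - f n j)).
    apply: H => n i; have := f01 n i; have := f01 n j => /andP[? ?] /andP[? ?].
    by rewrite ler_norml; apply/andP; split; lra.
  apply/funext => n; rewrite (meanB weight_stationary (M := 1)) ?fc.
  - by rewrite (mean_cst _ weight_stationary) mulr1.
  - exact: bounded01 (f01 n).
  - by move=> _; exact: bounded01 (f01 n) j.
have {}H : (fun n => c - (c - f n j)) @ \oo --> c - 0 by exact: (cvgB (cvg_cst c) H).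
rewrite subr0 in H; rewrite (_ : (fun n => f n j) = fun n => c - (c - f n j))//.
by apply/funext => n; ring.
Qed.

Definition cesaro_mean b n : I -> R :=
  fun i => (n.+1%:R)^-1 * \sum_(k < n.+1) iter k Pop b i.

Lemma cesaro_mean01 b n : in01 b -> in01 (cesaro_mean b n).
Proof.
move=> b01 i; have S0 : 0 <= \sum_(k < n.+1) iter k Pop b i.
  by apply: sumr_ge0 => k _; case/andP: (iter_Pop01 k b01 i).
rewrite /cesaro_mean mulr_ge0 ?invr_ge0//= mulrC ler_pdivrMr// mul1r.
rewrite -[X in _ <= X%:R]card_ord -sumr_const; apply: ler_sum => k _.
by case/andP: (iter_Pop01 k b01 i).
Qed.

(** The sums telescope: [Pop] moves a Cesaro mean by at most [1 / (n + 1)]. *)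
Lemma Pop_cesaro_mean b n i : in01 b ->
  Pop (cesaro_mean b n) i = cesaro_mean b n i + (n.+1%:R)^-1 * (iter n.+1 Pop b i - b i).
Proof.
move=> b01; have bd (m : nat) : forall i, `|iter m Pop b i| <= 1 by exact/bounded01/iter_Pop01.
rewrite /Pop /cesaro_mean (meanZ _ (weight_row i) (M := n.+1%:R)); last first.
  move=> l; apply: le_trans (ler_norm_sum _ _ _) _.
  by rewrite -[X in _ <= X%:R]card_ord -sumr_const; apply: ler_sum => k _.
rewrite -mulrDr; congr (_ * _).
rewrite (mean_sum _ (weight_row i) (M := 1) (fun k : 'I_n.+1 => bd k)).
rewrite [X in X + _]big_ord_recl /= [LHS]big_ord_recr /=.
by rewrite /bump /= [b i + _]addrC addrACA subrr addr0.
Qed.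

(** Because the means are almost fixed by [Pop], their dissipation vanishes and [Pop (f n) i] may be
    replaced by [f n i] on each edge. Paths of any length then compare values at the same time [n],
    whatever the period of the chain. *)
Lemma cesaro_mean_cvg b j : in01 b -> 0 < p j ->
  (fun n => cesaro_mean b n j) @ \oo --> mean p b.
Proof.
move=> b01 pj; pose f n := cesaro_mean b n.
have f01 n : in01 (f n) by exact: cesaro_mean01.
have close n i : `|Pop (f n) i - f n i| <= harmonic n :> R.
  rewrite Pop_cesaro_mean// addrC addKr normrM ger0_norm ?invr_ge0// ler_piMr ?invr_ge0//.
  have /andP[h1 h2] := iter_Pop01 n.+1 b01 i; have /andP[h3 h4] := b01 i.
  by rewrite ler_norml; apply/andP; split; lra.
have energy : (fun n => mean p (fun k => f n k ^+ 2) -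
    mean p (fun k => Pop (f n) k ^+ 2)) @ \oo --> 0.
  apply: (@norm_le_cvg0 _ _ (fun n => 2 * harmonic n)) => [n|].
    have fP := bounded01 (Pop01 (f01 n)); have fb := bounded01 (f01 n).
    rewrite -(meanB weight_stationary (M := 1)); last 2 first.
    - by move=> k; have := bounded_sqr fb k; rewrite expr1n.
    - by move=> k; have := bounded_sqr fP k; rewrite expr1n.
    rewrite -[leRHS]mulr1; apply: mean_norm_le weight_stationary _ => k.
    (* In the factored difference of squares one factor is at most [harmonic n], the other at most
       2. *)
    rewrite subr_sqr normrM mulrC ler_pM// 1?distrC ?close//.
    by rewrite (le_trans (ler_normD _ _))// -[leRHS]/(1 + 1) lerD.
  by rewrite -(mulr0 2); apply: cvgMr; exact: cvg_harmonic.
have edge i k : 0 < p i -> 0 < P i k -> (fun n => f n k - f n i) @ \oo --> 0.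
  move=> pi Pik.
  have h1 := edge_cvg f01 energy pi Pik.
  have h2 : (fun n => Pop (f n) i - f n i) @ \oo --> 0.
    by apply: norm_le_cvg0 (fun n => close n i) _; exact: cvg_harmonic.
  have h3 : (fun n => (f n k - Pop (f n) i) + (Pop (f n) i - f n i)) @ \oo --> 0 + 0.
    exact: (cvgD h1 h2).
  by under eq_fun => n do rewrite -(subrKA (Pop (f n) i)); rewrite addr0 in h3.
have path m : forall i k, 0 < p i -> steps m i k -> (fun n => f n k - f n i) @ \oo --> 0.
  elim: m => [|m IH] i k pi.
    by move/steps0 => ->; under eq_fun do rewrite subrr; exact: cvg_cst.
  move=> /stepsS[l [il lk]]; have [pl _] := support_edge pi il.
  have h3 : (fun n => (f n k - f n l) + (f n l - f n i)) @ \oo --> 0 + 0.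
    exact: (cvgD (IH _ _ pl lk) (edge _ _ pi il)).
  by under eq_fun => n do rewrite -(subrKA (f n l)); rewrite addr0 in h3.
apply: (@oscillation_cvg f) => // [n|k pk]; last first.
  by have [m jk] := conn pj pk; exact: path pj jk.
have bd (m : nat) : forall i, `|iter m Pop b i| <= 1 by exact/bounded01/iter_Pop01.
rewrite /f /cesaro_mean (meanZ _ weight_stationary (M := n.+1%:R)); last first.
  move=> l; apply: le_trans (ler_norm_sum _ _ _) _.
  by rewrite -[X in _ <= X%:R]card_ord -sumr_const; apply: ler_sum => k _.
rewrite (mean_sum _ weight_stationary (M := 1) (fun k : 'I_n.+1 => bd k)).
under eq_bigr do rewrite mean_iter_Pop//.
by rewrite sumr_const card_ord -[mean p b *+ _]mulr_natl mulKf ?pnatr_eq0.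
Qed.

Lemma jensen_Pop f : in01 f -> mean p (fun k => Pop f k ^+ 2) <= mean p (fun k => f k ^+ 2).
Proof.
move=> f01; have sq01 g : in01 g -> in01 (fun k => g k ^+ 2).
  by move=> h01 k; case/andP: (h01 k) => ? ?; rewrite sqr_ge0 expr_le1.
rewrite -(mean_stationary (sq01 _ f01)).
apply: mean_le weight_stationary (bounded01 (sq01 _ (Pop01 f01)))
  (bounded01 (Pop01 (sq01 _ f01))) _ => i _; rewrite -subr_ge0.
apply: le_trans (variance_ge i (weight_row i) (bounded01 f01)).
by rewrite mulr_ge0 ?sqr_ge0.
Qed.

(** Along the iterates the energy is nonincreasing by Jensen and bounded below, so it converges and
    its decrements, the dissipation, tend to zero. *)
Lemma iter_Pop_cvg b j : in01 b -> 0 < p j ->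
  (exists M, forall n, (M <= n)%N -> steps n j j) ->
  (fun n => iter n Pop b j) @ \oo --> mean p b.
Proof.
move=> b01 pj [M aper]; pose f n := iter n Pop b.
have f01 n : in01 (f n) by exact: iter_Pop01.
have energy : (fun n => mean p (fun k => f n k ^+ 2) -
    mean p (fun k => Pop (f n) k ^+ 2)) @ \oo --> 0.
  pose E n := mean p (fun k => f n k ^+ 2).
  have Ecvg : cvgn E.
    apply: nonincreasing_is_cvgn.
      apply/nonincreasing_seqP => n; exact: jensen_Pop.
    exists 0 => _ [n _ <-].
    have sq01 : in01 (fun k => f n k ^+ 2).
      by move=> k; case/andP: (f01 n k) => ? ?; rewrite sqr_ge0 expr_le1.
    by case/andP: (mean01 weight_stationary sq01).
  have E1 : (fun n => E n.+1) @ \oo --> limn E by rewrite cvg_shiftS.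
  have h : (fun n => E n - E n.+1) @ \oo --> limn E - limn E by exact: (cvgB Ecvg E1).
  by rewrite subrr in h.
have edge i k : 0 < p i -> 0 < P i k -> (fun n => f n k - f n.+1 i) @ \oo --> 0.
  exact: edge_cvg.
(* Each edge compares time [n] with time [n.+1], so a path of length [m] costs a time shift by
   [m]. *)
have path m : forall i k, 0 < p i -> steps m i k -> (fun n => f n k - f (n + m)%N i) @ \oo --> 0.
  elim: m => [|m IH] i k pi.
    by move/steps0 => ->; under eq_fun do rewrite addn0 subrr; exact: cvg_cst.
  move=> /stepsS[l [il lk]]; have [pl _] := support_edge pi il.
  have h2 : (fun n => f (n + m)%N l - f (n + m).+1 i) @ \oo --> 0.
    by have := edge _ _ pi il; rewrite -(cvg_shiftn m).
  have h3 : (fun n => (f n k - f (n + m)%N l) + (f (n + m)%N l - f (n + m).+1 i)) @ \oo --> 0 + 0.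
    exact: (cvgD (IH _ _ pl lk) h2).
  by under eq_fun => n do rewrite addnS -(subrKA (f (n + m)%N l)); rewrite addr0 in h3.
apply: (@oscillation_cvg f) => // [n|k pk]; first exact: mean_iter_Pop.
have [m jk] := conn pj pk.
(* Aperiodicity makes the time shifts cancel: a path from [j] to [k] and a loop at [j] of the same
   length [M + m] compare [f n k] and [f n j] with one and the same value. *)
have h1 := path _ _ _ pj (steps_trans (aper M (leqnn _)) jk).
have h2 := path _ _ _ pj (aper (M + m)%N (leq_addr _ _)).
have h3 : (fun n => (f n k - f (n + (M + m))%N j) - (f n j - f (n + (M + m))%N j)) @ \oo --> 0 - 0.
  exact: (cvgB h1 h2).
rewrite subr0 in h3; apply: cvg_trans h3; apply: near_eq_cvg.
by near=> n; ring.
Unshelve. all: by end_near. Qed.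

End Connected.
End Chain.

(** * Positive recurrence of the support and its communicating classes *)

Section Recurrence.
Context {R : realType} {I : choiceType}.
Variables (P : I -> I -> R) (p : I -> R).
Hypotheses (hP : stochastic P) (hp : stationary P p).
Implicit Types (f b : I -> R) (i j k : I) (L : set I).

Local Notation Pop := (Pop P).
Local Notation steps := (steps P).
Local Notation reach := (reach P).

Let P0 i j : 0 <= P i j. Proof. exact: (weight_row hP i).1. Qed.
Let p0 i : 0 <= p i. Proof. exact: (weight_stationary hp).1. Qed.

Definition taboo i f : I -> R := fun k => (k != i)%:R * f k.

(* [survival i n j] is the probability that the chain started at [j] avoids [i] at times 1, ..., n, and [hitting i n j] that it first hits [i] at time [n.+1]. *)
Definition survival i n : I -> R := iter n (fun f => Pop (taboo i f)) (fun=> 1).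

Definition hitting i n : I -> R := iter n (fun f => Pop (taboo i f)) (Pop (dl i)).

Arguments survival : simpl never.
Arguments hitting : simpl never.

Lemma taboo01 i f : in01 f -> in01 (taboo i f).
Proof.
move=> f01 k; rewrite /taboo; case: eqP => _; rewrite ?mul0r ?mul1r ?lexx ?ler01//.
Qed.

Lemma survival01 i n : in01 (survival i n).
Proof.
by elim: n => [k|n IH]; [rewrite ler01 lexx|exact/(Pop01 hP)/taboo01].
Qed.

Lemma hitting01 i n : in01 (hitting i n).
Proof.
by elim: n => [|n IH]; [exact/(Pop01 hP)/dl01|exact/(Pop01 hP)/taboo01].
Qed.

Lemma first_passageE i n j : first_passage P n.+1 j i = (hitting i n j)%:E.
Proof.
elim: n j => [|n IH] j.
  by rewrite /hitting /= /Pop (mean_dl _ (weight_row hP j)).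
transitivity (\esum_(k in [set k | k != i]) ((P j k)%:E * first_passage P n.+1 k i))%E => //.
rewrite esum_mkcond.
under eq_esum => k _.
  rewrite IH -EFinM (_ : (if _ then _ else _) = (P j k * taboo i (hitting i n) k)%:E); last first.
    rewrite /taboo; case: (eqVneq k i) => [->|ki]; last by rewrite mem_set// mul1r.
    by rewrite memNset ?mul0r ?mulr0//= eqxx.
  over.
have h01 := taboo01 i (hitting01 i n).
apply/hsum_nneg => [k|]; last exact: mean_hsum (weight_row hP j) (bounded01 h01).
by rewrite mulr_ge0//; case/andP: (h01 k).
Qed.

Lemma survivalS i n j : survival i n.+1 j + hitting i n j = survival i n j.
Proof.
elim: n j => [|n IH] j.
  rewrite /survival /hitting /= -(meanD (weight_row hP j) (M := 1)).
  - rewrite -[RHS](mulr1 1) -(mean_cst _ (weight_row hP j)).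
    congr (mean _ _); apply/funext => k.
    by rewrite /taboo /dl; case: eqP => _; rewrite /=; lra.
  - by apply/bounded01/taboo01 => k; rewrite ler01 lexx.
  - exact/bounded01/dl01.
rewrite /survival /hitting !iterS -(meanD (weight_row hP j) (M := 1)).
- congr (mean _ _); apply/funext => k.
  by rewrite /taboo -mulrDr; congr (_ * _); exact: IH.
- exact: (bounded01 (taboo01 i (survival01 i n.+1))).
- exact: (bounded01 (taboo01 i (hitting01 i n))).
Qed.

(* Kac's formula, as an inequality: stationarity gives [p i * survival i n i = u n - u n.+1] for [u n := mean p (survival i n)]. *)
Lemma sum_survival_le i n : p i * \sum_(k < n) survival i k i <= 1.
Proof.
pose u n := mean p (survival i n).
have uS m : u m.+1 = u m - p i * survival i m i.
  rewrite /u /survival iterS (mean_stationary hP hp); last exact: (taboo01 i (survival01 i m)).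
  have bd := bounded01 (survival01 i m).
  have -> : p i * survival i m i = mean p (fun k => survival i m i * dl i k).
    rewrite (meanZ _ (weight_stationary hp) (M := 1)); last exact/bounded01/dl01.
    by rewrite (mean_dl _ (weight_stationary hp)) mulrC.
  rewrite -(meanB (weight_stationary hp) (M := 1)) //.
    congr (mean _ _); apply/funext => k; rewrite /taboo /dl.
    by case: eqP => [->|_] /=; rewrite /survival; ring.
  move=> k; rewrite normrM -[leRHS]mulr1 ler_pM//.
  exact: bounded01 (dl01 i) k.
suff -> : p i * \sum_(k < n) survival i k i = u 0%N - u n.
  have /andP[h _] := mean01 (weight_stationary hp) (survival01 i n).
  by rewrite {1}/u /survival /= (mean_cst _ (weight_stationary hp)) mulr1; rewrite /u; lra.
elim: n => [|n IH]; first by rewrite big_ord0 mulr0 subrr.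
by rewrite big_ord_recr /= mulrDr IH uS; ring.
Qed.

Lemma survival_decr i n j : survival i n.+1 j <= survival i n j.
Proof. by rewrite -(survivalS i n j) lerDl; case/andP: (hitting01 i n j). Qed.

(** The survival probabilities decrease in [n], so Kac's bound on their sum gives the rate
    [1 / (p i * (n + 1))]. *)
Lemma survival_cvg i : 0 < p i -> (fun n => survival i n i) @ \oo --> 0.
Proof.
move=> pi.
have bd n : n.+1%:R * (p i * survival i n i) <= 1.
  apply: le_trans (sum_survival_le i n.+1).
  rewrite mulrCA ler_pM2l// mulr_natl -[in X in X <= _](card_ord n.+1) -sumr_const.
  apply: ler_sum => k _; have := leq_ord k.
  elim: n {k}(k : nat) => [[]//|n IH] k.
  rewrite leq_eqVlt => /orP[/eqP->//|]; rewrite ltnS => /IH.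
  exact: le_trans (survival_decr _ _ _).
apply: (@norm_le_cvg0 _ _ (fun n => (p i)^-1 * harmonic n)) => [n|].
  have /andP[h _] := survival01 i n i; rewrite ger0_norm// -invfM -[leRHS]mul1r ler_pdivlMr ?mulr_gt0//.
  by apply: le_trans (bd n); apply: le_of_eq; ring.
by rewrite -(mulr0 (p i)^-1); apply: cvgMr; exact: cvg_harmonic.
Qed.

(** First passages are decrements of [survival]. The first series telescopes to
    [1 - survival i n i]; summation by parts turns the second into a sum of survival probabilities
    minus a nonnegative term, bounded by [1 / p i]. *)
Lemma support_positive_recurrent i : 0 < p i -> positive_recurrent P i.
Proof.
move=> pi; split.
- have E n : (\sum_(1 <= k < n.+1) first_passage P k i i = (1 - survival i n i)%:E)%E.
    elim: n => [|n IH]; first by rewrite big_geq// /survival /= subrr.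
    rewrite big_nat_recr// IH first_passageE -[LHS]/(_ + _)%E -EFinD; congr _%:E.
    by rewrite -(survivalS i n i); ring.
  apply/cvg_lim => //; rewrite -cvg_shiftS.
  under eq_fun do rewrite E.
  apply: cvg_EFin; first by near=> n.
  have h : (fun n => 1 - survival i n i) @ \oo --> (1 - 0 : R).
    exact: (cvgB (cvg_cst _) (survival_cvg pi)).
  by rewrite subr0 in h.
- have E n : (\sum_(1 <= k < n.+1) (k%:R%:E * first_passage P k i i) =
      (\sum_(k < n) survival i k i - n%:R * survival i n i)%:E)%E.
    elim: n => [|n IH]; first by rewrite big_geq// big_ord0 mul0r subrr.
    rewrite big_nat_recr// IH first_passageE -[LHS]/(_ + _)%E -EFinM -EFinD; congr _%:E.
    rewrite big_ord_recr /= -(survivalS i n i) -natr1; ring.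
  apply: (@le_lt_trans _ _ (p i)^-1%:E); last exact: ltry.
  apply: lime_le.
    apply: is_cvg_nneseries => n n1 _; case: n n1 => // n _.
    by rewrite first_passageE -EFinM lee_fin mulr_ge0//; case/andP: (hitting01 i n i).
  apply: nearW => -[|n]; first by rewrite big_geq// lee_fin invr_ge0.
  rewrite E lee_fin; apply: (@le_trans _ _ (\sum_(k < n) survival i k i)).
    by rewrite gerBl mulr_ge0//; case/andP: (survival01 i n i).
  by rewrite -[leRHS]mulr1 ler_pdivlMl// sum_survival_le.
Unshelve. all: by end_near. Qed.

Lemma communicate_sym i j : communicate P i j -> communicate P j i.
Proof. by case. Qed.

Lemma communicate_trans i j k : communicate P i j -> communicate P j k -> communicate P i k.
Proof.
move=> /(communicateE hP)[ij ji] /(communicateE hP)[jk kj]; apply/(communicateE hP).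
by split; [exact: (reach_trans hP) jk|exact: (reach_trans hP) ji].
Qed.

Lemma communicate_class i k : communicate P i k ->
  [set j | communicate P i j] = [set j | communicate P k j].
Proof.
move=> ik; apply/seteqP; split=> j /=; apply: communicate_trans => //.
exact: communicate_sym.
Qed.

(** [Lambda] asks for a positive recurrent representative; Kac's bound provides one at every state
    of the support. *)
Lemma class_in_Lambda i : 0 < p i -> Lambda P p [set j | communicate P i j].
Proof.
move=> pi; split; first by exists i => //; exact: support_positive_recurrent.
apply: (@lt_le_trans _ _ (\esum_(k in [set i]) (p k)%:E)%E).
  by rewrite esum_set1 ?lee_fin ?lte_fin.
rewrite esum_mkcond [leRHS]esum_mkcond; apply: le_esum => k _.
rewrite in_set1; case: eqP => [->|_]; last by case: ifP; rewrite lee_fin.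
rewrite ifT// inE /=; apply/(communicateE hP); split; exact: (reach_refl).
Qed.

Lemma Lambda_class L : Lambda P p L ->
  exists2 i, 0 < p i & L = [set j | communicate P i j].
Proof.
move=> [[i0 _ ->] h]; have [i pi ii0] : exists2 i, 0 < p i & communicate P i0 i.
  apply: contrapT => no; move: h; rewrite esum1 ?ltxx// => i ci.
  congr _%:E; apply/eqP; have := p0 i; rewrite le_eqVlt => /orP[/eqP <-//|pi].
  by exfalso; apply: no; exists i.
by exists i => //; exact: communicate_class.
Qed.

Lemma Lambda_support L i : Lambda P p L -> L i -> 0 < p i.
Proof.
move=> /Lambda_class[k pk ->] /(communicateE hP)[ki _].
by have [] := support_reach hP hp pk ki.
Qed.

Lemma Lambda_eq L i : Lambda P p L -> L i -> L = [set j | communicate P i j].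
Proof. by move=> /Lambda_class[k pk ->]; exact: communicate_class. Qed.

Lemma Lambda_closed L i j : Lambda P p L -> L i -> 0 < P i j -> L j.
Proof.
move=> hL Li Pij; have pi := Lambda_support hL Li.
rewrite (Lambda_eq hL Li); apply/(communicateE hP).
have [_ ji] := support_edge hP hp pi Pij; split=> //; exists 1%N.
by apply/(stepsS hP); exists j; split => //; apply/steps0.
Qed.

(** A class in [Lambda] is closed, so paths starting in it never leave it and the powers of the
    block agree with those of [P]. *)
Lemma step_prob_block L n (i j : L) : Lambda P p L ->
  step_prob (block P (L := L)) n i j = step_prob P n (val i) (val j).
Proof.
move=> hL; elim: n i => [|n IH] i /=; first by rewrite val_eqE.
transitivity (\esum_(k in [set: L]) ((P (val i) (val k))%:E * step_prob P n (val k) (val j)))%E.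
  by apply: eq_esum => k _; congr (_ * _)%E; exact: IH.
rewrite -(@reindex_esum R _ _ [set: L] L val
  (fun k => (P (val i) k)%:E * step_prob P n k (val j))%E); last first.
  split=> [[k kL] _ /=|k l _ _ /val_inj//|k Lk]; first exact: set_mem kL.
  by exists (exist _ k (mem_set Lk)).
rewrite [LHS]esum_mkcond; apply: eq_esum => k _; case: ifPn => // /negP kL.
have := P0 (val i) k; rewrite le_eqVlt => /orP[/eqP <-|Pik]; first by rewrite mul0e.
by case: kL; apply/mem_set; apply: Lambda_closed hL _ Pik; exact: set_mem (valP i).
Qed.

Lemma aperiodic_block L : Lambda P p L ->
  aperiodic (block P (L := L)) <->
  forall i, L i -> forall e : nat,
    (forall n, (0 < n)%N -> steps n i i -> (e %| n)%N) -> (e %| 1)%N.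
Proof.
move=> hL; split=> [ap i Li e h|ap i e].
  have := ap (exist _ i (mem_set Li)) e => -[_]; apply => n n0.
  by rewrite step_prob_block// step_probE// lte_fin; exact: h.
split=> [|h]; first by rewrite dvdn1 => /eqP -> n _ _; exact: dvd1n.
apply: (ap (val i) (set_mem (valP i))) => n n0 hn; apply: h => //.
by rewrite step_prob_block// step_probE// lte_fin.
Qed.

Lemma aperiodic_eventually i :
  (forall e : nat, (forall n, (0 < n)%N -> steps n i i -> (e %| n)%N) -> (e %| 1)%N) ->
  exists M, forall n, (M <= n)%N -> steps n i i.
Proof.
apply: semigroup_cofinite; first exact/steps0.
by move=> a b; exact: (steps_trans hP).
Qed.

Lemma Lambda_unique L : Lambda P p = [set L] ->
  forall i j, 0 < p i -> 0 < p j -> reach i j.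
Proof.
move=> e i j pi pj; have := class_in_Lambda pi; have := class_in_Lambda pj.
rewrite e /= => <- h; have : [set j | communicate P i j] j.
  by rewrite h; apply/(communicateE hP); split; exact: reach_refl.
by move=> /(communicateE hP)[].
Qed.

End Recurrence.

(** * Bounded matrices *)

Section BoundedMatrices.
Context {R : realType}.
Local Notation C := R[i].
Local Notation nc := ComplexField.Normc.normc.
Implicit Types (S T U : choiceType) (M N : R).

(* The factor [M / 2] and the sum of squares, instead of a product of norms, make this bound additive in [A] and over orthogonal blocks, while rescaling [u] and [v] recovers the operator norm. *)
Definition opb S T (A : @mat R S T) M : Prop :=
  0 <= M /\ forall (F : {fset S}) (G : {fset T}) (u : S -> C) (v : T -> C),
    nc (\sum_(s <- F) \sum_(t <- G) u s * A s t * v t) <=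
    M / 2 * (\sum_(s <- F) nc (u s) ^+ 2 + \sum_(t <- G) nc (v t) ^+ 2).

(** At [r = M^-1] half of [Y] on the right is absorbed by the left-hand side, which leaves the
    quadratic bound; [M = 0] is settled by [r = 1]. *)
Lemma rescale_le (Y N M : R) : 0 <= Y -> 0 <= N -> 0 <= M ->
  (forall r, 0 < r -> r * Y <= M / 2 * (r ^+ 2 * Y + N)) -> Y <= M ^+ 2 * N.
Proof.
move=> Y0 N0; rewrite le_eqVlt => /orP[/eqP <-|M0] h.
  by have := h 1 ltr01; rewrite !mul0r mul1r expr0n mul0r.
have Mi : 0 < M^-1 by rewrite invr_gt0.
have := h _ Mi.
have -> : M / 2 * (M^-1 ^+ 2 * Y + N) = M^-1 * (Y / 2 + M ^+ 2 * N / 2).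
  by field; rewrite gt_eqF.
by rewrite ler_pM2l// => ?; lra.
Qed.

Definition l2le S (v : S -> C) N : Prop :=
  forall F : {fset S}, \sum_(s <- F) nc (v s) ^+ 2 <= N.

Lemma l2leP S (v : S -> C) N : (l2norm2 v <= N%:E)%E <-> l2le v N.
Proof.
split=> [h F|h].
  rewrite -lee_fin; apply: le_trans h; apply: esum_ge; exists [set` F] => //.
  by rewrite fsbig_finite//= set_fsetK sumEFin.
apply: ge_ereal_sup => _ [F [finF _] <-].
by rewrite fsbig_finite//= sumEFin lee_fin.
Qed.

Lemma l2le_ge0 S (v : S -> C) N : l2le v N -> 0 <= N.
Proof. by move=> /(_ fset0); rewrite big_seq_fset0. Qed.

Lemma l2P S (v : S -> C) : l2 v -> exists2 N, l2norm2 v = N%:E & l2le v N.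
Proof.
move=> hv; have fn : l2norm2 v \is a fin_num.
  by rewrite ge0_fin_numE//; apply: esum_ge0 => s _; rewrite lee_fin sqr_ge0.
by exists (fine (l2norm2 v)); [rewrite fineK|apply/l2leP; rewrite fineK].
Qed.

Lemma l2le_l2 S (v : S -> C) N : l2le v N -> l2 v.
Proof. by move=> /l2leP h; apply: le_lt_trans h (ltry _). Qed.

Lemma l2le_hsum S (v : S -> C) N : l2le v N ->
  exists2 l, hsum (fun s => nc (v s) ^+ 2) l & l <= N.
Proof. by move=> h; apply: hsum_bounded => // s; exact: sqr_ge0. Qed.

Lemma l2le_mul_hsum S (x y : S -> C) N N' : l2le x N -> l2le y N' ->
  hsum (fun s => x s * y s) (usum (fun s => x s * y s)).
Proof.
move=> /l2le_hsum[a ha _] /l2le_hsum[b hb _].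
have [l hl _] : exists2 l, hsum (fun s => x s * y s) l & nc l <= a + b.
  apply: hsum_complex_dominated (hsumD ha hb) => s; rewrite ncM.
  by have := nc_ge0 (x s); have := nc_ge0 (y s); nra.
exact/usummable_hsum/(hsum_usummable hl).
Qed.

Lemma opb_le S T (A : @mat R S T) M N : M <= N -> opb A M -> opb A N.
Proof.
move=> MN [M0 h]; split; first exact: le_trans MN.
move=> F G u v; apply: le_trans (h F G u v) _; rewrite ler_wpM2r//.
  by rewrite addr_ge0// sumr_ge0// => *; exact: sqr_ge0.
by rewrite ler_pM2r.
Qed.

Lemma opb_rescaled S T (A : @mat R S T) M (F : {fset S}) (G : {fset T}) u v (r : R) :
  opb A M -> 0 < r ->
  r * nc (\sum_(s <- F) \sum_(t <- G) u s * A s t * v t) <=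
    M / 2 * (r ^+ 2 * \sum_(s <- F) nc (u s) ^+ 2 + \sum_(t <- G) nc (v t) ^+ 2).
Proof.
move=> [M0 h] r0; have := h F G (fun s => r%:C%C * u s) v.
rewrite [X in nc X](_ : _ = r%:C%C * \sum_(s <- F) \sum_(t <- G) u s * A s t * v t).
  rewrite ncM nc_real gtr0_norm// => h1; apply: le_trans h1 _.
  apply: le_of_eq; congr (_ * (_ + _)).
  by rewrite mulr_sumr; apply: eq_bigr => s _; rewrite ncM nc_real gtr0_norm// exprMn.
rewrite mulr_sumr; apply: eq_bigr => s _; rewrite mulr_sumr; apply: eq_bigr => t _.
by rewrite !mulrA.
Qed.

(** Testing the form against the conjugate of [A v] turns it into the squared norm of [A v];
    [rescale_le] then removes that norm from the right-hand side. *)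
Lemma opb_l2fin S T (A : @mat R S T) M (F : {fset S}) (G : {fset T}) v : opb A M ->
  \sum_(s <- F) nc (\sum_(t <- G) A s t * v t) ^+ 2 <= M ^+ 2 * \sum_(t <- G) nc (v t) ^+ 2.
Proof.
move=> hA; set y := fun s => \sum_(t <- G) A s t * v t.
apply: rescale_le => [||//|r r0]; [by apply: sumr_ge0 => *; exact: sqr_ge0..|exact: hA.1|].
have := opb_rescaled F G (fun s => (y s)^*%C) v hA r0.
rewrite [X in nc X](_ : _ = (\sum_(s <- F) nc (y s) ^+ 2)%:C%C).
  rewrite nc_real ger0_norm ?sumr_ge0// => [h1|*]; last exact: sqr_ge0.
  apply: le_trans h1 _; apply: le_of_eq; congr (_ * (_ * _ + _)).
  by apply: eq_bigr => s _; rewrite nc_conj.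
rewrite rmorph_sum; apply: eq_bigr => s _; rewrite /= nc_sqr' {2}/y mulr_sumr.
by apply: eq_bigr => t _; rewrite mulrA.
Qed.

(** Converse of [opb_l2fin], by the weighted inequality [2 |u| |y| <= M |u|^2 + M^-1 |y|^2]; for
    [M = 0] the vector [y] vanishes. *)
Lemma opb_of_l2fin S T (A : @mat R S T) M : 0 <= M ->
  (forall (F : {fset S}) (G : {fset T}) v,
    \sum_(s <- F) nc (\sum_(t <- G) A s t * v t) ^+ 2 <= M ^+ 2 * \sum_(t <- G) nc (v t) ^+ 2) ->
  opb A M.
Proof.
move=> M0 h; split=> // F G u v.
pose y s := \sum_(t <- G) A s t * v t.
have -> : \sum_(s <- F) \sum_(t <- G) u s * A s t * v t = \sum_(s <- F) u s * y s.
  by apply: eq_bigr => s _; rewrite mulr_sumr; apply: eq_bigr => t _; rewrite mulrA.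
apply: le_trans (nc_sum _ _ _) _; have {}h := h F G v.
move: M0; rewrite le_eqVlt => /orP[/eqP M0|M0].
  move: h; rewrite -M0 expr0n mul0r mul0r mul0r => h.
  have y0 s : s \in F -> nc (y s) = 0.
    move=> sF; apply/eqP; rewrite -(@sqrf_eq0 R) eq_le sqr_ge0 andbT.
    apply: le_trans h; rewrite (big_fsetD1 s sF) /= lerDl.
    by apply: sumr_ge0 => *; exact: sqr_ge0.
  by rewrite big_seq big1// => s sF; rewrite ncM y0// mulr0.
apply: (@le_trans _ _ (\sum_(s <- F) (M / 2 * nc (u s) ^+ 2 + (2 * M)^-1 * nc (y s) ^+ 2))).
  apply: ler_sum => s _; rewrite ncM -subr_ge0.
  have -> : M / 2 * nc (u s) ^+ 2 + (2 * M)^-1 * nc (y s) ^+ 2 - nc (u s) * nc (y s) =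
    (2 * M)^-1 * (M * nc (u s) - nc (y s)) ^+ 2 by field; rewrite gt_eqF.
  by rewrite mulr_ge0 ?sqr_ge0// invr_ge0 mulr_ge0// ltW.
rewrite big_split /= -!mulr_sumr mulrDr lerD2l.
apply: (@le_trans _ _ ((2 * M)^-1 * (M ^+ 2 * \sum_(t <- G) nc (v t) ^+ 2))).
  by rewrite ler_wpM2l// invr_ge0 mulr_ge0// ltW.
by apply: le_of_eq; field; rewrite gt_eqF.
Qed.

(** Applied to its own conjugate, a finite piece of the row of squared norm [X] gives
    [X ^+ 2 <= M ^+ 2 * X]. *)
Lemma opb_row S T (A : @mat R S T) M s : opb A M -> l2le (A s) (M ^+ 2).
Proof.
move=> hA G; set X := (X in X <= _).
have X0 : 0 <= X by apply: sumr_ge0 => *; exact: sqr_ge0.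
have := opb_l2fin [fset s]%fset G (fun t => (A s t)^*%C) hA.
rewrite big_seq_fset1 (_ : \sum_(t <- G) A s t * (A s t)^*%C = X%:C%C); last first.
  by rewrite /X rmorph_sum; apply: eq_bigr => t _; rewrite /= nc_sqr.
rewrite (eq_bigr (fun t => nc (A s t) ^+ 2)) => [|t _]; last by rewrite nc_conj.
rewrite -/X nc_real ger0_norm// [X ^+ 2]expr2.
move: X0; rewrite le_eqVlt => /orP[/eqP <- _|X0]; first exact: sqr_ge0.
by rewrite ler_pM2r.
Qed.

Lemma opb_col S T (A : @mat R S T) M t : opb A M -> l2le (A ^~ t) (M ^+ 2).
Proof.
move=> hA F; have := opb_l2fin F [fset t]%fset (fun _ => 1) hA.
rewrite big_seq_fset1 nc1 expr1n mulr1; apply: le_trans.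
by apply: ler_sum => s _; rewrite big_seq_fset1 mulr1.
Qed.

Lemma opb_apply_hsum S T (A : @mat R S T) M v N s : opb A M -> l2le v N ->
  hsum (fun t => A s t * v t) (mat_apply A v s).
Proof. by move=> hA hv; exact: l2le_mul_hsum (opb_row s hA) hv. Qed.

(** With [F] fixed, the rescaled bilinear bound passes to the limit over finite sets of columns;
    rescaling is done after the limit, so no exchange of infinite sums occurs. *)
Lemma opb_apply S T (A : @mat R S T) M v N : opb A M -> l2le v N ->
  l2le (mat_apply A v) (M ^+ 2 * N).
Proof.
move=> hA hv F; set y := mat_apply A v.
have N0 := l2le_ge0 hv.
apply: rescale_le => [|//||r r0]; [by apply: sumr_ge0 => *; exact: sqr_ge0|exact: hA.1|].
have h : hsum (fun t => \sum_(s <- F) (y s)^*%C * (A s t * v t))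
    (\sum_(s <- F) (y s)^*%C * y s).
  by apply: hsum_sum => s; apply: hsumZ; exact: opb_apply_hsum hA hv.
have key : nc (r%:C%C * (\sum_(s <- F) (y s)^*%C * y s)) <=
    M / 2 * (r ^+ 2 * (\sum_(s <- F) nc (y s) ^+ 2) + N).
  apply: (nc_le_hsum (A0 := fset0) (hsumZ (c := r%:C%C) h)) => G _.
  have h1 := opb_rescaled F G (fun s => (y s)^*%C) v hA r0.
  rewrite -mulr_sumr ncM nc_real gtr0_norm// exchange_big /=.
  have -> : \sum_(s <- F) \sum_(t <- G) (y s)^*%C * (A s t * v t) =
    \sum_(s <- F) \sum_(t <- G) (y s)^*%C * A s t * v t.
    by apply: eq_bigr => s _; apply: eq_bigr => t _; rewrite mulrA.
  apply: le_trans h1 _; rewrite ler_wpM2l ?divr_ge0 ?hA.1//.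
  rewrite (eq_bigr (fun s => nc (y s) ^+ 2)) => [|s _]; last by rewrite nc_conj.
  by rewrite lerD2l; exact: hv.
move: key; rewrite (_ : \sum_(s <- F) (y s)^*%C * y s = (\sum_(s <- F) nc (y s) ^+ 2)%:C%C).
  rewrite ncM !nc_real !ger0_norm ?(ltW r0)//.
  by apply: sumr_ge0 => *; exact: sqr_ge0.
by rewrite rmorph_sum; apply: eq_bigr => s _; rewrite /= nc_sqr'.
Qed.

(** Translates the operator norm of the statement, tested on all of [l2], into finite bilinear
    bounds: one direction extends finite vectors by zero, the other is [opb_apply]. *)
Lemma norm_leP S T (A : @mat R S T) M : norm_le A M <-> opb A M.
Proof.
split=> [[M0 h]|hA].
  apply: opb_of_l2fin => // F G v.
  pose v' t := if t \in G then v t else 0.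
  have hv : l2le v' (\sum_(t <- G) nc (v t) ^+ 2).
    move=> B; apply: (@le_trans _ _ (\sum_(t <- (B `|` G)%fset) nc (v' t) ^+ 2)).
      rewrite [leRHS](big_fsetID _ [pred x | x \in B]) /=.
      rewrite (_ : [fset x | x in (B `|` G)%fset & x \in B]%fset = B).
        by rewrite lerDl sumr_ge0// => *; exact: sqr_ge0.
      by apply/fsetP => x; rewrite !inE andbC /=; case: (x \in B).
    rewrite -(@big_fset_incl _ _ _ _ G) ?fsubsetUr//; last first.
      by move=> t _ /negbTE tG; rewrite /v' tG nc0 expr0n.
    by apply: le_of_eq; rewrite big_seq [RHS]big_seq; apply: eq_bigr => t tG; rewrite /v' tG.
  have [hs hn] := h v' (l2le_l2 hv).
  have {}hn : l2le (mat_apply A v') (M ^+ 2 * \sum_(t <- G) nc (v t) ^+ 2).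
    apply/l2leP; apply: le_trans hn _; rewrite (EFinM (M ^+ 2)) lee_wpmul2l ?lee_fin ?sqr_ge0//.
    exact/l2leP.
  have := hn F; congr (_ <= _); apply: eq_bigr => s _; congr (nc _ ^+ 2).
  have := @hsum_fin _ _ G (fun t => A s t * v' t) _.
  move=> /(_ _)/hsum_usum E; rewrite /mat_apply E; last first.
    by move=> t /negbTE tG; rewrite /v' tG mulr0.
  by rewrite big_seq [RHS]big_seq; apply: eq_bigr => t tG; rewrite /v' tG.
split; first exact: hA.1.
move=> v /l2P[N Nv hv]; split=> [s|].
  exact: (hsum_usummable (opb_apply_hsum (s := s) hA hv)).
by rewrite Nv -EFinM; apply/l2leP; exact: opb_apply hA hv.
Qed.

Lemma boundedP S T (A : @mat R S T) : bounded A <-> exists M, opb A M.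
Proof. by split=> -[M /norm_leP hM]; exists M. Qed.

Lemma opb_entry S T (A : @mat R S T) M s t : opb A M -> nc (A s t) <= M.
Proof.
move=> [_ /(_ [fset s]%fset [fset t]%fset (fun=> 1) (fun=> 1))].
by rewrite !big_seq_fset1 nc1 expr1n mul1r mulr1 -[1 + 1]/2%:R divfK.
Qed.

Lemma opb_add S T (A B : @mat R S T) M N : opb A M -> opb B N -> opb (mat_add A B) (M + N).
Proof.
move=> [M0 hA] [N0 hB]; split; first exact: addr_ge0.
move=> F G u v; rewrite mulrDl mulrDl.
apply: le_trans (lerD (hA F G u v) (hB F G u v)).
apply: le_trans (ncD _ _); rewrite -big_split /=.
apply: le_of_eq; congr nc; apply: eq_bigr => s _; rewrite -big_split; apply: eq_bigr => t _ /=.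
by rewrite /mat_add mulrDr mulrDl.
Qed.

Lemma opb_scale S T (A : @mat R S T) M c : opb A M -> opb (mat_scale c A) (nc c * M).
Proof.
move=> [M0 hA]; split; first by rewrite mulr_ge0 ?nc_ge0.
move=> F G u v; have -> : \sum_(s <- F) \sum_(t <- G) u s * mat_scale c A s t * v t =
    c * \sum_(s <- F) \sum_(t <- G) u s * A s t * v t.
  rewrite mulr_sumr; apply: eq_bigr => s _; rewrite mulr_sumr; apply: eq_bigr => t _.
  by rewrite /mat_scale; ring.
by rewrite ncM -!mulrA ler_wpM2l ?nc_ge0// mulrA.
Qed.

Lemma mat_subE S T (A B : @mat R S T) : mat_sub A B = mat_add A (mat_scale (-1) B).
Proof. by apply/funext => s; apply/funext => t; rewrite /mat_add /mat_scale mulN1r. Qed.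

Lemma opb_sub S T (A B : @mat R S T) M N : opb A M -> opb B N -> opb (mat_sub A B) (M + N).
Proof.
move=> hA hB; rewrite mat_subE; apply: opb_add hA _.
by have := opb_scale (-1) hB; rewrite ncN nc1 mul1r.
Qed.

Lemma opb_adj S T (A : @mat R S T) M : opb A M -> opb (mat_adj A) M.
Proof.
move=> [M0 hA]; split=> // F G u v.
have := hA G F (fun t => (v t)^*%C) (fun s => (u s)^*%C).
rewrite exchange_big /= -nc_conj rmorph_sum addrC.
under eq_bigr do rewrite nc_conj; under [X in _ + X]eq_bigr do rewrite nc_conj.
congr (_ <= _); congr nc; apply: eq_bigr => s _; rewrite rmorph_sum.
by apply: eq_bigr => t _; rewrite !rmorphM /= !conjcK /mat_adj; ring.
Qed.

Lemma opb_reindex S T S' T' (A : @mat R S T) M (f : S' -> S) (g : T' -> T) :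
  injective f -> injective g -> opb A M -> opb (fun s t => A (f s) (g t)) M.
Proof.
move=> fI gI [M0 hA]; split=> // F G u v.
have ext (X Y : choiceType) (k : X -> Y) (w : X -> C) : injective k ->
    exists w' : Y -> C, forall x, w' (k x) = w x.
  move=> kI; exists (fun y => if pselect (exists x, k x = y) is left h then w (sval (cid h)) else 0).
  move=> x; case: pselect => [h|[]]; last by exists x.
  by case: (cid h) => z /= /kI ->.
have [u' hu] := ext _ _ f u fI; have [v' hv] := ext _ _ g v gI.
have := hA [fset f s | s in F]%fset [fset g t | t in G]%fset u' v'.
rewrite !big_imfset /=; try by move=> ? ? _ _; exact: fI || exact: gI.
under [X in nc X <= _]eq_bigr => s _.
  rewrite big_imfset /=; last by move=> ? ? _ _; exact: gI.
  under eq_bigr do rewrite hu hv.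
  over.
by under [X in _ * (X + _)]eq_bigr do rewrite hu; under [X in _ * (_ + X)]eq_bigr do rewrite hv.
Qed.

Lemma mat_mul_hsum S T U (A : @mat R S T) (B : @mat R T U) M N s u :
  opb A M -> opb B N -> hsum (fun t => A s t * B t u) (mat_mul A B s u).
Proof. by move=> hA hB; exact: l2le_mul_hsum (opb_row s hA) (opb_col u hB). Qed.

Lemma opb_mul S T U (A : @mat R S T) (B : @mat R T U) M N :
  opb A M -> opb B N -> opb (mat_mul A B) (M * N).
Proof.
move=> hA hB; apply: opb_of_l2fin; first by rewrite mulr_ge0 ?hA.1 ?hB.1.
move=> F G v; pose z k := \sum_(t <- G) B k t * v t.
have hz : l2le z (N ^+ 2 * \sum_(t <- G) nc (v t) ^+ 2).
  by move=> K; exact: opb_l2fin.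
rewrite exprMn -mulrA; apply: le_trans (opb_apply hA hz F).
apply: le_of_eq; apply: eq_bigr => s _; congr (nc _ ^+ 2).
apply: hsum_unique (opb_apply_hsum (s := s) hA hz).
apply: hsum_eq (@hsum_sum _ _ _ G (fun t k => v t * (A s k * B k t))
  (fun t => v t * mat_mul A B s t) _) => [k||t].
- by rewrite /z mulr_sumr; apply: eq_bigr => t _; ring.
- by apply: eq_bigr => t _; rewrite mulrC.
- by apply: hsumZ; exact: mat_mul_hsum hA hB.
Qed.

Lemma opb_diag S (d : S -> C) M : 0 <= M -> (forall s, nc (d s) <= M) ->
  opb (fun s t => d s * (s == t)%:R) M.
Proof.
move=> M0 hd; apply: opb_of_l2fin => // F G v.
have E s : \sum_(t <- G) d s * (s == t)%:R * v t = if s \in G then d s * v s else 0.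
  case: ifPn => sG; last first.
    rewrite big_seq big1// => t tG; case: eqP => [e|_]; last by rewrite mulr0 mul0r.
    by rewrite e tG in sG.
  rewrite (big_fsetD1 s sG) /= eqxx mulr1 big_seq big1 ?addr0// => t.
  by rewrite !inE eq_sym => /andP[/negbTE -> _]; rewrite mulr0 mul0r.
under eq_bigr do rewrite E.
apply: (@le_trans _ _ (\sum_(s <- F) if s \in G then M ^+ 2 * nc (v s) ^+ 2 else 0)).
  apply: ler_sum => s _; case: ifP => _; last by rewrite nc0 expr0n.
  by rewrite ncM exprMn ler_wpM2r ?sqr_ge0// ler_sqr ?nnegrE ?nc_ge0.
rewrite -big_mkcond /= big_fset_condE /= mulr_sumr.
set H := [fset _ | _ in _ & _]%fset.
rewrite [leRHS](big_fsetID _ [pred x | x \in F]) /=.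
rewrite (_ : [fset x | x in G & x \in F]%fset = H).
  by rewrite lerDl sumr_ge0// => *; rewrite mulr_ge0 ?sqr_ge0.
by apply/fsetP => x; rewrite !inE andbC.
Qed.

(** A bilinear form on finite sets involves finitely many entries, so entrywise convergence is
    enough to keep the bound. *)
Lemma opb_lim S T (A : @mat R S T) M (An : nat -> @mat R S T) :
  0 <= M ->
  (forall s t (e : R), 0 < e -> exists m, forall n, (m <= n)%N -> nc (A s t - An n s t) < e) ->
  (forall n, opb (An n) M) -> opb A M.
Proof.
move=> M0 hlim hA; split=> // F G u v; apply/ler_addgt0Pr => e e0.
suff [n hn] : exists n, nc (\sum_(s <- F) \sum_(t <- G) u s * A s t * v t -
    \sum_(s <- F) \sum_(t <- G) u s * An n s t * v t) <= e.
  set X := \sum_(s <- F) _ in hn *; set Y := \sum_(s <- F) _ in hn.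
  have -> : X = Y + (X - Y) by ring.
  by apply: le_trans (ncD _ _) _; apply: lerD hn; exact: (hA n).2.
have small (d : R) : 0 < d -> exists m, forall n, (m <= n)%N ->
    forall s t, s \in F -> t \in G -> nc (A s t - An n s t) < d.
  move=> d0; have allst (st : seq (S * T)) : exists m, forall n, (m <= n)%N ->
      forall x, x \in st -> nc (A x.1 x.2 - An n x.1 x.2) < d.
    elim: st => [|x st [m hm]]; first by exists 0%N.
    have [m' hm'] := hlim x.1 x.2 d d0; exists (maxn m m') => n.
    rewrite geq_max => /andP[mn m'n] y; rewrite inE => /orP[/eqP ->|]; first exact: hm'.
    exact: hm.
  have [m hm] := allst [seq (s, t) | s <- F, t <- G]; exists m => n mn s t sF tG.
  by apply: (hm n mn (s, t)); apply/allpairsP; exists (s, t).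
pose W := \sum_(s <- F) \sum_(t <- G) nc (u s) * nc (v t).
have W0 : 0 <= W by apply: sumr_ge0 => s _; apply: sumr_ge0 => t _; rewrite mulr_ge0 ?nc_ge0.
have d0 : 0 < e / (W + 1) by rewrite divr_gt0// ltr_wpDl.
have [m hm] := small _ d0; exists m.
rewrite -sumrB; apply: le_trans (nc_sum _ _ _) _.
apply: (@le_trans _ _ (W * (e / (W + 1)))); last first.
  rewrite mulrA ler_pdivrMr ?ltr_wpDl// mulrC ler_pM2l//; lra.
rewrite /W mulr_suml big_seq [leRHS]big_seq; apply: ler_sum => s sF.
rewrite -sumrB; apply: le_trans (nc_sum _ _ _) _.
rewrite mulr_suml big_seq [leRHS]big_seq; apply: ler_sum => t tG.
rewrite -mulrBl -mulrBr !ncM -mulrA mulrCA mulrC ler_wpM2l ?mulr_ge0 ?nc_ge0//.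
exact: ltW (hm m (leqnn _) s t sF tG).
Qed.

End BoundedMatrices.

Lemma mat_adjE (R : realType) (S T : choiceType) (A : @mat R S T) t s :
  mat_adj A t s = ((A s t)^*)%C.
Proof. by []. Qed.

Section MatrixAlgebra.
Context {R : realType} {S : choiceType}.
Local Notation C := R[i].
Local Notation nc := ComplexField.Normc.normc.
Local Notation mat := (@mat R S S).
Implicit Types (A B D : mat) (c : C) (M N : R).

Lemma mat_adjK A : mat_adj (mat_adj A) = A.
Proof. by apply/funext => s; apply/funext => t; rewrite !mat_adjE; exact: conjcK. Qed.

Lemma mat_adj_add A B : mat_adj (mat_add A B) = mat_add (mat_adj A) (mat_adj B).
Proof. by apply/funext => s; apply/funext => t; rewrite /mat_add !mat_adjE; exact: rmorphD. Qed.

Lemma mat_adj_sub A B : mat_adj (mat_sub A B) = mat_sub (mat_adj A) (mat_adj B).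
Proof. by apply/funext => s; apply/funext => t; rewrite /mat_sub !mat_adjE; exact: rmorphB. Qed.

Lemma mat_adj_scale c A : mat_adj (mat_scale c A) = mat_scale (c^*)%C (mat_adj A).
Proof. by apply/funext => s; apply/funext => t; rewrite /mat_scale !mat_adjE; exact: rmorphM. Qed.

Lemma mat_mul_adj A B M N : opb A M -> opb B N ->
  mat_adj (mat_mul A B) = mat_mul (mat_adj B) (mat_adj A).
Proof.
move=> hA hB; apply/funext => s; apply/funext => t.
rewrite [RHS]/mat_mul; apply/esym/hsum_usum.
apply: hsum_eq (hsum_conj (mat_mul_hsum (s := t) (u := s) hA hB)) => // k.
by rewrite rmorphM mulrC.
Qed.

Lemma mat_mulDl A B D M N : opb A M -> opb B M -> opb D N ->
  mat_mul (mat_add A B) D = mat_add (mat_mul A D) (mat_mul B D).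
Proof.
move=> hA hB hD; apply/funext => s; apply/funext => t; apply: hsum_usum.
apply: hsum_eq (hsumD (mat_mul_hsum (s := s) (u := t) hA hD)
  (mat_mul_hsum (s := s) (u := t) hB hD)) => // k.
by rewrite /mat_add mulrDl.
Qed.

Lemma mat_mulDr A B D M N : opb A M -> opb B M -> opb D N ->
  mat_mul D (mat_add A B) = mat_add (mat_mul D A) (mat_mul D B).
Proof.
move=> hA hB hD; apply/funext => s; apply/funext => t; apply: hsum_usum.
apply: hsum_eq (hsumD (mat_mul_hsum (s := s) (u := t) hD hA)
  (mat_mul_hsum (s := s) (u := t) hD hB)) => // k.
by rewrite /mat_add mulrDr.
Qed.

Lemma mat_mulZl c A D M N : opb A M -> opb D N ->
  mat_mul (mat_scale c A) D = mat_scale c (mat_mul A D).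
Proof.
move=> hA hD; apply/funext => s; apply/funext => t; apply: hsum_usum.
apply: hsum_eq (hsumZ (c := c) (mat_mul_hsum (s := s) (u := t) hA hD)) => // k.
by rewrite /mat_scale mulrA.
Qed.

Lemma mat_mulZr c A D M N : opb A M -> opb D N ->
  mat_mul D (mat_scale c A) = mat_scale c (mat_mul D A).
Proof.
move=> hA hD; apply/funext => s; apply/funext => t; apply: hsum_usum.
apply: hsum_eq (hsumZ (c := c) (mat_mul_hsum (s := s) (u := t) hD hA)) => // k.
by rewrite /mat_scale mulrCA.
Qed.

Definition diagm (d : S -> C) : mat := fun s t => d s * (s == t)%:R.

Lemma mat_id_diagm : @mat_id R S = diagm (fun=> 1).
Proof. by apply/funext => s; apply/funext => t; rewrite /diagm mul1r. Qed.

Lemma opb_diagm d M : 0 <= M -> (forall s, nc (d s) <= M) -> opb (diagm d) M.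
Proof. exact: opb_diag. Qed.

Lemma opb_id : opb (@mat_id R S) 1.
Proof. by rewrite mat_id_diagm; apply: opb_diagm => // s; rewrite nc1. Qed.

Lemma mul_diagm d A s t : mat_mul (diagm d) A s t = d s * A s t.
Proof.
apply: hsum_usum; apply: hsum_eq (@hsum1 _ _ s (fun k => diagm d s k * A k t) _) => //.
  by rewrite /diagm eqxx mulr1.
by move=> k /negbTE sk; rewrite /diagm eq_sym sk mulr0 mul0r.
Qed.

Lemma mul_mat_diagm d A s t : mat_mul A (diagm d) s t = A s t * d t.
Proof.
apply: hsum_usum; apply: hsum_eq (@hsum1 _ _ t (fun k => A s k * diagm d k t) _) => //.
  by rewrite /diagm eqxx mulr1.
by move=> k /negbTE kt; rewrite /diagm kt !mulr0.
Qed.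


Lemma mat_mul1 A : mat_mul A (@mat_id R S) = A.
Proof.
by rewrite mat_id_diagm; apply/funext => s; apply/funext => t; rewrite mul_mat_diagm mulr1.
Qed.

Lemma mat_1mul A : mat_mul (@mat_id R S) A = A.
Proof.
by rewrite mat_id_diagm; apply/funext => s; apply/funext => t; rewrite mul_diagm mul1r.
Qed.

(* Products with diagonal matrices are the only instances of associativity that are needed; no double sum has to be exchanged. *)
Lemma diagm_mulA d A B M N : opb A M -> opb B N ->
  mat_mul (mat_mul (diagm d) A) B = mat_mul (diagm d) (mat_mul A B).
Proof.
move=> hA hB; apply/funext => s; apply/funext => t; rewrite mul_diagm.
apply: hsum_usum; apply: hsum_eq (hsumZ (c := d s) (mat_mul_hsum (s := s) (u := t) hA hB)) => // k.
by rewrite mul_diagm mulrA.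
Qed.

Lemma mul_diagmA d A B M N : opb A M -> opb B N ->
  mat_mul A (mat_mul B (diagm d)) = mat_mul (mat_mul A B) (diagm d).
Proof.
move=> hA hB; apply/funext => s; apply/funext => t; rewrite mul_mat_diagm mulrC.
apply: hsum_usum; apply: hsum_eq (hsumZ (c := d t) (mat_mul_hsum (s := s) (u := t) hA hB)) => // k.
by rewrite mul_mat_diagm mulrA mulrC.
Qed.

Lemma diagm_mul d d' : mat_mul (diagm d) (diagm d') = diagm (fun s => d s * d' s).
Proof.
apply/funext => s; apply/funext => t; rewrite mul_diagm /diagm mulrA.
by case: eqP => [->//|_]; rewrite !mulr0.
Qed.

Lemma mat_adj_diagm d : mat_adj (diagm d) = diagm (fun s => (d s)^*%C).
Proof.
apply/funext => s; apply/funext => t; rewrite mat_adjE /diagm rmorphM eq_sym rmorph_nat.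
by case: eqP => [->//|_]; rewrite !mulr0.
Qed.

(** Serves to obtain exact identities from approximations with geometrically decaying error. *)
Lemma opb_eq0 A (c : R) : (forall n, opb A (c * 2^-1 ^+ n)) -> A = fun _ _ => 0.
Proof.
move=> h; apply/funext => s; apply/funext => t; apply: nc_eq0.
apply/eqP; rewrite eq_le nc_ge0 andbT.
have h0 : (fun n => c * 2^-1 ^+ n) @ \oo --> c * 0.
  by apply: cvgMr; apply: cvg_expr; rewrite ger0_norm ?invr_ge0// invf_lt1// ltr1n.
rewrite mulr0 in h0; apply: (cvgr_to_ge h0).
by apply: nearW => n; exact: opb_entry.
Qed.

End MatrixAlgebra.

Section Blocks.
Context {R : realType}.
Local Notation nc := ComplexField.Normc.normc.

(** [A] is block diagonal, each block being a compression of [a]. The label [r], the coordinate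
    [res] and the inverse [ov] describe the blocks. The bound is additive because every index occurs
    in exactly one block. *)
Lemma opb_blocks (S T K : choiceType) (A : @mat R S S) (a : @mat R T T) (M : R)
    (r : S -> K) (res : S -> T) (ov : K -> T -> S) :
  (forall s, ov (r s) (res s) = s) ->
  (forall s t, A s t = if r s == r t then a (res s) (res t) else 0) ->
  opb a M -> opb A M.
Proof.
move=> ovK hA [M0 ha]; split=> // F G u v.
have -> : \sum_(s <- F) \sum_(t <- G) u s * A s t * v t =
    \sum_(k <- [fset r s | s in F]%fset) \sum_(s <- F | r s == k)
      \sum_(t <- G | r t == k) u s * a (res s) (res t) * v t.
  rewrite (partition_big_imfset _ r) /=; apply: eq_bigr => k _; apply: eq_bigr => s /eqP rs.
  rewrite [RHS]big_mkcond; apply: eq_bigr => t _; rewrite hA rs eq_sym.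
  by case: ifP => _ //; rewrite mulr0 mul0r.
apply: le_trans (nc_sum _ _ _) _.
have block k : nc (\sum_(s <- F | r s == k) \sum_(t <- G | r t == k)
      u s * a (res s) (res t) * v t) <=
    M / 2 * (\sum_(s <- F | r s == k) nc (u s) ^+ 2 + \sum_(t <- G | r t == k) nc (v t) ^+ 2).
  have reind (V : nmodType) (B : {fset S}) (h : S -> V) : \sum_(s <- B | r s == k) h s =
      \sum_(x <- [fset res s | s in [fset s in B | r s == k]]%fset) h (ov k x).
    rewrite big_imfset /=; last first.
      move=> s t; rewrite !inE => /andP[_ /eqP rs] /andP[_ /eqP rt] E.
      by rewrite -(ovK s) -(ovK t) rs rt E.
    rewrite big_fset_condE /= big_seq [RHS]big_seq; apply: eq_bigr => s.
    by rewrite !inE => /andP[_ /eqP <-]; rewrite ovK.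
  have resK (B : {fset S}) x : x \in [fset res s | s in [fset s in B | r s == k]]%fset -> res (ov k x) = x.
    by move=> /imfsetP[s /=]; rewrite !inE => /andP[_ /eqP <-] ->; rewrite ovK.
  under eq_bigr do rewrite reind.
  rewrite !reind; apply: le_trans (ha _ _ (fun x => u (ov k x)) (fun x => v (ov k x))).
  apply: le_of_eq; congr nc; rewrite big_seq [RHS]big_seq; apply: eq_bigr => x /resK ->.
  by rewrite big_seq [RHS]big_seq; apply: eq_bigr => y /resK ->.
apply: (@le_trans _ _ (\sum_(k <- [fset r s | s in F]%fset) M / 2 *
    (\sum_(s <- F | r s == k) nc (u s) ^+ 2 + \sum_(t <- G | r t == k) nc (v t) ^+ 2))).
  by apply: ler_sum => k _; exact: block.
rewrite -mulr_sumr big_split /= -(partition_big_imfset _ r) ler_wpM2l ?divr_ge0// lerD2l.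
(* The sum runs over labels met by [F]; terms of [G] with another label only enlarge the right-hand
   side. *)
rewrite (exchange_big_dep xpredT) //=; apply: ler_sum => t _.
have [rt|rt] := boolP (r t \in [fset r s | s in F]%fset).
  rewrite big_mkcond (big_fsetD1 _ rt) /= eqxx big1_seq ?addr0// => k /andP[_].
  by rewrite in_fsetD1 eq_sym => /andP[/negbTE -> _].
rewrite big_seq_cond big1 ?sqr_ge0// => k /andP[kF /eqP e].
by rewrite e kF in rt.
Qed.

End Blocks.

(** * Local and quasi-local operators *)

Section Local.
Context {R : realType} {I : choiceType}.
Local Notation C := R[i].
Local Notation nc := ComplexField.Normc.normc.
Local Notation conf := (int -> I).
Local Notation cmat := (@mat R conf conf).
Implicit Types (J K : {fset int}) (X Y A B : cmat) (s t u : conf) (c : C) (M N e : R).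

Definition agree_off J s t : Prop := forall x, x \notin J -> s x = t x.

Definition restr J s : J -> I := fun j => s (val j).
Arguments restr : clear implicits.

Definition glue J s (x : J -> I) : conf := fun n => if insub n is Some j then x j else s n.

Lemma glue_in J s x n (nJ : n \in J) : glue s x n = x [` nJ]%fset.
Proof. by rewrite /glue insubT. Qed.

Lemma glue_out J s (x : J -> I) n : n \notin J -> glue s x n = s n.
Proof. by move=> nJ; rewrite /glue insubN. Qed.

Lemma restr_glue J s (x : J -> I) : restr J (glue s x) = x.
Proof.
apply/funext => j; rewrite /restr glue_in ?fsvalP// => h.
by congr x; apply: val_inj.
Qed.

Lemma glue_restr J s t : agree_off J s t -> glue s (restr J t) = t.
Proof.
move=> h; apply/funext => n; have [nJ|nJ] := boolP (n \in J); first by rewrite glue_in.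
by rewrite glue_out// h.
Qed.

Lemma glue_inj J s : injective (@glue J s).
Proof. by move=> x y /(congr1 (restr J)); rewrite !restr_glue. Qed.

Lemma agree_off_glue J s (x : J -> I) : agree_off J s (glue s x).
Proof. by move=> n nJ; rewrite glue_out. Qed.

Lemma agree_offP J s t z : agree_off J s t <-> glue s (restr J z) = glue t (restr J z).
Proof.
split=> [h|h n nJ].
  apply/funext => n; have [nJ|nJ] := boolP (n \in J); first by rewrite !glue_in.
  by rewrite !glue_out// h.
by have := congr1 (@^~ n) h; rewrite /= !glue_out.
Qed.

(** Describes the range of [embed] through the entries of [X] alone, which makes stability under
    products, adjoints and enlargement of [J] direct. Boundedness is kept apart; [local_algebraP]
    joins the two. *)
Definition localm J X : Prop :=
  (forall s t, X s t != 0 -> agree_off J s t) /\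
  (forall s t s' t', agree_off J s t -> agree_off J s' t' ->
     restr J s = restr J s' -> restr J t = restr J t' -> X s t = X s' t').

Lemma embedE J (a : @mat R (J -> I) (J -> I)) s t :
  agree_off J s t -> embed a s t = a (restr J s) (restr J t).
Proof. by move=> h; rewrite /embed asboolT. Qed.

Lemma embed_eq0 J (a : @mat R (J -> I) (J -> I)) s t :
  ~ agree_off J s t -> embed a s t = 0.
Proof. by move=> h; rewrite /embed asboolF. Qed.

Lemma localm_embed J (a : @mat R (J -> I) (J -> I)) : localm J (embed a).
Proof.
split=> [s t|s t s' t' h h' e e'].
  by apply: contra_neqP => /(embed_eq0 a).
by rewrite !embedE// e e'.
Qed.

(** Configurations that agree outside [J] form a block on which [embed a] is a copy of [a].
    Resetting the coordinates in [J] to those of a fixed [z] gives each block a label; an empty [I]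
    leaves no [z] and is treated apart. *)
Lemma opb_embed J (a : @mat R (J -> I) (J -> I)) M : opb a M -> opb (embed a) M.
Proof.
move=> ha; have [[z _]|no] := pselect (exists z : conf, True); last first.
  split=> [|F G u v]; first exact: ha.1.
  by rewrite !big1 ?nc0 ?addr0 ?mulr0// => s; exfalso; apply: no; exists s.
apply: (@opb_blocks R _ _ conf _ a M (fun s => glue s (restr J z)) (restr J) (@glue J)) => //.
  move=> s; rewrite -[RHS](@glue_restr J (glue s (restr J z)))// => n nJ; exact: glue_out.
move=> s t; case: eqP => [/agree_offP h|h]; first by rewrite embedE.
by rewrite embed_eq0// => /agree_offP.
Qed.

Lemma localm_local_algebra J X : localm J X -> bounded X -> local_algebra J X.
Proof.
move=> [X0 Xl] /boundedP[M hM]; have [[z _]|no] := pselect (exists z : conf, True); last first.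
  exists (fun _ _ => 0); last by apply/funext => s; exfalso; apply: no; exists s.
  apply/boundedP; exists 0; split=> // F G u v; rewrite !mul0r big1 ?nc0// => s _.
  by rewrite big1// => t _; rewrite mulr0 mul0r.
exists (fun x y => X (glue z x) (glue z y)).
  by apply/boundedP; exists M; apply: opb_reindex hM; exact: glue_inj.
apply/funext => s; apply/funext => t; have [h|h] := pselect (agree_off J s t).
  rewrite embedE//; apply: Xl; rewrite ?restr_glue// => n nJ.
  by rewrite !glue_out.
by rewrite embed_eq0//; apply/eqP; apply: contrapT => /negP/X0.
Qed.

Lemma local_algebraP J X : local_algebra J X <-> localm J X /\ bounded X.
Proof.
split=> [[a /boundedP[M ha] ->]|[h1 h2]]; last exact: localm_local_algebra.
by split; [exact: localm_embed|apply/boundedP; exists M; exact: opb_embed].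
Qed.

Lemma localm_mono J K X : (J `<=` K)%fset -> localm J X -> localm K X.
Proof.
move=> JK [X0 Xl]; have off s t : agree_off J s t -> agree_off K s t.
  by move=> h n nK; apply: h; apply: contra nK; exact: (fsubsetP JK).
have restrW s t : restr K s = restr K t -> restr J s = restr J t.
  move=> h; apply/funext => j; have jK : val j \in K by apply: (fsubsetP JK); exact: fsvalP.
  exact: (congr1 (@^~ [` jK]%fset) h).
split=> [s t /X0/off//|s t s' t' h h' e e'].
have key a b a' b' : agree_off K a b -> agree_off K a' b' -> restr K a = restr K a' ->
    restr K b = restr K b' -> agree_off J a b -> agree_off J a' b'.
  move=> ab ab' ea eb hJ n nJ; have [nK|nK] := boolP (n \in K); last exact: ab'.
  have := congr1 (@^~ [` nK]%fset) ea; have := congr1 (@^~ [` nK]%fset) eb.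
  by rewrite /restr /= => <- <-; exact: hJ.
have [hJ|hJ] := pselect (agree_off J s t).
  by apply: Xl => //; [exact: key hJ|exact: restrW|exact: restrW].
rewrite (_ : X s t = 0); last by apply/eqP; apply: contrapT => /negP/X0.
rewrite (_ : X s' t' = 0)//; apply/eqP; apply: contrapT => /negP/X0 hJ'.
by apply: hJ; exact: (key s' t').
Qed.

Lemma localm_lin J X Y c : localm J X -> localm J Y -> localm J (mat_add (mat_scale c X) Y).
Proof.
move=> [X0 Xl] [Y0 Yl]; split=> [s t|s t s' t' h h' e e'].
  rewrite /mat_add /mat_scale; apply: contra_neqP => h.
  rewrite (_ : X s t = 0) 1?(_ : Y s t = 0) ?mulr0 ?addr0//.
    by apply/eqP; apply: contrapT => /negP/Y0.
  by apply/eqP; apply: contrapT => /negP/X0.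
by rewrite /mat_add /mat_scale (Xl s t s' t')// (Yl s t s' t').
Qed.

Lemma localm_adj J X : localm J X -> localm J (mat_adj X).
Proof.
move=> [X0 Xl]; split=> [s t|s t s' t' h h' e e'].
  rewrite mat_adjE; apply: contra_neqP => h.
  rewrite (_ : X t s = 0) ?rmorph0//; apply/eqP; apply: contrapT => /negP/X0 h'.
  by apply: h => n nJ; rewrite h'.
by rewrite !mat_adjE (Xl t s t' s')// => n nJ; rewrite (h, h').
Qed.

Lemma localm_mul J X Y : localm J X -> localm J Y -> localm J (mat_mul X Y).
Proof.
move=> [X0 Xl] [Y0 Yl].
have X0' s t : ~ agree_off J s t -> X s t = 0.
  by move=> h; apply/eqP; apply: contrapT => /negP/X0.
(* A nonzero entry of [X] preserves the coordinates off [J], so the intermediate configuration is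
   determined by its restriction to [J]. *)
have E s u : mat_mul X Y s u = usum (fun x : J -> I => X s (glue s x) * Y (glue s x) u).
  rewrite /mat_mul (usum_inj (@glue_inj J s))// => t h.
   rewrite X0' ?mul0r// => st; apply: (h (restr J t)); exact: glue_restr.
split=> [s t|s t s' t' h h' e e'].
  apply: contra_neqP => h; apply: hsum_usum; apply: hsum_eq hsum0 => // u /=.
  have [su|su] := pselect (agree_off J s u); last by rewrite X0' ?mul0r.
  rewrite (_ : Y u t = 0) ?mulr0//; apply/eqP; apply: contrapT => /negP/Y0 ut.
  by apply: h => n nJ; rewrite su// ut.
rewrite !E; congr usum; apply/funext => x; congr (_ * _).
  by apply: Xl; rewrite ?restr_glue//; exact: agree_off_glue.
by apply: Yl; rewrite ?restr_glue// => n nJ; rewrite glue_out// (h, h').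
Qed.

Lemma localm_diagm J (d : conf -> C) :
  (forall s t, restr J s = restr J t -> d s = d t) -> localm J (diagm d).
Proof.
move=> hd; split=> [s t|s t s' t' h h' e e'].
  by rewrite /diagm; case: (s =P t) => [->//|_]; rewrite mulr0 eqxx.
rewrite /diagm (hd _ _ e); congr (_ * (nat_of_bool _)%:R).
have key a b a' b' : agree_off J a' b' -> restr J a = restr J a' ->
    restr J b = restr J b' -> a = b -> a' = b'.
  move=> ab' ea eb ab; rewrite -(glue_restr ab') -eb -ab ea glue_restr//.
by apply/eqP/eqP; [exact: key|apply: key].
Qed.

Definition translate (n : int) s : conf := fun x => s (x + n)%R.

Lemma translate_inj n : injective (translate n).
Proof.
move=> s t h; apply/funext => x; have := congr1 (@^~ (x - n)) h.
by rewrite /translate /= subrK.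
Qed.

Lemma iter_shiftE n X s t : iter n Defs.shift X s t = X (translate n%:Z s) (translate n%:Z t).
Proof.
elim: n s t => [|n IH] s t /=.
  by congr X; apply/funext => x; rewrite /translate addr0.
rewrite /Defs.shift IH; congr X; apply/funext => x; rewrite /translate -addrA;
  by rewrite [_%:Z + 1]addrC -intS.
Qed.

Lemma opb_shift X M : opb X M -> opb (Defs.shift X) M.
Proof. exact: (@opb_reindex R _ _ _ _ X M (translate 1) (translate 1) (@translate_inj 1) (@translate_inj 1)). Qed.

Lemma localm_shift J X : localm J X -> localm [fset (x + 1)%R | x in J]%fset (Defs.shift X).
Proof.
move=> [X0 Xl]; set J' := [fset (x + 1)%R | x in J]%fset.
have off s t : agree_off J (translate 1 s) (translate 1 t) <-> agree_off J' s t.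
  split=> h x xJ.
    have := h (x - 1); rewrite /translate subrK; apply; apply: contra xJ => xJ.
    by apply/imfsetP; exists (x - 1) => //; rewrite subrK.
  apply: h; apply: contra xJ => /imfsetP[y /= yJ /addIr ->//].
have rst s t : restr J' s = restr J' t ->
    restr J (translate 1 s) = restr J (translate 1 t).
  move=> h; apply/funext => j; have jJ : val j + 1 \in J'.
    by apply/imfsetP; exists (val j) => //; exact: fsvalP.
  exact: (congr1 (@^~ [` jJ]%fset) h).
split=> [s t /X0/off//|s t s' t' /off h /off h' /rst e /rst e'].
exact: Xl.
Qed.

Lemma quasilocalP X : quasilocal X <->
  forall e, 0 < e -> exists J A M, [/\ localm J A, opb A M & opb (mat_sub X A) e].
Proof.
split=> h e e0.
  have [J [A /local_algebraP[hA /boundedP[M hM]] /norm_leP hXA]] := h e e0.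
  by exists J, A, M.
have [J [A [M [hA hM hXA]]]] := h e e0; exists J; exists A; last exact/norm_leP.
by apply/local_algebraP; split => //; apply/boundedP; exists M.
Qed.

Lemma quasilocal_local J X M : localm J X -> opb X M -> quasilocal X.
Proof.
move=> hX hM; apply/quasilocalP => e e0; exists J, X, M; split=> //.
rewrite (_ : mat_sub X X = fun _ _ => 0); last first.
  by apply/funext => s; apply/funext => t; rewrite /mat_sub subrr.
split; first exact: ltW.
move=> F G u v; rewrite big1 ?nc0 => [|s _]; last first.
  by rewrite big1// => t _; rewrite mulr0 mul0r.
by rewrite mulr_ge0 ?divr_ge0 ?(ltW e0)// addr_ge0 ?sumr_ge0// => *; exact: sqr_ge0.
Qed.

Lemma quasilocal_opb X : quasilocal X -> exists M, 0 < M /\ opb X M.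
Proof.
move=> /quasilocalP /(_ 1 ltr01)[J [A [M [_ hA hXA]]]].
exists (1 + M); split; first by rewrite ltr_wpDr// hA.1.
rewrite (_ : X = mat_add (mat_sub X A) A); first exact: opb_add.
by apply/funext => s; apply/funext => t; rewrite /mat_add /mat_sub subrK.
Qed.

Lemma quasilocal_lim X :
  (forall e, 0 < e -> exists2 Y, quasilocal Y & opb (mat_sub X Y) e) -> quasilocal X.
Proof.
move=> h; apply/quasilocalP => e e0; have e2 : 0 < e / 2 by lra.
have [Y /quasilocalP /(_ _ e2)[J [A [M [hA hM hYA]]]] hXY] := h _ e2.
exists J, A, M; split=> //; rewrite (_ : mat_sub X A = mat_add (mat_sub X Y) (mat_sub Y A)).
  by rewrite [e]splitr; exact: opb_add.
by apply/funext => s; apply/funext => t; rewrite /mat_add /mat_sub addrA subrK.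
Qed.

Lemma quasilocal_lin X Y c : quasilocal X -> quasilocal Y ->
  quasilocal (mat_add (mat_scale c X) Y).
Proof.
move=> /quasilocalP hX /quasilocalP hY; apply/quasilocalP => e e0.
have c0 : 0 < nc c + 1 by rewrite ltr_wpDl ?nc_ge0.
have d0 : 0 < e / 2 / (nc c + 1) by rewrite !divr_gt0.
have e2 : 0 < e / 2 by rewrite divr_gt0.
have [J [A [M [hA hM hXA]]]] := hX _ d0; have [K [B [N [hB hN hYB]]]] := hY _ e2.
exists (J `|` K)%fset, (mat_add (mat_scale c A) B), (nc c * M + N); split.
- by apply: localm_lin; [apply: localm_mono hA; exact: fsubsetUl|apply: localm_mono hB; exact: fsubsetUr].
- by apply: opb_add hN; exact: opb_scale.
- rewrite (_ : mat_sub _ _ = mat_add (mat_scale c (mat_sub X A)) (mat_sub Y B)).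
    apply: opb_le (opb_add (opb_scale c hXA) hYB).
    rewrite [leRHS]splitr lerD2r mulrA ler_pdivrMr// mulrC ler_pM2l//; lra.
  by apply/funext => s; apply/funext => t; rewrite /mat_add /mat_scale /mat_sub; ring.
Qed.

Lemma quasilocal_adj X : quasilocal X -> quasilocal (mat_adj X).
Proof.
move=> /quasilocalP hX; apply/quasilocalP => e e0; have [J [A [M [hA hM hXA]]]] := hX e e0.
exists J, (mat_adj A), M; split; [exact: localm_adj|exact: opb_adj|].
by rewrite -mat_adj_sub; exact: opb_adj.
Qed.

Lemma quasilocal_shift X : quasilocal X -> quasilocal (Defs.shift X).
Proof.
move=> /quasilocalP hX; apply/quasilocalP => e e0; have [J [A [M [hA hM hXA]]]] := hX e e0.
by exists [fset (x + 1)%R | x in J]%fset, (Defs.shift A), M; split;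
  [exact: localm_shift|exact: opb_shift|exact: opb_shift hXA].
Qed.

Lemma quasilocal_iter_shift n X : quasilocal X -> quasilocal (iter n Defs.shift X).
Proof. by move=> hX; elim: n => //= n; exact: quasilocal_shift. Qed.

Lemma opb_iter_shift n X M : opb X M -> opb (iter n Defs.shift X) M.
Proof. by move=> hX; elim: n => //= n; exact: opb_shift. Qed.

Lemma mat_subK X Y : mat_add (mat_sub X Y) Y = X.
Proof. by apply/funext => s; apply/funext => t; rewrite /mat_add /mat_sub subrK. Qed.

Lemma mat_mul_sub X Y A B M : opb X M -> opb Y M -> opb A M -> opb B M ->
  mat_sub (mat_mul X Y) (mat_mul A B) =
  mat_add (mat_mul X (mat_sub Y B)) (mat_mul (mat_sub X A) B).
Proof.
move=> hX hY hA hB.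
have M0 := hX.1; have MM : M <= M + M by rewrite lerDl.
rewrite -{1}(mat_subK Y B) (mat_mulDr (opb_sub hY hB) (opb_le MM hB) hX).
rewrite -{2}(mat_subK X A) (mat_mulDl (opb_sub hX hA) (opb_le MM hA) hB).
by apply/funext => s; apply/funext => t; rewrite /mat_add /mat_sub; ring.
Qed.

Lemma quasilocal_mul X Y : quasilocal X -> quasilocal Y -> quasilocal (mat_mul X Y).
Proof.
move=> hX hY; have [M [M0 hM]] := quasilocal_opb hX; have [N [N0 hN]] := quasilocal_opb hY.
move/quasilocalP in hX; move/quasilocalP in hY; apply/quasilocalP => e e0.
pose L := M + N + 1; have L0 : 0 < L by rewrite /L; lra.
(* The cap 1 keeps the approximants bounded by [L] for every [e]; [e / (2 * L)] then makes each of
   the two error terms at most [e / 2]. *)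
pose d := Num.min 1 (e / (2 * L)).
have d0 : 0 < d by rewrite lt_min ltr01 divr_gt0// mulr_gt0.
have d1 : d <= 1 by rewrite ge_min lexx.
have dL : d * L <= e / 2.
  have : d <= e / (2 * L) by rewrite ge_min lexx orbT.
  by rewrite -(ler_pM2r L0) => /le_trans; apply; apply: le_of_eq; field; rewrite gt_eqF.
have [J [A [M' [hA hM' hXA]]]] := hX d d0; have [K [B [N' [hB hN' hYB]]]] := hY d d0.
have bound (Z Z' : cmat) (m : R) : opb Z m -> opb (mat_sub Z Z') d -> m + 1 <= L -> opb Z' L.
  move=> hZ hZZ hm; apply: (opb_le (M := m + d)); first lra.
  rewrite (_ : Z' = mat_sub Z (mat_sub Z Z')); first exact: opb_sub.
  by apply/funext => s; apply/funext => t; rewrite /mat_sub; ring.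
have hAL : opb A L by apply: (bound X A M hM hXA); rewrite /L; lra.
have hBL : opb B L by apply: (bound Y B N hN hYB); rewrite /L; lra.
have hXL : opb X L by apply: opb_le hM; rewrite /L; lra.
have hYL : opb Y L by apply: opb_le hN; rewrite /L; lra.
exists (J `|` K)%fset, (mat_mul A B), (M' * N'); split.
- by apply: localm_mul; [apply: localm_mono hA; exact: fsubsetUl|apply: localm_mono hB; exact: fsubsetUr].
- exact: opb_mul.
- rewrite (mat_mul_sub hXL hYL hAL hBL).
  by apply: opb_le (opb_add (opb_mul hXL hYB) (opb_mul hXA hBL)); lra.
Qed.

Lemma quasilocal_id : quasilocal (@mat_id R conf).
Proof.
apply: (@quasilocal_local fset0 _ 1); last exact: opb_id.
by rewrite mat_id_diagm; exact: localm_diagm.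
Qed.

(* The sum over the intermediate configurations has a single non-zero term. *)
Lemma localm_mul_disjoint J K X Y s u : localm J X -> localm K Y -> [disjoint J & K]%fset ->
  mat_mul X Y s u = X s (glue s (restr J u)) * Y (glue s (restr J u)) u.
Proof.
move=> [X0 _] [Y0 _] JK.
apply: hsum_usum; apply: (@hsum1 _ _ (glue s (restr J u)) (fun t => X s t * Y t u)).
move=> t tu; apply/eqP; rewrite mulf_eq0; apply/negPn/negP => /norP[/X0 st /Y0 ut].
move/eqP: tu; apply; rewrite -(glue_restr st); congr glue; apply/funext => j.
rewrite /restr ut//; apply/negP => jK; move/fdisjointP: JK => /(_ _ (fsvalP j)).
by rewrite jK.
Qed.

End Local.

Arguments restr {I} J s _.

(** * Cauchy-Schwarz for positive forms, and limits of geometrically Cauchy sequences *)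

Section PositiveForms.
Context {R : realType}.
Local Notation C := R[i].
Local Notation nc := ComplexField.Normc.normc.

(** The hypothesis is positivity of a sesquilinear form at [c X + Y]. Reality at [c = 1] and [c = i]
    gives the Hermitian symmetry. The choice [c = - z / a] gives the inequality; when [a = 0], a
    large multiple of [z] forces [z = 0]. *)
Lemma complex_form_cauchy_schwarz (a b : R) (z z' : C) : 0 <= a ->
  (forall c : C, 0 <= (nc c ^+ 2 * a + b)%:C%C + (c^*)%C * z + c * z') ->
  z' = (z^*)%C /\ nc z ^+ 2 <= a * b.
Proof.
move=> a0 h; have zz : z' = (z^*)%C.
  have := h 1; have := h 'i%C; case: z {h} => x y; case: z' => x' y'.
  rewrite !lecE /= => /andP[/eqP h1 _] /andP[/eqP h2 _].
  have e1 : x' = x by lra.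
  have e2 : y' = - y by lra.
  by rewrite e1 e2.
split=> //.
have key (r : R) : 0 <= r ^+ 2 * nc z ^+ 2 * a + b - 2 * r * nc z ^+ 2.
  have := h (- r%:C%C * z); rewrite zz ncM ncN nc_real.
  have -> : ((- r%:C%C * z)^*)%C = - r%:C%C * (z^*)%C.
    by case: z {zz h} => x y; apply/eqP; rewrite eq_complex /=; apply/andP; split; apply/eqP; ring.
  rewrite (_ : _ + _ + _ = ((`|r| * nc z) ^+ 2 * a + b)%:C%C - (2 * r)%:C%C * (z * (z^*)%C)).
    rewrite -nc_sqr -rmorphM -rmorphB lecR exprMn real_normK ?num_real//.
  by rewrite rmorphM rmorph_nat; ring.
move: a0; rewrite le_eqVlt => /orP[/eqP a0|a0].
  rewrite -a0 mul0r leNgt; apply/negP => z0.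
  have nz : nc z != 0 by apply: contraTneq z0 => ->; rewrite expr0n ltxx.
  have := key ((b + 1) / nc z ^+ 2); rewrite -a0 mulr0 add0r.
  rewrite (_ : 2 * _ * _ = 2 * (b + 1)); last by field.
  have := key 0; rewrite -a0; lra.
have := key a^-1; rewrite (_ : _ + b - _ = b - nc z ^+ 2 / a); last by field; rewrite gt_eqF.
by rewrite subr_ge0 ler_pdivrMr// mulrC.
Qed.

Lemma geometric_cauchy_cvg (u : nat -> R) :
  (forall k m, (k <= m)%N -> `|u m - u k| <= 2^-1 ^+ k) -> exists l : R, u @ \oo --> l.
Proof.
move=> h; suff : cvgn u by move=> /cvg_ex.
apply/cauchy_cvgP; apply: cauchy_exP => e e0.
have g : (fun n => 2^-1 ^+ n : R) @ \oo --> (0 : R).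
  by apply: cvg_expr; rewrite ger0_norm ?invr_ge0// invf_lt1// ltr1n.
move/cvgr0Pnorm_lt: g => /(_ e e0)[k _ hk].
exists (u k); exists k => // n /= kn; rewrite /ball /= distrC.
apply: le_lt_trans (h _ _ kn) _; apply: le_lt_trans (hk k (leqnn k)).
exact: ler_norm.
Qed.

Lemma complex_cvg_geometric (u : nat -> C) :
  (forall k m, (k <= m)%N -> nc (u m - u k) <= 2^-1 ^+ k) ->
  exists l, forall e : R, 0 < e -> exists m, forall n, (m <= n)%N -> nc (l - u n) < e.
Proof.
move=> h.
have [a ha] : exists a, (fun n => complex.Re (u n)) @ \oo --> (a : R).
  apply: geometric_cauchy_cvg => k m km; apply: le_trans (h k m km).
  by apply: le_trans (nc_ge_Re _); case: (u m); case: (u k).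
have [b hb] : exists b, (fun n => complex.Im (u n)) @ \oo --> (b : R).
  apply: geometric_cauchy_cvg => k m km; apply: le_trans (h k m km).
  by apply: le_trans (nc_ge_Im _); case: (u m); case: (u k).
exists (a +i* b)%C => e e0; have e2 : 0 < e / 2 by lra.
move/cvgrPdist_lt: ha => /(_ _ e2)[m _ hm]; move/cvgrPdist_lt: hb => /(_ _ e2)[m' _ hm'].
exists (maxn m m') => n; rewrite geq_max => /andP[/hm h1 /hm' h2].
rewrite (_ : _ - _ = (a - complex.Re (u n))%:C%C + 'i%C * (b - complex.Im (u n))%:C%C); last first.
  by case: (u n) => x y; apply/eqP; rewrite eq_complex /=; apply/andP; split; apply/eqP; ring.
apply: le_lt_trans (ncD _ _) _; rewrite ncM !nc_real.
rewrite (_ : nc 'i%C = 1) ?mul1r; last by rewrite /= expr0n add0r expr1n sqrtr1.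
by rewrite [e]splitr ltrD.
Qed.

End PositiveForms.

(** * Square root of [1 - H] for a small self-adjoint [H] *)

Section SquareRoot.
Context {R : realType} {I : choiceType}.
Local Notation C := R[i].
Local Notation nc := ComplexField.Normc.normc.
Local Notation conf := (int -> I).
Local Notation cmat := (@mat R conf conf).
Local Notation half := (2^-1 : R).
Local Notation one := (@mat_id R conf).

Variable H : cmat.
Hypotheses (Hq : quasilocal H) (Hadj : mat_adj H = H) (Hn : opb H half).

(* [one - Z] is the square root of [one - H] when [Z = (H + Z ^ 2) / 2], the fixed point equation of a contraction on the ball of radius 1/2. *)
Definition sqrt_step (Z : cmat) : cmat :=
  mat_scale (2^-1) (mat_add (mat_scale 1 H) (mat_mul Z Z)).

Definition sqrt_iter n : cmat := iter n sqrt_step (fun _ _ => 0).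


Lemma mat_scale1 (A : cmat) : mat_scale 1 A = A.
Proof. by apply/funext => s; apply/funext => t; rewrite /mat_scale mul1r. Qed.

Lemma mat_scale0 (A : cmat) : mat_scale 0 A = fun _ _ => 0.
Proof. by apply/funext => s; apply/funext => t; rewrite /mat_scale mul0r. Qed.

Lemma quasilocal0 : quasilocal ((fun _ _ => 0) : cmat).
Proof.
have := quasilocal_lin (-1) (@quasilocal_id R I) (@quasilocal_id R I).
congr quasilocal; apply/funext => s; apply/funext => t.
by rewrite /mat_add /mat_scale mulN1r addNr.
Qed.

Lemma quasilocal_scale c (A : cmat) : quasilocal A -> quasilocal (mat_scale c A).
Proof.
move=> hA; have := quasilocal_lin c hA quasilocal0; congr quasilocal.
by apply/funext => s; apply/funext => t; rewrite /mat_add addr0.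
Qed.

Lemma quasilocal_add (A B : cmat) : quasilocal A -> quasilocal B -> quasilocal (mat_add A B).
Proof. by move=> hA hB; have := quasilocal_lin 1 hA hB; rewrite mat_scale1. Qed.

Lemma quasilocal_sub (A B : cmat) : quasilocal A -> quasilocal B -> quasilocal (mat_sub A B).
Proof.
by move=> hA hB; rewrite mat_subE; apply: quasilocal_add => //; exact: quasilocal_scale.
Qed.

Let nc_half : nc (2^-1 : C) = half.
Proof.
have -> : (2^-1 : C) = half%:C%C by rewrite fmorphV rmorph_nat.
by rewrite nc_real ger0_norm// invr_ge0.
Qed.

Lemma opb_sqrt_step Z : opb Z half -> opb (sqrt_step Z) half.
Proof.
move=> hZ; apply: opb_le (opb_scale _ (opb_add (opb_scale 1 Hn) (opb_mul hZ hZ))).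
by rewrite nc_half nc1; lra.
Qed.

Lemma sqrt_step_sub Z Z' e : opb Z half -> opb Z' half -> opb (mat_sub Z Z') e ->
  opb (mat_sub (sqrt_step Z) (sqrt_step Z')) (half * e).
Proof.
move=> hZ hZ' hd.
have -> : mat_sub (sqrt_step Z) (sqrt_step Z') =
    mat_scale (2^-1) (mat_sub (mat_mul Z Z) (mat_mul Z' Z')).
  apply/funext => s; apply/funext => t.
  by rewrite /sqrt_step /mat_sub /mat_scale /mat_add; ring.
rewrite (mat_mul_sub hZ hZ hZ' hZ').
apply: opb_le (opb_scale _ (opb_add (opb_mul hZ hd) (opb_mul hd hZ'))).
by rewrite nc_half; lra.
Qed.

Lemma opb_sqrt_iter n : opb (sqrt_iter n) half.
Proof.
elim: n => [|n IH]; last exact: opb_sqrt_step.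
by rewrite /sqrt_iter /= -(mat_scale0 H); apply: opb_le (opb_scale 0 Hn); rewrite nc0; lra.
Qed.

Lemma quasilocal_sqrt_iter n : quasilocal (sqrt_iter n).
Proof.
elim: n => [|n IH]; first exact: quasilocal0.
apply: quasilocal_scale; apply: quasilocal_add; first exact: quasilocal_scale.
exact: quasilocal_mul.
Qed.

Lemma sqrt_iter_adj n : mat_adj (sqrt_iter n) = sqrt_iter n.
Proof.
elim: n => [|n IH]; first by apply/funext => s; apply/funext => t; rewrite mat_adjE conjc0.
rewrite [sqrt_iter n.+1]/(sqrt_step _) /sqrt_step mat_adj_scale mat_adj_add mat_adj_scale Hadj.
rewrite (mat_mul_adj (opb_sqrt_iter n) (opb_sqrt_iter n)) IH conjc1; congr mat_scale.
by rewrite fmorphV rmorph_nat.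
Qed.

Lemma sqrt_iter_sub k j : opb (mat_sub (sqrt_iter (k + j)) (sqrt_iter k)) (half ^+ k).
Proof.
elim: k => [|k IH]; last first.
  by rewrite addSn exprS; apply: sqrt_step_sub => //; exact: opb_sqrt_iter.
rewrite expr0 add0n; apply: opb_le (opb_sub (opb_sqrt_iter j) (opb_sqrt_iter 0)); lra.
Qed.

(** Puts [1 - H] in the form on which states are known to be positive. The iterates converge entry
    by entry, [opb_lim] upgrades this to norm convergence, and self-adjointness and the fixed point
    equation hold up to errors of order [2^-n], hence exactly. *)
Lemma sqrt_exists : exists2 Y, quasilocal Y & mat_mul (mat_adj Y) Y = mat_sub one H.
Proof.
have lim s t : exists l : C, forall e : R, 0 < e -> exists m, forall n, (m <= n)%N ->
    nc (l - sqrt_iter n s t) < e.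
  apply: complex_cvg_geometric => k m /subnKC <-.
  exact: (opb_entry s t (sqrt_iter_sub k (m - k))).
pose Z s t := sval (cid (lim s t)).
have hZ s t : forall e : R, 0 < e -> exists m, forall n, (m <= n)%N ->
    nc (Z s t - sqrt_iter n s t) < e by exact: (svalP (cid (lim s t))).
have Zn : opb Z half.
  by apply: opb_lim hZ opb_sqrt_iter; rewrite invr_ge0.
have Zd k : opb (mat_sub Z (sqrt_iter k)) (half ^+ k).
  apply: (opb_lim (An := fun n => mat_sub (sqrt_iter (k + n)) (sqrt_iter k))).
  - by rewrite exprn_ge0// invr_ge0.
  - move=> s t e e0; have [m hm] := hZ s t e e0; exists m => n mn.
    rewrite /mat_sub opprB addrA subrK; apply: hm.
    by rewrite (leq_trans mn)// leq_addl.
  - exact: sqrt_iter_sub.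
have Zq : quasilocal Z.
  apply: quasilocal_lim => e e0.
  have g : (fun n => half ^+ n) @ \oo --> (0 : R).
    by apply: cvg_expr; rewrite ger0_norm ?invr_ge0// invf_lt1// ltr1n.
  move/cvgr0Pnorm_lt: g => /(_ e e0)[k _ hk]; exists (sqrt_iter k).
    exact: quasilocal_sqrt_iter.
  by apply: opb_le (Zd k); apply: le_trans (ltW (hk k (leqnn k))); exact: ler_norm.
have Zadj : mat_adj Z = Z.
  have : mat_sub (mat_adj Z) Z = fun _ _ => 0.
    apply: (@opb_eq0 _ _ _ 2) => n.
    rewrite (_ : mat_sub _ _ = mat_sub (mat_adj (mat_sub Z (sqrt_iter n))) (mat_sub Z (sqrt_iter n))).
      by apply: opb_le (opb_sub (opb_adj (Zd n)) (Zd n)); rewrite mulr_natl mulr2n.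
    rewrite mat_adj_sub sqrt_iter_adj; apply/funext => s; apply/funext => t.
    by rewrite /mat_sub; ring.
  move=> /(congr1 (fun X : cmat => mat_add X Z)); rewrite mat_subK => ->.
  by apply/funext => s; apply/funext => t; rewrite /mat_add add0r.
have fix_Z : Z = sqrt_step Z.
  have : mat_sub Z (sqrt_step Z) = fun _ _ => 0.
    apply: (@opb_eq0 _ _ _ 1) => n.
    rewrite (_ : mat_sub _ _ = mat_add (mat_sub Z (sqrt_iter n.+1))
      (mat_scale (-1) (mat_sub (sqrt_step Z) (sqrt_step (sqrt_iter n))))).
      apply: opb_le (opb_add (Zd n.+1) (opb_scale (-1) (sqrt_step_sub Zn (opb_sqrt_iter n) (Zd n)))).
      by rewrite ncN nc1 exprS; lra.
    by apply/funext => s; apply/funext => t; rewrite /mat_sub /mat_add /mat_scale /=; ring.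
  move=> h0; rewrite -[LHS](mat_subK Z (sqrt_step Z)) h0.
  by apply/funext => s; apply/funext => t; rewrite /mat_add add0r.
exists (mat_sub one Z); first by apply: quasilocal_sub => //; exact: quasilocal_id.
have -> : mat_adj (mat_sub one Z) = mat_sub one Z.
  rewrite mat_adj_sub Zadj; congr mat_sub; rewrite mat_id_diagm mat_adj_diagm.
  by congr diagm; apply/funext => s; exact: conjc1.
have o1 := @opb_id R conf.
have Z1 : opb Z 1 by apply: opb_le Zn; lra.
have n1 := opb_scale (-1) Z1; rewrite ncN nc1 mul1r in n1.
rewrite [X in mat_mul X _]mat_subE (mat_mulDl o1 n1 (opb_sub o1 Z1)) mat_1mul.
rewrite (mat_mulZl _ Z1 (opb_sub o1 Z1)) mat_subE (mat_mulDr o1 n1 Z1) mat_mul1 (mat_mulZr _ Z1 Z1).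
have E s t : mat_mul Z Z s t = 2 * Z s t - H s t.
  by rewrite {3}fix_Z /sqrt_step /mat_scale /mat_add; field.
by apply/funext => s; apply/funext => t; rewrite /mat_sub /mat_add /mat_scale E; ring.
Qed.

End SquareRoot.

(** * States *)

Section States.
#[local] Opaque quasilocal opb usum mat_mul.
Context {R : realType} {I : choiceType}.
Local Notation C := R[i].
Local Notation nc := ComplexField.Normc.normc.
Local Notation conf := (int -> I).
Local Notation cmat := (@mat R conf conf).
Local Notation one := (@mat_id R conf).
Variable w : cmat -> C.
Hypothesis hw : state w.
Implicit Types (X Y : cmat) (c : C) (b : conf -> bool) (M : R).

Lemma state_add X Y : quasilocal X -> quasilocal Y -> w (mat_add X Y) = w X + w Y.
Proof. by case: hw => h _ _ hX hY; have := h 1 X Y hX hY; rewrite mat_scale1 mul1r. Qed.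

Lemma state_scale c X : quasilocal X -> w (mat_scale c X) = c * w X.
Proof.
case: hw => h _ _ hX.
have w0 : w (fun _ _ => 0) = 0.
  have e : mat_add (mat_scale (-1) X) X = fun _ _ => 0.
    by apply/funext => s; apply/funext => t; rewrite /mat_add /mat_scale mulN1r addNr.
  by rewrite -e h// mulN1r addNr.
have e : mat_add (mat_scale c X) (fun _ _ => 0) = mat_scale c X.
  by apply/funext => s; apply/funext => t; rewrite /mat_add addr0.
have := h c X _ hX quasilocal0; rewrite e w0 addr0; exact.
Qed.

Lemma state_sub X Y : quasilocal X -> quasilocal Y -> w (mat_sub X Y) = w X - w Y.
Proof.
move=> hX hY; have q := quasilocal_scale (-1) hY.
by rewrite mat_subE (state_add hX q) (state_scale _ hY) mulN1r.
Qed.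

Lemma state1 : w one = 1. Proof. by case: hw. Qed.

(** The squared norm of the GNS vector of [X]. By positivity the value is already real on
    quasi-local operators ([sqnormE]). *)
Definition sqnorm X : R := complex.Re (w (mat_mul (mat_adj X) X)).

Lemma sqnormE X : quasilocal X -> w (mat_mul (mat_adj X) X) = (sqnorm X)%:C%C.
Proof.
case: hw => _ h _ /h; rewrite /sqnorm; case: (w _) => x y.
by rewrite lecE /= => /andP[/eqP -> _].
Qed.

Lemma sqnorm_ge0 X : quasilocal X -> 0 <= sqnorm X.
Proof. by move=> hX; case: hw => _ /(_ X hX) + _; rewrite sqnormE// lecR. Qed.

Lemma form_expand X Y c : quasilocal X -> quasilocal Y ->
  w (mat_mul (mat_adj (mat_add (mat_scale c X) Y)) (mat_add (mat_scale c X) Y)) =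
  (nc c ^+ 2 * sqnorm X + sqnorm Y)%:C%C + (c^*)%C * w (mat_mul (mat_adj X) Y) +
  c * w (mat_mul (mat_adj Y) X).
Proof.
move=> qX qY; have [M [M0 hX]] := quasilocal_opb qX; have [N [N0 hY]] := quasilocal_opb qY.
pose L := nc c * M + M + N.
have cM : 0 <= nc c * M by rewrite mulr_ge0 ?nc_ge0// ltW.
have hcX : opb (mat_scale c X) L by apply: opb_le (opb_scale c hX); rewrite /L; lra.
have hXL : opb X L by apply: opb_le hX; rewrite /L; lra.
have hYL : opb Y L by apply: opb_le hY; rewrite /L; lra.
have qXX := quasilocal_mul (quasilocal_adj qX) qX.
have qXY := quasilocal_mul (quasilocal_adj qX) qY.
have qYX := quasilocal_mul (quasilocal_adj qY) qX.
have qYY := quasilocal_mul (quasilocal_adj qY) qY.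
rewrite mat_adj_add mat_adj_scale.
have hcXa : opb (mat_scale (c^*)%C (mat_adj X)) L.
  by rewrite -mat_adj_scale; exact: opb_adj.
rewrite (mat_mulDl hcXa (opb_adj hYL) (opb_add hcX hYL)).
rewrite (mat_mulDr hcX hYL hcXa) (mat_mulDr hcX hYL (opb_adj hYL)).
rewrite (mat_mulZl _ (opb_adj hXL) hcX) (mat_mulZl _ (opb_adj hXL) hYL).
rewrite !(mat_mulZr _ hXL (opb_adj hXL)) !(mat_mulZr _ hXL (opb_adj hYL)).
have q1 := quasilocal_scale c qXX; have q2 := quasilocal_scale (c^*)%C q1.
have q3 := quasilocal_scale (c^*)%C qXY; have q4 := quasilocal_scale c qYX.
rewrite (state_add (quasilocal_add q2 q3) (quasilocal_add q4 qYY)).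
rewrite (state_add q2 q3) (state_add q4 qYY) (state_scale _ q1) (state_scale _ qXX).
rewrite (state_scale _ qXY) (state_scale _ qYX) (sqnormE qX) (sqnormE qY).
by rewrite rmorphD rmorphM /= nc_sqr; ring.
Qed.

Lemma form_cauchy_schwarz X Y : quasilocal X -> quasilocal Y ->
  w (mat_mul (mat_adj Y) X) = ((w (mat_mul (mat_adj X) Y))^*)%C /\
  nc (w (mat_mul (mat_adj X) Y)) ^+ 2 <= sqnorm X * sqnorm Y.
Proof.
move=> qX qY; apply: complex_form_cauchy_schwarz; first exact: sqnorm_ge0.
move=> c; rewrite -form_expand//; case: hw => _ h _; apply: h.
by apply: quasilocal_lin.
Qed.

Lemma mat_adj1 : mat_adj one = one.
Proof.
rewrite mat_id_diagm mat_adj_diagm; congr diagm; apply/funext => s; exact: conjc1.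
Qed.

Lemma sqnorm1 : sqnorm one = 1.
Proof. by rewrite /sqnorm mat_adj1 mat_mul1 state1. Qed.

Lemma state_cauchy_schwarz X : quasilocal X -> nc (w X) ^+ 2 <= sqnorm X.
Proof.
move=> qX; have [_] := form_cauchy_schwarz (@quasilocal_id R I) qX.
by rewrite sqnorm1 mul1r mat_adj1 mat_1mul.
Qed.

(** Positivity of [w] on [1 - H], where [H] is the product of the adjoint of [X] with [X] divided by
    [2 M^2]. The norm 1/2 allowed by [sqrt_exists] is the origin of the factor 2. *)
Lemma sqnorm_le X M : quasilocal X -> 0 < M -> opb X M -> sqnorm X <= 2 * M ^+ 2.
Proof.
move=> qX M0 hX; have M2 : 0 < 2 * M ^+ 2 by rewrite mulr_gt0// exprn_gt0.
pose k : R := (2 * M ^+ 2)^-1; have k0 : 0 < k by rewrite invr_gt0.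
pose H := mat_scale k%:C%C (mat_mul (mat_adj X) X).
have qXX := quasilocal_mul (quasilocal_adj qX) qX.
have qH : quasilocal H by exact: quasilocal_scale.
have [||Y qY eY] := sqrt_exists qH.
- rewrite mat_adj_scale (mat_mul_adj (opb_adj hX) hX) mat_adjK; congr mat_scale.
  by rewrite /= oppr0.
- apply: opb_le (opb_scale _ (opb_mul (opb_adj hX) hX)).
  rewrite nc_real gtr0_norm// /k -expr2; apply: le_of_eq; field; rewrite gt_eqF//.
have := sqnorm_ge0 qY; rewrite /sqnorm eY (state_sub (@quasilocal_id R I) qH).
rewrite state1 (state_scale _ qXX) (sqnormE qX) -rmorphM -rmorphB /= subr_ge0.
by rewrite /k ler_pdivrMl// mulr1.
Qed.

Lemma state_norm_le X M : quasilocal X -> 0 < M -> opb X M -> nc (w X) <= 2 * M.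
Proof.
move=> qX M0 hX; have := le_trans (state_cauchy_schwarz qX) (sqnorm_le qX M0 hX).
move=> h; rewrite -(@ler_pXn2r _ 2)// ?nnegrE ?nc_ge0 ?mulr_ge0 ?(ltW M0)//.
apply: le_trans h _; rewrite exprMn ler_wpM2r ?sqr_ge0//; lra.
Qed.

Definition prj b : cmat := diagm (fun s => (b s)%:R).

Lemma opb_prj b : opb (prj b) 1.
Proof. by apply: opb_diagm => // s; case: (b s); rewrite ?nc1 ?nc0. Qed.

Lemma prj_adj b : mat_adj (prj b) = prj b.
Proof.
rewrite mat_adj_diagm; congr diagm; apply/funext => s; exact: rmorph_nat.
Qed.

Lemma prj_idem b : mat_mul (prj b) (prj b) = prj b.
Proof. by rewrite diagm_mul; congr diagm; apply/funext => s; case: (b s); rewrite ?mulr1 ?mulr0. Qed.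

Lemma sqnorm_prj b : sqnorm (prj b) = complex.Re (w (prj b)).
Proof. by rewrite /sqnorm prj_adj prj_idem. Qed.

Lemma state_prj b : quasilocal (prj b) -> w (prj b) = (sqnorm (prj b))%:C%C.
Proof. by move=> q; rewrite -sqnormE// prj_adj prj_idem. Qed.

Lemma state_prj_mul b X M d : quasilocal (prj b) -> quasilocal X -> 0 < M -> opb X M ->
  0 <= d -> sqnorm (prj b) <= d ^+ 2 ->
  nc (w (mat_mul (prj b) X)) <= 2 * M * d /\ nc (w (mat_mul X (prj b))) <= 2 * M * d.
Proof.
move=> qb qX M0 hX d0 hd.
have key (z s : R) : 0 <= z -> 0 <= s -> s <= 2 * M ^+ 2 -> z ^+ 2 <= sqnorm (prj b) * s ->
    z <= 2 * M * d.
  move=> z0 s0 hs hz; rewrite -(@ler_pXn2r _ 2)// ?nnegrE ?mulr_ge0 ?(ltW M0)//.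
  apply: le_trans hz _; apply: (@le_trans _ _ (d ^+ 2 * (2 * M ^+ 2))).
    by apply: ler_pM => //; exact: sqnorm_ge0.
  rewrite -subr_ge0 (_ : _ - _ = 2 * (M * d) ^+ 2); last by ring.
  by rewrite mulr_ge0// sqr_ge0.
split.
  have [_] := form_cauchy_schwarz qb qX; rewrite prj_adj => h.
  by apply: key h; rewrite ?nc_ge0 ?sqnorm_ge0//; exact: sqnorm_le.
have qXa := quasilocal_adj qX.
have [_] := form_cauchy_schwarz qXa qb; rewrite mat_adjK mulrC => h.
by apply: key h; rewrite ?nc_ge0 ?sqnorm_ge0//; apply: sqnorm_le => //; exact: opb_adj.
Qed.

Definition cut b X : cmat := fun s t => (b s)%:R * X s t * (b t)%:R.

Lemma cutE b X : cut b X = mat_mul (mat_mul (prj b) X) (prj b).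
Proof.
by apply/funext => s; apply/funext => t; rewrite mul_mat_diagm mul_diagm.
Qed.

Lemma opb_cut b X M : opb X M -> opb (cut b X) M.
Proof.
move=> hX; rewrite cutE; apply: opb_le (opb_mul (opb_mul (opb_prj b) hX) (opb_prj b)).
by rewrite mul1r mulr1.
Qed.

Lemma quasilocal_cut b X : quasilocal (prj b) -> quasilocal X -> quasilocal (cut b X).
Proof.
move=> qb qX; rewrite cutE.
have h := quasilocal_mul (quasilocal_mul qb qX) qb; exact: h.
Qed.

(** With [b] the projection, [X - b X b] equals [(1 - b) X + b X (1 - b)]. Each summand contains the
    complementary projection, so Cauchy-Schwarz bounds it by [2 * M * d]. *)
Lemma state_cut_close b X M d : quasilocal (prj b) -> quasilocal (prj (fun s => ~~ b s)) ->
  quasilocal X -> 0 < M -> opb X M ->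
  0 <= d -> sqnorm (prj (fun s => ~~ b s)) <= d ^+ 2 -> nc (w X - w (cut b X)) <= 4 * M * d.
Proof.
move=> qb qb' qX M0 hX d0 hd.
have qbX := quasilocal_mul qb qX.
rewrite -(state_sub qX (quasilocal_cut qb qX)).
have -> : mat_sub X (cut b X) = mat_add (mat_mul (prj (fun s => ~~ b s)) X)
    (mat_mul (mat_mul (prj b) X) (prj (fun s => ~~ b s))).
  apply/funext => s; apply/funext => t.
  rewrite /mat_sub /mat_add mul_mat_diagm !mul_diagm /cut.
  by case: (b s); case: (b t); rewrite /=; ring.
rewrite (state_add (quasilocal_mul qb' qX) (quasilocal_mul qbX qb')).
have -> : 4 * M * d = 2 * M * d + 2 * M * d by ring.
apply: le_trans (ncD _ _) _; apply: lerD.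
  by have [] := state_prj_mul qb' qX M0 hX d0 hd.
have hbX : opb (mat_mul (prj b) X) M by have := opb_mul (opb_prj b) hX; rewrite mul1r.
by have [] := state_prj_mul qb' qbX M0 hbX d0 hd.
Qed.


End States.

(** * Normality *)

Section Normality.
#[local] Opaque usum.
Context {R : realType} {S : choiceType}.
Local Notation C := R[i].
Local Notation nc := ComplexField.Normc.normc.
Implicit Types (A B Y : @mat R S S) (v : S -> C) (M N : R) (F : {fset S}) (d : S -> R).

Lemma quadratic_form_hsum A M v N : opb A M -> l2le v N ->
  hsum (fun s => (v s)^*%C * mat_apply A v s) (usum (fun s => (v s)^*%C * mat_apply A v s)).
Proof.
move=> hA hv; apply: l2le_mul_hsum (opb_apply hA hv).
by move=> F; rewrite (eq_bigr (fun s => nc (v s) ^+ 2)) => [|s _]; [exact: hv|rewrite nc_conj].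
Qed.

Lemma mat_apply_diagm (d : S -> C) v s : mat_apply (diagm d) v s = d s * v s.
Proof.
apply: hsum_usum; apply: hsum_eq (@hsum1 _ _ s (fun k => diagm d s k * v k) _) => //.
  by rewrite /diagm eqxx mulr1.
by move=> k /negbTE sk; rewrite /diagm eq_sym sk mulr0 mul0r.
Qed.

Lemma opb_diagm01 d : (forall s, 0 <= d s <= 1) -> opb (diagm (fun s => (d s)%:C%C)) 1.
Proof.
move=> h; apply: opb_diagm => // s; rewrite nc_real.
by case/andP: (h s) => ? ?; rewrite ger0_norm.
Qed.

Lemma positive_diagm d : (forall s, 0 <= d s <= 1) ->
  positive_op (diagm (fun s => (d s)%:C%C)).
Proof.
move=> h; have o := opb_diagm01 h; split; first by apply/boundedP; exists 1.
move=> v /l2P[N _ hv]; apply: hsum_complex_ge0 (quadratic_form_hsum o hv) => s.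
rewrite mat_apply_diagm mulrCA -nc_sqr' -rmorphM lecR mulr_ge0 ?sqr_ge0//.
by case/andP: (h s).
Qed.

Definition fin_proj F : @mat R S S := diagm (fun s => ((s \in F)%:R : R)%:C%C).

Lemma fin_proj_sub_positive F d : (forall s, (s \in F)%:R <= d s <= 1) ->
  op_le (fin_proj F) (diagm (fun s => (d s)%:C%C)).
Proof.
move=> h; rewrite /op_le.
have -> : mat_sub (diagm (fun s => (d s)%:C%C)) (fin_proj F) =
    diagm (fun s => (d s - (s \in F)%:R)%:C%C).
  apply/funext => s; apply/funext => t.
  by rewrite /mat_sub /fin_proj /diagm rmorphB mulrBl.
apply: positive_diagm => s; case/andP: (h s) => h1 h2.
have : 0 <= (s \in F)%:R :> R by []; move=> h3.
by apply/andP; split; lra.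
Qed.

Lemma id_diagm_real : @mat_id R S = diagm (fun s => (1 : R)%:C%C).
Proof. by rewrite mat_id_diagm. Qed.

(** The quadratic form at [v] of an upper bound [Y] dominates every finite partial sum of [|v s|^2],
    hence the full sum, which is the form of the identity. *)
Lemma fin_proj_lub : op_lub [set A | exists F, A = fin_proj F] (@mat_id R S).
Proof.
split.
- by rewrite id_diagm_real; apply: positive_diagm => s; rewrite ler01 lexx.
- move=> _ [F ->]; rewrite id_diagm_real; apply: fin_proj_sub_positive => s.
  by rewrite lexx andbT lern1 leq_b1.
move=> Y [/boundedP[M hY] _] hF.
have o1 := @opb_id R S.
split; first by apply/boundedP; exists (M + 1); exact: opb_sub.
move=> v lv; have [N Nv hv] := l2P lv.
set a := usum (fun s => (v s)^*%C * mat_apply Y v s).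
have ha : hsum (fun s => (v s)^*%C * mat_apply Y v s) a by exact: quadratic_form_hsum hY hv.
have [l hl _] := l2le_hsum hv.
have apply_sub B M' s : opb B M' ->
    mat_apply (mat_sub Y B) v s = mat_apply Y v s - mat_apply B v s.
  move=> hB; apply: hsum_usum.
  apply: hsum_eq (hsumB (opb_apply_hsum (s := s) hY hv) (opb_apply_hsum (s := s) hB hv)) => // t.
  by rewrite /mat_sub mulrBl.
have key F : 0 <= a - (\sum_(s <- F) nc (v s) ^+ 2)%:C%C.
  have oF : opb (fin_proj F) 1.
    by apply: opb_diagm01 => s; rewrite ler0n lern1 leq_b1.
  have [_ /(_ v lv)] := hF (fin_proj F) (ex_intro _ F erefl).
  congr (0 <= _); apply: hsum_usum.
  have h1 := @hsum_fin _ _ F (fun s => ((s \in F)%:R * nc (v s) ^+ 2)%:C%C).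
  apply: hsum_eq (hsumB ha (h1 _)) => [s||s /negbTE ->]; last by rewrite mul0r.
    rewrite (apply_sub _ _ _ oF) /fin_proj mat_apply_diagm mulrBr; congr (_ - _).
    by rewrite rmorphM /= nc_sqr'; ring.
  congr (_ - _); rewrite rmorph_sum big_seq [RHS]big_seq; apply: eq_bigr => s ->.
  by rewrite mul1r.
have hq : hsum (fun s => (v s)^*%C * mat_apply (mat_sub Y (@mat_id R S)) v s) (a - l%:C%C).
  apply: hsum_eq (hsumB ha (hsum_real_complex hl)) => // s.
  rewrite (apply_sub _ _ _ o1) mat_id_diagm mat_apply_diagm mul1r mulrBr.
  by rewrite nc_sqr'.
move: (hsum_usum hq) => /= E; rewrite [X in 0 <= X]E.
have := key fset0; rewrite big_seq_fset0 subr0.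
move: key; clear -hl; case: a => x y key; rewrite lecE /= => /andP[y0 _].
rewrite lecE /= oppr0 addr0 y0 /= subr_ge0.
have [l' hl' le_l] : exists2 l', hsum (fun s => nc (v s) ^+ 2) l' & l' <= x.
  apply: hsum_bounded => [s|F]; first exact: sqr_ge0.
  by have := key F; rewrite lecE /= => /andP[_]; rewrite subr_ge0.
by rewrite (hsum_unique hl hl').
Qed.

(** Normality with the bound [1 - e]: if no finite projection exceeded it, neither would the
    identity. *)
Lemma normal_fin_proj (f : @mat R S S -> C) (e : R) : normal f -> f (@mat_id R S) = 1 ->
  (forall F, f (fin_proj F) = (complex.Re (f (fin_proj F)))%:C%C) -> 0 < e ->
  exists F, 1 - e < complex.Re (f (fin_proj F)).
Proof.
move=> nf f1 freal e0; apply: contrapT => no.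
have : f (@mat_id R S) <= (1 - e)%:C%C.
  apply: (nf [set A | exists F, A = fin_proj F]).
  - by exists (fin_proj fset0), fset0.
  - by move=> _ [F ->]; apply: positive_diagm => s; rewrite ler0n lern1 leq_b1.
  - move=> _ _ [F ->] [G ->]; exists (fin_proj (F `|` G)%fset); first by exists (F `|` G)%fset.
    split; apply: fin_proj_sub_positive => s; rewrite lern1 leq_b1 andbT ler_nat in_fsetU.
      by case: (s \in F).
    by case: (s \in G); rewrite ?orbT.
  - exact: fin_proj_lub.
  - move=> _ [F ->]; rewrite freal lecR leNgt; apply/negP => h; apply: no; by exists F.
by rewrite f1 lecE /= => /andP[_]; lra.
Qed.

End Normality.

(** * Reduction of local operators to matrix units *)

Section LocalApproximation.
#[local] Opaque usum.
Context {R : realType} {I : choiceType}.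
Local Notation C := R[i].
Local Notation conf := (int -> I).
Local Notation cmat := (@mat R conf conf).
Local Notation one := (@mat_id R conf).
Implicit Types (J : {fset int}) (X A B : cmat) (s t : conf) (c : C) (e : R).

Lemma embed_diagm J (d : (J -> I) -> C) :
  embed (diagm d) = diagm (fun s : conf => d (restr J s)).
Proof.
apply/funext => s; apply/funext => t; have [h|h] := pselect (agree_off J s t).
  rewrite embedE// /diagm; congr (_ * (nat_of_bool _)%:R); apply/eqP/eqP => [e|->//].
  by rewrite -(glue_restr h) -e glue_restr.
rewrite embed_eq0// /diagm; case: (s =P t) => [e|_]; last by rewrite mulr0.
by case: h; rewrite e.
Qed.

Lemma quasilocal_prj_restr J (p : pred (J -> I)) :
  quasilocal (prj (R := R) (fun s : conf => p (restr J s))).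
Proof.
apply: (@quasilocal_local R I J _ 1); last exact: opb_prj.
by apply: localm_diagm => s t ->.
Qed.

Lemma locally_normal_approx (w : cmat -> C) J (e : R) : state w -> locally_normal w -> 0 < e ->
  exists F : {fset (J -> I)}, sqnorm w (prj (fun s => restr J s \notin F)) <= e.
Proof.
move=> hw nw e0.
have fE F : embed (@fin_proj R (J -> I) F) = prj (fun s => restr J s \in F).
  by rewrite /fin_proj embed_diagm; congr diagm; apply/funext => s; exact: rmorph_nat.
have qF (F : {fset (J -> I)}) := quasilocal_prj_restr (fun x => x \in F).
have [||F hF] := normal_fin_proj (nw J) _ _ e0.
- by rewrite mat_id_diagm embed_diagm -mat_id_diagm; exact: state1.
- by move=> F; rewrite fE (state_prj hw (qF F)).
exists F.
have E : mat_sub one (prj (R := R) (fun s => restr J s \in F)) = prj (fun s => restr J s \notin F).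
  apply/funext => s; apply/funext => t; rewrite mat_id_diagm /mat_sub /prj /diagm.
  by case: (restr J s \in F); rewrite /=; ring.
rewrite sqnorm_prj -E (state_sub hw (@quasilocal_id R I) (qF F)) (state1 hw).
rewrite fE in hF; move: hF; case: (w _) => x y /=; lra.
Qed.

Definition munit (S : choiceType) (x y : S) : @mat R S S :=
  fun s t : S => (s == x)%:R * (t == y)%:R.

Lemma sum_delta (S : choiceType) (F : {fset S}) (s : S) (g : S -> C) :
  \sum_(x <- F) (s == x)%:R * g x = (s \in F)%:R * g s.
Proof.
have [sF|sF] := boolP (s \in F).
  rewrite (big_fsetD1 s sF) /= eqxx big_seq big1 ?addr0// => x.
  by rewrite !inE eq_sym => /andP[/negbTE -> _]; rewrite mul0r.
rewrite mul0r big_seq big1// => x xF; case: eqP => [e|]; last by rewrite mul0r.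
by rewrite -e (negbTE sF) in xF.
Qed.

(** An induction principle: cut to finitely many configurations, a local operator is a finite
    combination of matrix units, so a property stable under linear combinations is checked on the
    units. *)
Lemma cut_span (Q : cmat -> Prop) J (F : {fset (J -> I)}) X :
  local_algebra J X -> Q (fun _ _ => 0) ->
  (forall c A B, Q A -> Q B -> Q (mat_add (mat_scale c A) B)) ->
  (forall x y : J -> I, Q (embed (munit x y))) ->
  Q (cut (fun s => restr J s \in F) X).
Proof.
move=> [a _ ->] Q0 Qlin Qunit.
have Qsum (xs : seq ((J -> I) * (J -> I))) :
    Q (fun s t => \sum_(p <- xs) a p.1 p.2 * embed (munit p.1 p.2) s t).
  elim: xs => [|p xs IH].
    have -> : (fun s t => \sum_(p <- [::]) a p.1 p.2 * embed (munit p.1 p.2) s t) = fun _ _ => 0.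
      by apply/funext => s; apply/funext => t; rewrite big_nil.
    exact: Q0.
  have -> : (fun s t => \sum_(p <- p :: xs) a p.1 p.2 * embed (munit p.1 p.2) s t) =
      mat_add (mat_scale (a p.1 p.2) (embed (munit p.1 p.2)))
        (fun s t => \sum_(p <- xs) a p.1 p.2 * embed (munit p.1 p.2) s t).
    by apply/funext => s; apply/funext => t; rewrite big_cons.
  by apply: Qlin; [exact: Qunit|exact: IH].
have -> : cut (fun s => restr J s \in F) (embed a) = fun s t =>
    \sum_(p <- [seq (x, y) | x <- F, y <- F]) a p.1 p.2 * embed (munit p.1 p.2) s t.
  apply/funext => s; apply/funext => t; rewrite /cut big_allpairs_dep /=.
  have [h|h] := pselect (agree_off J s t); last first.
    rewrite embed_eq0// mulr0 mul0r big1// => x _; rewrite big1// => y _.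
    by rewrite embed_eq0// mulr0.
  under eq_bigr => x _.
    under eq_bigr => y _ do rewrite embedE// /munit mulrCA (mulrC (a x y)).
    rewrite -mulr_sumr sum_delta; over.
  by rewrite sum_delta embedE//; ring.
exact: Qsum.
Qed.

End LocalApproximation.

(** * The entangled chain on product observables *)

Section Transition.
#[local] Opaque usum.
Context {R : realType} {I : choiceType}.
Local Notation C := R[i].
Variables (P : I -> I -> R) (p : I -> R).
Hypotheses (hP : stochastic P) (hp : stationary P p).
Implicit Types (i j k : I) (x : I -> R) (A : @mat R I I).

Let P0 i j : 0 <= P i j. Proof. exact: (weight_row hP i).1. Qed.
Let p0 i : 0 <= p i. Proof. exact: (weight_stationary hp).1. Qed.

Lemma P_le1 i j : P i j <= 1.
Proof.
have := hsum_nneg_le [fset j]%fset (weight_row hP i).1 (weight_row hP i).2.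
by rewrite big_seq_fset1.
Qed.

(** The weights in the [(i, j)] entry of the transition expectation of a diagonal matrix. Their sum
    is the Bhattacharyya coefficient of rows [i] and [j]; for [i = j] they are the row itself. *)
Definition overlap i j : I -> R := fun k => Num.sqrt (P i k) * Num.sqrt (P j k).

Definition overlap_mass i j : R := usum (overlap i j).

Lemma overlap_hsum i j : hsum (overlap i j) (overlap_mass i j) /\ overlap_mass i j <= 1.
Proof.
have [l hl le_l] : exists2 l, hsum (overlap i j) l & l <= 2^-1 * (1 + 1).
  apply: hsum_nneg_dominated (hsumZ (c := 2^-1) (hsumD (weight_row hP i).2 (weight_row hP j).2)) => k.
  have -> : P i k + P j k = Num.sqrt (P i k) ^+ 2 + Num.sqrt (P j k) ^+ 2.
    by rewrite !sqr_sqrtr.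
  rewrite mulr_ge0 ?sqrtr_ge0//=.
  by rewrite /overlap -subr_ge0 (_ : _ - _ = 2^-1 * (Num.sqrt (P i k) - Num.sqrt (P j k)) ^+ 2);
    [rewrite mulr_ge0 ?sqr_ge0// invr_ge0|field].
rewrite /overlap_mass (hsum_usum hl); split=> //; apply: le_trans le_l _; lra.
Qed.

Lemma overlap_weight i j : weight (overlap i j) (overlap_mass i j).
Proof. by split; [move=> k; rewrite mulr_ge0 ?sqrtr_ge0|exact: (overlap_hsum i j).1]. Qed.

Lemma overlap_mass01 i j : 0 <= overlap_mass i j <= 1.
Proof.
rewrite (overlap_hsum i j).2 andbT; apply: hsum_ge0 (overlap_hsum i j).1 => k.
exact: (overlap_weight i j).1.
Qed.

Lemma mean_overlap_diag x i : mean (overlap i i) x = Pop P x i.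
Proof. by congr usum; apply/funext => k; rewrite /overlap -expr2 sqr_sqrtr. Qed.

Definition rdiag x : @mat R I I := diagm (fun i => (x i)%:C%C).

Lemma rdiag1 : mat_id I = rdiag (fun=> 1).
Proof. by rewrite mat_id_diagm. Qed.

Lemma tensor_isometry_rdiag A x q j :
  mat_mul (mat_tensor A (rdiag x)) (isometryV P) q j =
  A q.1 j * (x q.2)%:C%C * (Num.sqrt (P j q.2))%:C%C.
Proof.
apply: hsum_usum; apply: hsum_eq (@hsum1 _ _ (j, q.2)
  (fun r => mat_tensor A (rdiag x) q r * isometryV P r j) _) => //.
  by rewrite /mat_tensor /isometryV /rdiag /diagm /= !eqxx mulr1.
move=> [r1 r2]; rewrite /mat_tensor /isometryV /rdiag /diagm /=.
case: (r1 =P j) => [->|_]; last by rewrite mulr0.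
case: (q.2 =P r2) => [<-|_]; first by rewrite eqxx.
by rewrite !mulr0 mul0r.
Qed.

Lemma transition_rdiag A x i j : (forall k, 0 <= x k <= 1) ->
  transition_at P A (rdiag x) i j = A i j * (mean (overlap i j) x)%:C%C.
Proof.
move=> x01; transitivity (usum (fun q => mat_adj (isometryV P) i q *
  mat_mul (mat_tensor A (rdiag x)) (isometryV P) q j)) => //.
rewrite (usum_inj (h := fun k => (i, k))) => [|k l [->//]|[r1 r2] h]; last first.
  cbn beta; rewrite mat_adjE /isometryV /=.
  case: (r1 =P i) => [e|_]; last by rewrite conjc0 mul0r.
  by case: (h r2); rewrite e.
apply: hsum_usum.
have h := hsum_real_complex (mean_hsum (overlap_weight i j) (bounded01 x01)).
apply: hsum_eq (hsumZ (c := A i j) h) => // k.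
rewrite /= tensor_isometry_rdiag mat_adjE /isometryV /= eqxx /overlap.
by rewrite conjc_real !rmorphM /=; ring.
Qed.

Lemma transition_diag_rdiag (a x : I -> R) : (forall k, 0 <= x k <= 1) ->
  transition_at P (rdiag a) (rdiag x) = rdiag (fun i => a i * Pop P x i).
Proof.
move=> x01; apply/funext => i; apply/funext => j; rewrite transition_rdiag//.
rewrite /rdiag /diagm; case: eqP => [<-|_]; last by rewrite !mulr0 mul0r.
by rewrite mean_overlap_diag !mulr1 rmorphM.
Qed.

Lemma transition_munit A (y : C) u v i j :
  transition_at P A (mat_scale y (munit u v)) i j =
  A i j * (y * (Num.sqrt (P i u) * Num.sqrt (P j v))%:C%C).
Proof.
rewrite /transition_at /transition.
have E q : mat_mul (mat_tensor A (mat_scale y (munit u v))) (isometryV P) q j =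
    A q.1 j * (y * (q.2 == u)%:R) * (Num.sqrt (P j v))%:C%C.
  apply: hsum_usum; apply: hsum_eq (@hsum1 _ _ (j, v)
    (fun r => mat_tensor A (mat_scale y (munit u v)) q r * isometryV P r j) _) => //.
    by rewrite /mat_tensor /isometryV /mat_scale /munit /= !eqxx mulr1 mulrA.
  move=> [r1 r2]; rewrite /mat_tensor /isometryV /mat_scale /munit /=.
  case: (r1 =P j) => [->|_]; last by rewrite mulr0.
  case: (r2 =P v) => [->|_]; first by rewrite eqxx.
  by rewrite !mulr0 mul0r.
apply: hsum_usum; apply: hsum_eq (@hsum1 _ _ (i, u)
  (fun q => mat_adj (isometryV P) i q * mat_mul (mat_tensor A (mat_scale y (munit u v))) (isometryV P) q j) _) => //.
  rewrite E mat_adjE /isometryV /= !eqxx conjc_real !rmorphM /=; ring.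
move=> [r1 r2]; rewrite E mat_adjE /isometryV /=.
case: (r1 =P i) => [->|_]; last by rewrite conjc0 mul0r.
case: (r2 =P u) => [->|_]; first by rewrite eqxx.
by rewrite !mulr0 mul0r mulr0.
Qed.

Lemma Qmat_hsum i j : hsum (fun k => p k * Num.sqrt (P k i * P k j))
  (usum (fun k => p k * Num.sqrt (P k i * P k j))).
Proof.
have [l hl _] : exists2 l, hsum (fun k => p k * Num.sqrt (P k i * P k j)) l & l <= 1.
  apply: hsum_nneg_dominated (weight_stationary hp).2 => k.
  rewrite mulr_ge0 ?sqrtr_ge0//= ler_piMr// -sqrtr1 ler_wsqrtr//.
  by rewrite mulr_ile1// P_le1.
exact/usummable_hsum/(hsum_usummable hl).
Qed.

Lemma Qmat_diag i : Qmat P p i i = (p i)%:C%C.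
Proof.
congr (_%:C%C); apply: hsum_usum; case: hp => _ _ /(_ i) h.
apply: hsum_eq ((hsum_nneg (p i) _).2 h) => // k; last by rewrite mulr_ge0.
by rewrite -expr2 sqrtr_sqr ger0_norm.
Qed.

Lemma Qstate_rdiag x : (forall k, 0 <= x k <= 1) -> Qstate P p (rdiag x) = (mean p x)%:C%C.
Proof.
move=> x01; apply: hsum_usum.
apply: hsum_eq (hsum_real_complex (mean_hsum (weight_stationary hp) (bounded01 x01))) => // i.
by rewrite /rdiag mul_mat_diagm Qmat_diag rmorphM.
Qed.

Lemma Qstate_munit (y : C) s t : Qstate P p (mat_scale y (munit s t)) = Qmat P p t s * y.
Proof.
have E i j : mat_mul (Qmat P p) (mat_scale y (munit s t)) i j = Qmat P p i s * y * (j == t)%:R.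
  apply: hsum_usum; apply: hsum_eq (@hsum1 _ _ s
    (fun k => Qmat P p i k * mat_scale y (munit s t) k j) _) => //.
    by rewrite /mat_scale /munit eqxx mul1r mulrA.
  by move=> k /negbTE ks; rewrite /mat_scale /munit ks mul0r !mulr0.
apply: hsum_usum; apply: hsum_eq (@hsum1 _ _ t
  (fun i => mat_mul (Qmat P p) (mat_scale y (munit s t)) i i) _) => //.
  by rewrite E eqxx mulr1.
by move=> i /negbTE it; rewrite E it mulr0.
Qed.

(** A nonzero entry requires some [k] in the support with an edge to [j], and the support is closed
    under edges. *)
Lemma Qmat_support i j : Qmat P p i j != 0 -> 0 < p j.
Proof.
apply: contra_neqT; rewrite -leNgt => pj; rewrite /Qmat (hsum_usum (l := 0))//.
apply: hsum_eq hsum0 => // k.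
have := p0 k; rewrite le_eqVlt => /orP[/eqP <-|pk]; first by rewrite mul0r.
have := P0 k j; rewrite le_eqVlt => /orP[/eqP <-|Pkj]; first by rewrite mulr0 sqrtr0 mulr0.
by have [] := support_edge hP hp pk Pkj; rewrite ltNge pj.
Qed.

Definition word (Bs : seq (@mat R I I)) (X : @mat R I I) : @mat R I I :=
  foldr (transition_at P) X Bs.

(** The classical chain appears here: on diagonal matrices, a site carrying the identity acts as
    [Pop]. *)
Lemma word_gap n x : (forall k, 0 <= x k <= 1) ->
  word (nseq n (mat_id I)) (rdiag x) = rdiag (iter n (Pop P) x).
Proof.
move=> x01; elim: n => //= n ->; rewrite rdiag1 transition_diag_rdiag.
  by congr rdiag; apply/funext => i; rewrite mul1r.
exact: iter_Pop01.
Qed.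

Definition munits (st : seq (I * I)) : seq (@mat R I I) := [seq munit q.1 q.2 | q <- st].

(** [c] is the product of the square roots of [P] along the row path and the column path of the
    word. If it is nonzero the row path is a path of the chain, which later confines the
    correlations to the support. The diagonal [x] enters at the last site only, through
    [overlap]. *)
Lemma word_munits q0 st : exists c : R, [/\ 0 <= c <= 1,
  c != 0 -> reach P q0.1 (last q0 st).1 &
  forall x, (forall k, 0 <= x k <= 1) -> word (munits (q0 :: st)) (rdiag x) =
    mat_scale (c * mean (overlap (last q0 st).1 (last q0 st).2) x)%:C%C (munit q0.1 q0.2)].
Proof.
elim: st q0 => [|q1 st IH] q0.
  exists 1; split=> [|_|x x01]; first by rewrite ler01 lexx.
    exact: reach_refl.
  apply/funext => i; apply/funext => j; rewrite /= transition_rdiag// mul1r.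
  rewrite /mat_scale /munit; case: (i =P q0.1) => [->|_]; last by rewrite !mul0r mulr0.
  case: (j =P q0.2) => [->|_]; last by rewrite !mulr0 mul0r.
  by rewrite !mulr1 mul1r.
have [c [/andP[c0 c1] cr ec]] := IH q1.
have sq01 i j : 0 <= Num.sqrt (P i j) <= 1.
  by rewrite sqrtr_ge0 -sqrtr1 ler_wsqrtr// P_le1.
have /andP[a0 a1] := sq01 q0.1 q1.1; have /andP[b0 b1] := sq01 q0.2 q1.2.
exists (c * (Num.sqrt (P q0.1 q1.1) * Num.sqrt (P q0.2 q1.2))); split=> [||x x01].
- by rewrite !mulr_ge0//= !mulr_ile1// mulr_ge0.
- rewrite !mulf_eq0 !negb_or => /and3P[/cr h1 h2 _].
  apply: (reach_trans hP) h1; exists 1%N; apply/(stepsS hP); exists q1.1.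
  split; last exact/steps0.
  by rewrite lt_def P0 andbT; apply: contra_neq h2 => ->; rewrite sqrtr0.
- have -> : word (munits (q0 :: q1 :: st)) (rdiag x) =
    transition_at P (munit q0.1 q0.2) (word (munits (q1 :: st)) (rdiag x)) by [].
  rewrite ec//.
  apply/funext => i; apply/funext => j; rewrite transition_munit.
  rewrite /mat_scale /munit; case: (i =P q0.1) => [->|_]; last by rewrite !mul0r mulr0.
  case: (j =P q0.2) => [->|_]; last by rewrite !mulr0 mul0r.
  by rewrite !mulr1 mul1r /= -rmorphM; congr (_%:C%C); ring.
Qed.

End Transition.

(** * Products of one-site operators on consecutive sites *)

Section SiteTensors.
Context {R : realType} {I : choiceType}.
Local Notation C := R[i].
Local Notation nc := ComplexField.Normc.normc.
Local Notation conf := (int -> I).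
Local Notation cmat := (@mat R conf conf).
Implicit Types (s t u : conf) (k : int) (n m d : nat) (B : int -> @mat R I I).

Lemma sitesP k n j : reflect (exists2 i, (i < n)%N & j = k + i%:Z) (j \in sites k n).
Proof.
apply: (iffP idP) => [/imfsetP[i /=]|[i hi ->]].
  by rewrite mem_iota add0n => hi ->; exists i.
by apply/imfsetP; exists i => //=; rewrite mem_iota.
Qed.

Lemma site_tensorE k n B s t :
  site_tensor B (restr (sites k n) s) (restr (sites k n) t) =
  \prod_(i <- iota 0 n) B (k + i%:Z) (s (k + i%:Z)) (t (k + i%:Z)).
Proof.
rewrite /site_tensor /restr -(big_seq_fsetE _ (sites k n) xpredT (fun j => B j (s j) (t j))) /=.
rewrite /sites big_imfset /=; last by move=> x y _ _ /addrI; case.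
by rewrite undup_id ?iota_uniq.
Qed.

Definition tensor k n B : cmat := embed (site_tensor (J := sites k n) B).

Lemma tensor_in k n B s t : agree_off (sites k n) s t ->
  tensor k n B s t = \prod_(i <- iota 0 n) B (k + i%:Z) (s (k + i%:Z)) (t (k + i%:Z)).
Proof. by move=> h; rewrite /tensor embedE// site_tensorE. Qed.

Lemma tensor_out k n B s t : ~ agree_off (sites k n) s t -> tensor k n B s t = 0.
Proof. exact: embed_eq0. Qed.

Lemma localm_tensor k n B : localm (sites k n) (tensor k n B).
Proof. exact: localm_embed. Qed.

Lemma tensor_shift k n B d :
  iter d Defs.shift (tensor k n B) = tensor (k + d%:Z) n (fun j => B (j - d%:Z)).
Proof.
apply/funext => s; apply/funext => t; rewrite iter_shiftE.
have off : agree_off (sites k n) (translate d%:Z s) (translate d%:Z t) <->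
    agree_off (sites (k + d%:Z) n) s t.
  split=> h j hj.
    have := h (j - d%:Z); rewrite /translate subrK; apply; apply: contra hj => /sitesP[i hi e].
    apply/sitesP; exists i => //; rewrite -(subrK d%:Z j) e; ring.
  apply: h; apply: contra hj => /sitesP[i hi e]; apply/sitesP; exists i => //.
  by rewrite -(addrK d%:Z j) e; ring.
have [h|h] := pselect (agree_off (sites (k + d%:Z) n) s t); last first.
  by rewrite !tensor_out// => /off.
rewrite !tensor_in//; last exact/off.
apply: eq_bigr => i _; rewrite /translate.
have -> : k + d%:Z + i%:Z - d%:Z = k + i%:Z by ring.
by have -> : k + d%:Z + i%:Z = k + i%:Z + d%:Z by ring.
Qed.

Definition glue_sites k m d B B' : int -> @mat R I I := fun j =>
  if (j < k + m%:Z)%R then B j else if (j < k + d%:Z)%R then mat_id I else B' j.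

Lemma tensor_mul k m d B B' : (m <= d)%N ->
  mat_mul (tensor k m B) (tensor (k + d%:Z) m B') = tensor k (d + m) (glue_sites k m d B B').
Proof.
move=> md; apply/funext => s; apply/funext => u.
pose J := sites k m; pose K := sites (k + d%:Z) m; pose L := sites k (d + m).
have JK : [disjoint J & K]%fset.
  apply/fdisjointP => j /sitesP[i hi ->]; apply/negP => /sitesP[i' hi'].
  rewrite -addrA => /addrI e; have : (i = d + i')%N by move: e; rewrite -PoszD => -[].
  by move=> e'; move: hi; rewrite e' ltnNge (leq_trans md)// leq_addr.
rewrite (localm_mul_disjoint s u (localm_tensor k m B) (localm_tensor (k + d%:Z) m B') JK).
rewrite -/J; set r := glue s (restr J u).
have rJ i : (i < m)%N -> r (k + i%:Z) = u (k + i%:Z).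
  move=> hi; have h : k + i%:Z \in J by apply/sitesP; exists i.
  by rewrite /r (glue_in _ _ h).
have rK i : (i < m)%N -> r (k + d%:Z + i%:Z) = s (k + d%:Z + i%:Z).
  move=> hi; rewrite /r glue_out//; apply/negP => /(fdisjointP JK)/negP; apply.
  by apply/sitesP; exists i.
have E1 : tensor k m B s r = \prod_(i <- iota 0 m) B (k + i%:Z) (s (k + i%:Z)) (u (k + i%:Z)).
  rewrite tensor_in; last exact: agree_off_glue.
  rewrite big_seq [RHS]big_seq; apply: eq_bigr => i.
  by rewrite mem_iota => /andP[_ hi]; rewrite rJ.
have JL j : j \in J -> j \in L.
  by move=> /sitesP[i hi ->]; apply/sitesP; exists i; rewrite ?(leq_trans hi) ?leq_addl.
have KL j : j \in K -> j \in L.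
  move=> /sitesP[i hi ->]; apply/sitesP; exists (d + i)%N; first by rewrite ltn_add2l.
  by rewrite PoszD addrA.
have [h|h] := pselect (agree_off L s u); last first.
  rewrite [RHS]tensor_out// [X in _ * X]tensor_out ?mulr0// => h'; apply: h => j jL.
  have jJ : j \notin J by apply: contra jL; exact: JL.
  by rewrite -h' ?/r ?glue_out//; apply: contra jL; exact: KL.
rewrite [RHS]tensor_in// E1.
have -> : (d + m = m + (d - m) + m)%N by rewrite subnKC.
rewrite !iotaD !big_cat !add0n subnKC//=.
have P1 : \prod_(i <- iota 0 m) glue_sites k m d B B' (k + i%:Z) (s (k + i%:Z)) (u (k + i%:Z)) =
    \prod_(i <- iota 0 m) B (k + i%:Z) (s (k + i%:Z)) (u (k + i%:Z)).
  rewrite big_seq [RHS]big_seq; apply: eq_bigr => i; rewrite mem_iota => /andP[_ hi].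
  by rewrite /glue_sites ltrD2l ltz_nat hi.
have P2 : \prod_(i <- iota m (d - m)) glue_sites k m d B B' (k + i%:Z) (s (k + i%:Z)) (u (k + i%:Z)) =
    \prod_(i <- iota m (d - m)) (s (k + i%:Z) == u (k + i%:Z))%:R.
  rewrite big_seq [RHS]big_seq; apply: eq_bigr => i; rewrite mem_iota subnKC// => /andP[h1 h2].
  by rewrite /glue_sites !ltrD2l !ltz_nat h2 ltnNge h1.
have P3 : \prod_(i <- iota d m) glue_sites k m d B B' (k + i%:Z) (s (k + i%:Z)) (u (k + i%:Z)) =
    \prod_(i <- iota 0 m) B' (k + d%:Z + i%:Z) (s (k + d%:Z + i%:Z)) (u (k + d%:Z + i%:Z)).
  rewrite -[X in iota X m]addn0 iotaDl big_map big_seq [RHS]big_seq; apply: eq_bigr => i _.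
  rewrite PoszD addrA /glue_sites -addrA !ltrD2l -PoszD !ltz_nat.
  by rewrite !ltnNge leq_addr (leq_trans md) ?leq_addr.
rewrite P1 P2 P3 -mulrA; congr (_ * _).
(* If [s] and [u] agree in the gap, the identities there contribute 1. Otherwise both sides vanish:
   an identity entry is 0 on the right, and on the left [r], equal to [s] in the gap, differs from
   [u] off [K]. *)
have [gap|gap] := pselect (forall i, (m <= i < d)%N -> s (k + i%:Z) = u (k + i%:Z)).
  rewrite big_seq big1 ?mul1r => [|i]; last by rewrite mem_iota subnKC// => /gap ->; rewrite eqxx.
  rewrite tensor_in.
    rewrite big_seq [RHS]big_seq; apply: eq_bigr => i; rewrite mem_iota => /andP[_ hi].
    by rewrite rK.
  move=> j jK; have [jJ|jJ] := boolP (j \in J).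
    by case/sitesP: jJ => i hi ->; exact: rJ.
  rewrite /r glue_out//; have [jL|jL] := boolP (j \in L); last exact: h.
  case/sitesP: jL => i hi e; rewrite e; apply: gap; apply/andP; split.
    by rewrite leqNgt; apply: contra jJ => im; apply/sitesP; exists i.
  rewrite ltnNge; apply: contra jK => di; apply/sitesP; exists (i - d)%N.
    by rewrite ltn_subLR.
  by rewrite e -addrA -PoszD subnKC.
rewrite tensor_out.
  apply/esym; suff -> : \prod_(i <- iota m (d - m)) ((s (k + i%:Z) == u (k + i%:Z))%:R : C) = 0.
    by rewrite mul0r.
  apply/eqP; rewrite prodf_seq_eq0; apply/hasP.
  have [i /existsNP[hi /eqP ne]] : exists i, ~ ((m <= i < d)%N -> s (k + i%:Z) = u (k + i%:Z)).
    exact/existsNP.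
  by exists i; rewrite ?mem_iota ?subnKC//= (negbTE ne).
move=> h'; apply: gap => i /andP[mi id].
have iJ : k + i%:Z \notin J.
  by apply/sitesP => -[i' hi' /addrI [e]]; rewrite e leqNgt hi' in mi.
have iK : k + i%:Z \notin K.
  apply/sitesP => -[i' hi']; rewrite -addrA -PoszD => /addrI [e].
  by rewrite e ltnNge leq_addr in id.
by rewrite -h' ?/r ?glue_out.
Qed.

Lemma glue_sites_map k m d B B' : (m <= d)%N ->
  [seq glue_sites k m d B B' (k + i%:Z) | i <- iota 0 (d + m)] =
  [seq B (k + i%:Z) | i <- iota 0 m] ++ nseq (d - m) (mat_id I) ++
  [seq B' (k + d%:Z + i%:Z) | i <- iota 0 m].
Proof.
move=> md; have -> : (d + m = m + ((d - m) + m))%N by rewrite addnA subnKC.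
rewrite !iotaD !map_cat !add0n subnKC//; congr (_ ++ (_ ++ _)).
- apply/eq_in_map => i; rewrite mem_iota => /andP[_ hi].
  by rewrite /glue_sites ltrD2l ltz_nat hi.
- apply: (@eq_from_nth _ (mat_id I)); rewrite size_map size_iota ?size_nseq// => i hi.
  rewrite (nth_map 0%N) ?size_iota// nth_iota// nth_nseq hi.
  have h2 : (m + i < d)%N by rewrite -ltn_subRL.
  by rewrite /glue_sites !ltrD2l !ltz_nat h2 ltnNge leq_addr.
- rewrite -[X in iota X m]addn0 iotaDl -map_comp; apply/eq_in_map => i _ /=.
  rewrite PoszD addrA /glue_sites -addrA !ltrD2l -PoszD !ltz_nat.
  by rewrite !ltnNge leq_addr (leq_trans md) ?leq_addr.
Qed.

Lemma tensor_diag k (a : I -> C) : tensor k 1 (fun=> diagm a) = diagm (fun s => a (s k)).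
Proof.
apply/funext => s; apply/funext => t.
have [h|h] := pselect (agree_off (sites k 1) s t).
  rewrite tensor_in// big_seq1 addr0 /diagm; congr (_ * (nat_of_bool _)%:R).
  apply/eqP/eqP => [e|->//]; apply/funext => j.
  have [jk|jk] := eqVneq j k; first by rewrite jk.
  by apply: h; apply/sitesP => -[[|//] _]; rewrite addr0 => /eqP; exact/negP.
rewrite tensor_out// /diagm; case: (s =P t) => [e|_]; last by rewrite mulr0.
by case: h; rewrite e.
Qed.

Lemma embed_munit k n s t :
  embed (munit (restr (sites k n) s) (restr (sites k n) t)) =
  tensor k n (fun j => munit (s j) (t j)).
Proof.
rewrite /tensor; congr embed; apply/funext => x; apply/funext => y.
rewrite /site_tensor /munit big_split /=; congr (_ * _).
  have [->|xs] := eqVneq x (restr _ s).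
    by rewrite big1// => j _; rewrite /restr eqxx.
  apply/esym/eqP; rewrite prodf_seq_eq0; apply/hasP.
  have [j jx] : exists j, x j != s (val j).
    apply: contrapT => no; move/eqP: xs; apply; apply/funext => j.
    by apply/eqP/negPn/negP => h; apply: no; exists j.
  by exists j; rewrite ?mem_index_enum//= (negbTE jx).
have [->|yt] := eqVneq y (restr _ t).
  by rewrite big1// => j _; rewrite /restr eqxx.
apply/esym/eqP; rewrite prodf_seq_eq0; apply/hasP.
have [j jx] : exists j, y j != t (val j).
  apply: contrapT => no; move/eqP: yt; apply; apply/funext => j.
  by apply/eqP/negPn/negP => h; apply: no; exists j.
by exists j; rewrite ?mem_index_enum//= (negbTE jx).
Qed.

Lemma opb_munit (S : choiceType) (x y : S) : opb (@munit R S x y) 1.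
Proof.
split=> // F G f g.
have -> : \sum_(a <- F) \sum_(b <- G) f a * munit x y a b * g b =
    ((x \in F)%:R * f x) * ((y \in G)%:R * g y).
  rewrite -!sum_delta mulr_suml; apply: eq_bigr => a _; rewrite mulr_sumr.
  by apply: eq_bigr => b _; rewrite /munit (eq_sym a) (eq_sym b); ring.
have single (H : {fset S}) (h : S -> C) z : nc ((z \in H)%:R * h z) ^+ 2 <= \sum_(a <- H) nc (h a) ^+ 2.
  have [zH|zH] := boolP (z \in H); last first.
    by rewrite mul0r nc0 expr0n sumr_ge0// => *; exact: sqr_ge0.
  rewrite mul1r (big_fsetD1 z zH) /= lerDl sumr_ge0// => *; exact: sqr_ge0.
have h1 := single F f x; have h2 := single G g y.
rewrite ncM; set X := nc _ in h1 *; set Y := nc _ in h2 *.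
have h3 := sqr_ge0 (X - Y).
have h4 : X * Y = 1 / 2 * (X ^+ 2 + Y ^+ 2) - 1 / 2 * (X - Y) ^+ 2 by field.
rewrite h4; lra.
Qed.

Lemma bounded_munit (x y : I) : bounded (@munit R I x y).
Proof. by apply/boundedP; exists 1; exact: opb_munit. Qed.

Lemma opb_rdiag (a : I -> R) : in01 a -> opb (rdiag a) 1.
Proof. exact: opb_diagm01. Qed.

End SiteTensors.

(** * Correlations of the entangled chain as classical expectations *)

Section ChainCorrelations.
Context {R : realType} {I : choiceType}.
Local Notation C := R[i].
Local Notation conf := (int -> I).
Local Notation cmat := (@mat R conf conf).
Variables (P : I -> I -> R) (p : I -> R) (w : cmat -> C).
Hypotheses (hP : stochastic P) (hp : stationary P p) (hw : entangled_markov_chain P p w).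
Implicit Types (s t u v : conf) (k : int) (n m d : nat) (B : int -> @mat R I I) (a b : I -> R).

Local Notation Pop := (Pop P).

Lemma chain_state : state w. Proof. by case: hw => -[]. Qed.

Lemma chain_tensor k n B : (0 < n)%N -> (forall j, bounded (B j)) ->
  w (tensor k n B) = Qstate P p (word P [seq B (k + i%:Z) | i <- iota 0 n] (mat_id I)).
Proof. by move=> n0 hB; case: hw => _ _ h; rewrite /tensor h// /word foldr_map. Qed.

Lemma bounded_mat_id : bounded (@mat_id R I).
Proof. by apply/boundedP; exists 1; exact: opb_id. Qed.

Lemma chain_two_point k m d B B' : (0 < m)%N -> (m <= d)%N ->
  (forall j, bounded (B j)) -> (forall j, bounded (B' j)) ->
  w (mat_mul (tensor k m B) (iter d Defs.shift (tensor k m B'))) =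
  Qstate P p (word P [seq B (k + i%:Z) | i <- iota 0 m]
    (word P (nseq (d - m) (mat_id I)) (word P [seq B' (k + i%:Z) | i <- iota 0 m] (mat_id I)))).
Proof.
move=> m0 md hB hB'; rewrite tensor_shift tensor_mul// chain_tensor.
- rewrite glue_sites_map//.
  have -> : [seq B' (k + d%:Z + i%:Z - d%:Z) | i <- iota 0 m] = [seq B' (k + i%:Z) | i <- iota 0 m].
    by apply: eq_map => i; congr B'; ring.
  by rewrite /word !foldr_cat.
- by rewrite addn_gt0 m0 orbT.
- move=> j; rewrite /glue_sites; case: ifP => _; first exact: hB.
  by case: ifP => _; [exact: bounded_mat_id|exact: hB'].
Qed.

Definition site (a : I -> R) : cmat := diagm (fun s => (a (s 0))%:C%C).

Lemma site_tensor1 a : site a = tensor 0 1 (fun=> rdiag a).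
Proof. by rewrite /rdiag tensor_diag. Qed.

Lemma bounded_rdiag a : in01 a -> bounded (rdiag a).
Proof. by move=> h; apply/boundedP; exists 1; exact: opb_rdiag. Qed.

Lemma word_rdiag a x : in01 x -> word P [:: rdiag a] (rdiag x) = rdiag (fun i => a i * Pop x i).
Proof. by move=> hx; rewrite /word /= transition_diag_rdiag. Qed.

Lemma word_rdiag1 a : in01 a -> word P [:: rdiag a] (mat_id I) = rdiag a.
Proof.
move=> ha; rewrite rdiag1 word_rdiag => [|k]; last by rewrite ler01 lexx.
by congr rdiag; apply/funext => i; rewrite (Pop_cst hP) mulr1.
Qed.

Lemma chain_site a : in01 a -> w (site a) = (mean p a)%:C%C.
Proof.
move=> ha; rewrite site_tensor1 chain_tensor//; last by move=> _; exact: bounded_rdiag.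
by rewrite (_ : [seq _ | _ <- _] = [:: rdiag a])// word_rdiag1// Qstate_rdiag.
Qed.

Lemma chain_site_two_point n a b : (0 < n)%N -> in01 a -> in01 b ->
  w (mat_mul (site a) (iter n Defs.shift (site b))) =
  (mean p (fun i => a i * iter n Pop b i))%:C%C.
Proof.
move=> n0 ha hb; rewrite !site_tensor1 chain_two_point//; try by move=> _; exact: bounded_rdiag.
rewrite (_ : [seq _ | _ <- _] = [:: rdiag a])// (_ : [seq _ | _ <- _] = [:: rdiag b])//.
rewrite word_rdiag1// (word_gap hP)// word_rdiag; last exact: iter_Pop01.
rewrite -iterS subn1 prednK// Qstate_rdiag// => k.
have /andP[h1 h2] := ha k; have /andP[h3 h4] := iter_Pop01 hP n hb k.
by rewrite mulr_ge0//= mulr_ile1.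
Qed.

Lemma mean_cst1 (mu : I -> R) (m : R) : weight mu m -> mean mu (fun=> 1) = m.
Proof. by move=> h; rewrite (mean_cst _ h) mul1r. Qed.

(** The distance is [m + g.+1], with [g.+1] free sites: the last one turns the right-hand matrix
    unit into the diagonal [b], the other [g] apply [Pop]. The left-hand unit reads the result
    through [mu], the overlap at its last site, and [C0] collects its square roots and an entry of
    [Qmat]. *)
Lemma chain_units k m s t u v : (0 < m)%N ->
  exists (C0 : C) (mu : I -> R) (mm : R) (b : I -> R),
  [/\ weight mu mm, in01 b, (C0 != 0 -> forall i, 0 < mu i -> 0 < p i),
    w (tensor k m (fun j => munit (s j) (t j))) = C0 * mm%:C%C /\
    w (tensor k m (fun j => munit (u j) (v j))) = (mean p b)%:C%C &
    forall g, w (mat_mul (tensor k m (fun j => munit (s j) (t j)))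
        (iter (m + g.+1) Defs.shift (tensor k m (fun j => munit (u j) (v j))))) =
      C0 * (mean mu (iter g Pop b))%:C%C].
Proof.
case: m => // m _.
have units s' t' : exists q0 st, forall X : @mat R I I,
    word P [seq munit (s' (k + i%:Z)) (t' (k + i%:Z)) | i <- iota 0 m.+1] X =
    word P (munits (q0 :: st)) X.
  exists (s' (k + 0%:Z), t' (k + 0%:Z)), [seq (s' (k + i%:Z), t' (k + i%:Z)) | i <- iota 1 m] => X.
  by rewrite /munits /= -map_comp.
have [q0 [st E1]] := units s t; have [r0 [rt E2]] := units u v.
have [c1 [/andP[c10 c11] c1r e1]] := word_munits hP q0 st.
have [c2 [/andP[c20 c21] _ e2]] := word_munits hP r0 rt.
have one01 : in01 (fun _ : I => 1 : R) by move=> i; rewrite ler01 lexx.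
set mu := overlap P (last q0 st).1 (last q0 st).2 in e1.
have hmu : weight mu _ := overlap_weight hP (last q0 st).1 (last q0 st).2.
have hnu := overlap_weight hP (last r0 rt).1 (last r0 rt).2.
pose y := c2 * overlap_mass P (last r0 rt).1 (last r0 rt).2.
have /andP[mass0 mass1] := overlap_mass01 hP (last r0 rt).1 (last r0 rt).2.
have y0 : 0 <= y by rewrite mulr_ge0.
have y1 : y <= 1 by rewrite mulr_ile1.
(* Diagonal part left by one identity site in front of the right-hand word, whose value is [y] times
   the unit at its first indices [r0]. *)
pose b i := y * (Num.sqrt (P i r0.1) * Num.sqrt (P i r0.2)).
have sq01 i j : 0 <= Num.sqrt (P i j) <= 1.
  by rewrite sqrtr_ge0 -sqrtr1 ler_wsqrtr// P_le1.
have b01 : in01 b.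
  move=> i; have /andP[a0 a1] := sq01 i r0.1; have /andP[d0 d1] := sq01 i r0.2.
  by rewrite !mulr_ge0//= !mulr_ile1// mulr_ge0.
have B1 s' t' j : bounded (@munit R I (s' j) (t' j)) by exact: bounded_munit.
exists (Qmat P p q0.2 q0.1 * c1%:C%C), mu, (overlap_mass P (last q0 st).1 (last q0 st).2), b.
split=> //.
- rewrite mulf_eq0 negb_or => /andP[/(Qmat_support hP hp) pq0 c1n] i mui.
  have {}c1n : c1 != 0 by apply: contra_neq c1n => ->.
  have [pl _] := support_reach hP hp pq0 (c1r c1n).
  have Pi : 0 < P (last q0 st).1 i.
    rewrite lt_def (weight_row hP _).1 andbT; apply: contraTneq mui => e.
    by rewrite /mu /overlap e sqrtr0 mul0r ltxx.
  by have [] := support_edge hP hp pl Pi.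
- split.
    rewrite chain_tensor// E1 rdiag1 e1// Qstate_munit (mean_cst1 hmu).
    by rewrite rmorphM mulrA.
  rewrite chain_tensor// E2 rdiag1 e2// Qstate_munit (mean_cst1 hnu) -/y.
  rewrite /Qmat -rmorphM; congr (_%:C%C).
  apply/esym/meanE; apply: hsum_eq (hsumZ (c := y) (Qmat_hsum hP hp (i := r0.2) (j := r0.1))) => [i|].
    by rewrite /b sqrtrM ?(weight_row hP i).1//; ring.
  by rewrite mulrC.
- move=> g; rewrite chain_two_point ?leq_addr//.
  rewrite E1 E2 rdiag1 e2// (mean_cst1 hnu) -/y addKn -addn1 nseqD /word foldr_cat -!/(word P _ _).
  have -> : word P (nseq 1 (rdiag (fun=> 1))) (mat_scale y%:C%C (munit r0.1 r0.2)) = rdiag b.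
    apply/funext => i; apply/funext => j.
    rewrite /word /= transition_munit /rdiag /diagm mul1r.
    case: eqP => [<-|_]; last by rewrite mul0r mulr0.
    by rewrite mul1r mulr1 -rmorphM.
  rewrite -[nseq g _]/(nseq g (rdiag (fun=> 1))) -rdiag1 (word_gap hP)//.
  rewrite e1; last exact: iter_Pop01.
  by rewrite Qstate_munit rmorphM mulrA.
Qed.

End ChainCorrelations.

(** * Ergodicity and clustering from the classical chain *)

Section Ergodicity.
Context {R : realType} {I : choiceType}.
Local Notation C := R[i].
Local Notation nc := ComplexField.Normc.normc.
Local Notation conf := (int -> I).
Local Notation cmat := (@mat R conf conf).
Local Notation one := (@mat_id R conf).
Implicit Types (X Y Z A B : cmat) (J : {fset int}) (e M N K : R).

Lemma opb_ge0 (S T : choiceType) (A : @mat R S T) M : opb A M -> 0 <= M.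
Proof. by move=> hA; apply: (proj1 hA). Qed.

#[local] Opaque quasilocal opb usum mat_mul.

Lemma fset_in_sites J : exists n0 : nat, forall n, (n0 <= n)%N ->
  (J `<=` sites (- n%:Z)%R (n + n.+1))%fset.
Proof.
exists (\max_(j <- J) `|j|%N)%N => n hn; apply/fsubsetP => j jJ.
have jn : (`|j| <= n)%N.
  by apply: leq_trans hn; exact: (@leq_bigmax_seq _ _ xpredT (fun j : int => `|j|%N) j jJ).
apply/sitesP; exists (absz (j + n%:Z)%R); lia.
Qed.

Definition delta_state (w : cmat -> C) n A B : C :=
  w (mat_mul A (iter n Defs.shift B)) - w A * w B.

Lemma iter_shift_lin n c A B : iter n Defs.shift (mat_add (mat_scale c A) B) =
  mat_add (mat_scale c (iter n Defs.shift A)) (iter n Defs.shift B).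
Proof.
apply/funext => s; apply/funext => t.
by rewrite /mat_add /mat_scale !iter_shiftE.
Qed.

Lemma iter_shift_id n : iter n Defs.shift one = one.
Proof.
elim: n => //= n ->; apply/funext => s; apply/funext => t; rewrite /Defs.shift /mat_id.
congr (nat_of_bool _)%:R; apply/eqP/eqP => [e|->//].
by apply: (@translate_inj I 1); exact: e.
Qed.

Lemma state_lin (w : cmat -> C) c A B : state w -> quasilocal A -> quasilocal B ->
  w (mat_add (mat_scale c A) B) = c * w A + w B.
Proof. by case=> h _ _; exact: h. Qed.

Lemma mat_mul_linl (S : choiceType) c (A B D : @mat R S S) M N K : opb A M -> opb B N -> opb D K ->
  mat_mul (mat_add (mat_scale c A) B) D = mat_add (mat_scale c (mat_mul A D)) (mat_mul B D).
Proof.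
move=> hA hB hD; pose L := nc c * M + N.
have h1 : opb (mat_scale c A) L.
  by apply: opb_le (opb_scale c hA); rewrite lerDl; exact: opb_ge0 hB.
have h2 : opb B L by apply: opb_le hB; rewrite lerDr mulr_ge0 ?nc_ge0//; exact: opb_ge0 hA.
by rewrite (mat_mulDl h1 h2 hD) (mat_mulZl c hA hD).
Qed.

Lemma mat_mul_linr (S : choiceType) c (A B D : @mat R S S) M N K : opb A M -> opb B N -> opb D K ->
  mat_mul D (mat_add (mat_scale c A) B) = mat_add (mat_scale c (mat_mul D A)) (mat_mul D B).
Proof.
move=> hA hB hD; pose L := nc c * M + N.
have h1 : opb (mat_scale c A) L by apply: opb_le (opb_scale c hA); rewrite lerDl; exact: opb_ge0 hB.
have h2 : opb B L by apply: opb_le hB; rewrite lerDr mulr_ge0 ?nc_ge0//; exact: opb_ge0 hA.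
by rewrite (mat_mulDr h1 h2 hD) (mat_mulZr c hA hD).
Qed.

Section Form.
Variable w : cmat -> C.
Hypothesis hw : state w.

Lemma state_mul_linl c A B D : quasilocal A -> quasilocal B -> quasilocal D ->
  w (mat_mul (mat_add (mat_scale c A) B) D) = c * w (mat_mul A D) + w (mat_mul B D).
Proof.
move=> qA qB qD; have [M [_ hA]] := quasilocal_opb qA; have [N [_ hB]] := quasilocal_opb qB.
have [K [_ hD]] := quasilocal_opb qD.
have qAD := quasilocal_mul qA qD; have qBD := quasilocal_mul qB qD.
by rewrite (mat_mul_linl c hA hB hD) (state_lin c hw qAD qBD).
Qed.

Lemma state_mul_linr c A B D : quasilocal A -> quasilocal B -> quasilocal D ->
  w (mat_mul D (mat_add (mat_scale c A) B)) = c * w (mat_mul D A) + w (mat_mul D B).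
Proof.
move=> qA qB qD; have [M [_ hA]] := quasilocal_opb qA; have [N [_ hB]] := quasilocal_opb qB.
have [K [_ hD]] := quasilocal_opb qD.
have qDA := quasilocal_mul qD qA; have qDB := quasilocal_mul qD qB.
by rewrite (mat_mul_linr c hA hB hD) (state_lin c hw qDA qDB).
Qed.

Lemma delta_linl n c A B D : quasilocal A -> quasilocal B -> quasilocal D ->
  delta_state w n (mat_add (mat_scale c A) B) D =
  c * delta_state w n A D + delta_state w n B D.
Proof.
move=> qA qB qD; have qD' := quasilocal_iter_shift n qD.
by rewrite /delta_state (state_mul_linl c qA qB qD') (state_lin c hw qA qB); ring.
Qed.

Lemma delta_linr n c A B D : quasilocal A -> quasilocal B -> quasilocal D ->
  delta_state w n D (mat_add (mat_scale c A) B) =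
  c * delta_state w n D A + delta_state w n D B.
Proof.
move=> qA qB qD; have qA' := quasilocal_iter_shift n qA; have qB' := quasilocal_iter_shift n qB.
by rewrite /delta_state iter_shift_lin (state_mul_linr c qA' qB' qD) (state_lin c hw qA qB); ring.
Qed.

Lemma delta_norm_le n A B M N : quasilocal A -> quasilocal B -> 0 < M -> 0 < N ->
  opb A M -> opb B N -> nc (delta_state w n A B) <= 6 * (M * N).
Proof.
move=> qA qB M0 N0 hA hB; have hB' := opb_iter_shift n hB.
have qB' := quasilocal_iter_shift n qB.
have MN0 : 0 < M * N by exact: mulr_gt0.
have h1 := state_norm_le hw (quasilocal_mul qA qB') MN0 (opb_mul hA hB').
have h2 := state_norm_le hw qA M0 hA; have h3 := state_norm_le hw qB N0 hB.
apply: le_trans (ncB _ _) _; rewrite ncM.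
have h4 : nc (w A) * nc (w B) <= (2 * M) * (2 * N) by apply: ler_pM; rewrite ?nc_ge0.
apply: le_trans (lerD h1 h4) _; apply: le_of_eq; ring.
Qed.

End Form.

(** Unnormalised, and written with [mat_scale 1] so that [quasilocal_lin] and [state_lin] apply to
    each step. *)
Definition birkhoff n (u : cmat) : cmat :=
  iteri n (fun k X => mat_add (mat_scale 1 X) (iter k Defs.shift u)) (fun _ _ => 0).

Lemma quasilocal_birkhoff n u : quasilocal u -> quasilocal (birkhoff n u).
Proof.
move=> qu; elim: n => [|n IH]; first exact: quasilocal0.
exact: quasilocal_lin (quasilocal_iter_shift n qu).
Qed.

Section MeanSquare.
Variable w : cmat -> C.
Hypothesis hw : invariant_state w.
Let sw : state w. Proof. by case: hw. Qed.

Lemma invariant_iter n X : quasilocal X -> w (iter n Defs.shift X) = w X.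
Proof.
move=> qX; elim: n => //= n <-; case: hw => _; apply.
exact: quasilocal_iter_shift.
Qed.

Lemma state0 : w (fun _ _ => 0) = 0.
Proof.
rewrite -(mat_scale0 one) (state_scale sw); last exact: quasilocal_id.
by rewrite mul0r.
Qed.

Lemma birkhoff_state n u : quasilocal u -> w (birkhoff n u) = n%:R * w u.
Proof.
move=> qu; elim: n => [|n IH]; first by rewrite mul0r; exact: state0.
have h := state_lin 1 sw (quasilocal_birkhoff n qu) (quasilocal_iter_shift n qu).
rewrite /birkhoff iteriS -/(birkhoff n u) h IH (invariant_iter _ qu) -natr1; ring.
Qed.

Lemma shift_mul X Y : mat_mul (Defs.shift X) (Defs.shift Y) = Defs.shift (mat_mul X Y).
Proof.
#[local] Transparent mat_mul.
apply/funext => s; apply/funext => t; rewrite /Defs.shift /mat_mul.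
have bij : forall r : conf, exists r', translate 1 r' = r.
  by move=> r; exists (translate (- 1) r); apply/funext => x; rewrite /translate addrK.
rewrite [RHS](usum_inj (@translate_inj I 1)) => [//|r h].
by have [r' e] := bij r; case: (h r').
Qed.
#[local] Opaque mat_mul.

Lemma iter_shift_mul n X Y : mat_mul (iter n Defs.shift X) (iter n Defs.shift Y) =
  iter n Defs.shift (mat_mul X Y).
Proof. by elim: n => //= n <-; exact: shift_mul. Qed.

Lemma shift_correlation k d X Y : quasilocal X -> quasilocal Y ->
  w (mat_mul (iter k Defs.shift X) (iter (k + d) Defs.shift Y)) =
  w (mat_mul X (iter d Defs.shift Y)).
Proof.
move=> qX qY; rewrite iterD iter_shift_mul; apply: invariant_iter.
exact: quasilocal_mul qX (quasilocal_iter_shift d qY).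
Qed.

Lemma iter_shift_adj n X : mat_adj (iter n Defs.shift X) = iter n Defs.shift (mat_adj X).
Proof.
by apply/funext => s; apply/funext => t; rewrite mat_adjE !iter_shiftE mat_adjE.
Qed.

(** By invariance a correlation depends on the lag alone, so a translate placed at [n + j] meets the
    lags [j + 1] to [j + n]. The offset [j] makes the induction go through. *)
Lemma birkhoff_cross n j u : quasilocal u ->
  w (mat_mul (mat_adj (birkhoff n u)) (iter (n + j) Defs.shift u)) =
  \sum_(d < n) w (mat_mul (mat_adj u) (iter (d.+1 + j) Defs.shift u)).
Proof.
move=> qu; elim: n j => [|n IH] j.
  rewrite big_ord0; have -> : mat_adj (birkhoff 0 u) = mat_scale 0 one.
    by rewrite mat_scale0; apply/funext => s; apply/funext => t; rewrite mat_adjE conjc0.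
  have o1 := @opb_id R conf; have q := quasilocal_iter_shift (0 + j) qu.
  have [M [_ hM]] := quasilocal_opb q.
  by rewrite (mat_mulZl 0 o1 hM) (state_scale sw _ (quasilocal_mul (@quasilocal_id R I) q)) mul0r.
have qa := quasilocal_adj qu; have qb := quasilocal_birkhoff n qu.
rewrite /birkhoff iteriS -/(birkhoff n u) mat_adj_add mat_adj_scale conjc1.
rewrite (state_mul_linl sw 1 (quasilocal_adj qb) (quasilocal_adj (quasilocal_iter_shift n qu))
  (quasilocal_iter_shift (n.+1 + j) qu)).
rewrite mul1r iter_shift_adj addSnnS (shift_correlation n j.+1 qa qu) IH.
rewrite big_ord_recl addrC; congr (_ + _).
by apply: eq_bigr => d _; rewrite lift0 -addSnnS.
Qed.

Lemma birkhoff_sqnorm n u : quasilocal u ->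
  sqnorm w (birkhoff n.+1 u) = sqnorm w (birkhoff n u) + sqnorm w u +
    2 * complex.Re (\sum_(d < n) w (mat_mul (mat_adj u) (iter d.+1 Defs.shift u))).
Proof.
move=> qu; have qb := quasilocal_birkhoff n qu; have qs := quasilocal_iter_shift n qu.
have h := form_expand sw 1 qb qs.
rewrite {1}/sqnorm /birkhoff iteriS -/(birkhoff n u) h.
have [-> _] := form_cauchy_schwarz sw qb qs.
have := birkhoff_cross n 0 qu; rewrite addn0 => ->.
under eq_bigr do rewrite addn0.
have -> : sqnorm w (iter n Defs.shift u) = sqnorm w u.
  have := shift_correlation n 0 (quasilocal_adj qu) qu.
  by rewrite addn0 /sqnorm iter_shift_adj => ->.
rewrite nc1 conjc1; case: (\sum_(d < n) _) => x y /=; ring.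
Qed.

(** The increments in [birkhoff_sqnorm] are at most [sqnorm w u + 2 * (e * n%:R + K)]; their sum has
    quadratic coefficient at most [e]. *)
Lemma birkhoff_sqnorm_le u e : quasilocal u -> 0 <= e ->
  (exists K, forall n, nc (\sum_(d < n) w (mat_mul (mat_adj u) (iter d.+1 Defs.shift u))) <=
     e * n%:R + K) ->
  exists K, forall n, sqnorm w (birkhoff n u) <= e * n%:R ^+ 2 + K * n%:R.
Proof.
move=> qu e0 [K hK]; exists (sqnorm w u + 2 * K) => n.
elim: n => [|n IH].
  by rewrite /sqnorm /birkhoff /= (_ : mat_mul _ _ = mat_mul (mat_adj (mat_scale 0 one)) (mat_scale 0 one));
    [rewrite mat_adj_scale conjc0 (mat_mulZl 0 (opb_adj (@opb_id R conf)) (opb_scale 0 (@opb_id R conf)));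
     rewrite mat_scale0 state0 mulr0 addr0 expr0n mulr0|rewrite mat_scale0].
rewrite birkhoff_sqnorm//; set G := \sum_(d < n) _.
have h1 : complex.Re G <= e * n%:R + K.
  by apply: le_trans (hK n); apply: le_trans (nc_ge_Re _); exact: ler_norm.
rewrite -natr1; have n0 : 0 <= n%:R :> R by [].
nra.
Qed.

End MeanSquare.
End Ergodicity.

(** * Ergodicity when the support is connected *)

Section ErgodicSufficiency.
#[local] Opaque quasilocal opb usum mat_mul.
Context {R : realType} {I : choiceType}.
Local Notation C := R[i].
Local Notation nc := ComplexField.Normc.normc.
Local Notation conf := (int -> I).
Local Notation cmat := (@mat R conf conf).
Local Notation one := (@mat_id R conf).
Implicit Types (X Y Z A : cmat) (J : {fset int}) (e M N K : R).

Lemma cesaro_sum_bound (h : nat -> R) e : 0 < e ->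
  (fun q => (q.+1%:R)^-1 * \sum_(g < q.+1) h g) @ \oo --> 0 ->
  exists K, forall n, `|\sum_(g < n) h g| <= e * n%:R + K.
Proof.
move=> e0 /cvgr0Pnorm_lt /(_ e e0)[Q _ hQ].
exists (\sum_(g < Q) `|h g|) => n.
have S0 m : 0 <= \sum_(g < m) `|h g| by apply: sumr_ge0.
have [nQ|Qn] := leqP n Q.
  apply: le_trans (ler_norm_sum _ _ _) _.
  have -> : \sum_(g < Q) `|h g| = \sum_(g < n) `|h g| + \sum_(n <= g < Q) `|h g|.
    by rewrite -!(big_mkord xpredT (fun g => `|h g|)) -big_cat_nat.
  have : 0 <= \sum_(n <= g < Q) `|h g| by apply: sumr_ge0.
  by have : 0 <= e * n%:R by [rewrite mulr_ge0// ltW]; lra.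
case: n Qn => // q; rewrite ltnS => Qq; have := hQ q Qq.
rewrite normrM ger0_norm ?invr_ge0// mulrC ltr_pdivrMr// => h1.
by apply: le_trans (ltW h1) _; rewrite lerDl.
Qed.

(** The classical formula for [f] is available beyond lag [m] only, when the two blocks are
    disjoint; the earlier terms are absorbed in [K]. For [c = 0] the limit of [h] may be unknown,
    but the tail vanishes. *)
Lemma complex_sum_bound (f : nat -> C) (h : nat -> R) (c : C) m e : 0 < e ->
  (forall g, f (m + g)%N = c * (h g)%:C%C) ->
  (c != 0 -> (fun q => (q.+1%:R)^-1 * \sum_(g < q.+1) h g) @ \oo --> 0) ->
  exists K, forall n, nc (\sum_(d < n) f d) <= e * n%:R + K.
Proof.
move=> e0 fE hc.
have [K hK] : exists K, forall n, nc (\sum_(g < n) c * (h g)%:C%C) <= e * n%:R + K.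
  have [c0|c0] := eqVneq c 0.
    exists 0 => n; rewrite big1 ?nc0 => [|g _]; last by rewrite c0 mul0r.
    by rewrite addr0 mulr_ge0// ltW.
  have nc0' : 0 < nc c.
    by rewrite lt_def nc_ge0 andbT; apply: contra_neq c0; exact: nc_eq0.
  have d0 : 0 < e / nc c by rewrite divr_gt0.
  have [K hK] := cesaro_sum_bound d0 (hc c0); exists (nc c * K) => n.
  rewrite -mulr_sumr ncM -rmorph_sum nc_real.
  apply: le_trans (ler_wpM2l (nc_ge0 c) (hK n)) _.
  by apply: le_of_eq; field; rewrite gt_eqF.
exists (\sum_(d < m) nc (f d) + K) => n.
have S0 k l : 0 <= \sum_(k <= d < l) nc (f d) by apply: sumr_ge0 => *; exact: nc_ge0.
have K0 : 0 <= K by have := hK 0%N; rewrite big_ord0 nc0 mulr0 add0r.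
have en : 0 <= e * n%:R by rewrite mulr_ge0// ltW.
rewrite -(big_mkord xpredT f) -(big_mkord xpredT (fun d => nc (f d))).
have [nm|mn] := leqP n m.
  apply: le_trans (nc_sum _ _ _) _.
  have -> : \sum_(0 <= d < m) nc (f d) = \sum_(0 <= d < n) nc (f d) + \sum_(n <= d < m) nc (f d).
    by rewrite -big_cat_nat.
  by have := S0 n m; lra.
rewrite (big_cat_nat _ (n := m))//=; last exact: ltnW.
apply: le_trans (ncD _ _) _.
have h1 := nc_sum (index_iota 0 m) xpredT f.
have h2 : nc (\sum_(m <= d < n) f d) <= e * n%:R + K.
  have -> : \sum_(m <= d < n) f d = \sum_(g < n - m) c * (h g)%:C%C.
    rewrite -{1}[m]add0n big_addn big_mkord; apply: eq_bigr => g _.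
    by rewrite addnC fE.
  apply: le_trans (hK _) _; rewrite lerD2r ler_pM2l// ler_nat; exact: leq_subr.
lra.
Qed.

Lemma tensor_munit_adj k m (s t : conf) :
  mat_adj (tensor k m (fun j => @munit R I (s j) (t j))) = tensor k m (fun j => munit (t j) (s j)).
Proof.
rewrite -!embed_munit; apply/funext => a; apply/funext => b; rewrite mat_adjE.
have [h|h] := pselect (agree_off (sites k m) a b).
  rewrite !embedE//; last by move=> j jk; rewrite h.
  by rewrite /munit rmorphM !rmorph_nat mulrC.
rewrite !embed_eq0 ?conjc0// => h'; apply: h => j jk; by rewrite h'.
Qed.

Lemma opb_tensor_munit k m (s t : conf) : opb (tensor k m (fun j => @munit R I (s j) (t j))) 1.
Proof. by rewrite -embed_munit; apply: opb_embed; exact: opb_munit. Qed.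

Lemma quasilocal_tensor_munit k m (s t : conf) :
  quasilocal (tensor k m (fun j => @munit R I (s j) (t j))).
Proof. exact: quasilocal_local (localm_tensor k m _) (opb_tensor_munit k m s t). Qed.

Section Chain.
Variables (P : I -> I -> R) (p : I -> R) (w : cmat -> C).
Hypotheses (hP : stochastic P) (hp : stationary P p) (hw : entangled_markov_chain P p w).
Hypothesis conn : forall i j, 0 < p i -> 0 < p j -> reach P i j.

Let sw : state w. Proof. exact: chain_state hw. Qed.
Let iw : invariant_state w. Proof. by case: hw. Qed.

Lemma delta_one (v : cmat -> C) n X : state v -> quasilocal X -> v (iter n Defs.shift X) = v X ->
  delta_state v n one X = 0 /\ delta_state v n X one = 0.
Proof.
move=> sv qX e; rewrite /delta_state iter_shift_id mat_1mul mat_mul1 (state1 sv) e.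
by split; ring.
Qed.

Definition centered A : cmat := mat_add (mat_scale (- w A) one) A.

Lemma quasilocal_centered A : quasilocal A -> quasilocal (centered A).
Proof. by move=> qA; exact: quasilocal_lin (@quasilocal_id R I) qA. Qed.

Lemma centered_correlation A d : quasilocal A ->
  w (mat_mul (mat_adj (centered A)) (iter d Defs.shift (centered A))) =
  delta_state w d (mat_adj A) A.
Proof.
move=> qA; have q1 := @quasilocal_id R I; have qa := quasilocal_adj qA.
have qc := quasilocal_centered qA.
have wc : w (centered A) = 0 by rewrite /centered (state_lin _ sw q1 qA) (state1 sw); ring.
have -> : w (mat_mul (mat_adj (centered A)) (iter d Defs.shift (centered A))) =
    delta_state w d (mat_adj (centered A)) (centered A) by rewrite /delta_state wc mulr0 subr0.
have -> : mat_adj (centered A) = mat_add (mat_scale ((- w A)^*)%C one) (mat_adj A).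
  by rewrite /centered mat_adj_add mat_adj_scale mat_adj1.
rewrite (delta_linl sw d _ q1 qa qc) (delta_one sw qc (invariant_iter iw d qc)).1 mulr0 add0r.
rewrite /centered (delta_linr sw d _ q1 qA qa).
by rewrite (delta_one sw qa (invariant_iter iw d qa)).2 mulr0 add0r.
Qed.

Lemma centered_unit_bound k m (s t : conf) e : (0 < m)%N -> 0 < e ->
  let u := centered (tensor k m (fun j => munit (s j) (t j))) in
  exists K, forall n, nc (\sum_(d < n) w (mat_mul (mat_adj u) (iter d.+1 Defs.shift u))) <=
    e * n%:R + K.
Proof.
move=> m0 e0 u.
have qA := quasilocal_tensor_munit k m s t.
(* The first unit is the adjoint, which exchanges [s] and [t]. *)
have [C0 [mu [mm [b [hmu b01 supp [wA' wA] two]]]]] := chain_units hP hp hw k t s s t m0.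
apply: (@complex_sum_bound (fun d => w (mat_mul (mat_adj u) (iter d.+1 Defs.shift u)))
  (fun g => mean mu (iter g (Pop P) b) - mean p b * mm) C0 m e e0) => [g|c0].
  rewrite (centered_correlation _ qA) /delta_state tensor_munit_adj wA' wA -addnS two.
  by rewrite rmorphB rmorphM /=; ring.
have bd n i : `|cesaro_mean P b n i| <= 1 := bounded01 (cesaro_mean01 hP n b01) i.
have lim : (fun n => mean mu (cesaro_mean P b n)) @ \oo --> mean p b * mm.
  apply: (mean_dominated_cvg hmu bd) => i mui.
  exact: (cesaro_mean_cvg hP hp conn b01 (supp c0 i mui)).
rewrite (_ : (fun q => _) = fun q => mean mu (cesaro_mean P b q) - mean p b * mm).
  exact/subr_cvg0.
apply/funext => q; have bk (g : 'I_q.+1) i : `|iter g (Pop P) b i| <= 1.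
  exact: bounded01 (iter_Pop01 hP g b01) i.
rewrite /cesaro_mean (meanZ _ hmu (M := q.+1%:R)) => [|i]; last first.
  apply: le_trans (ler_norm_sum _ _ _) _.
  by rewrite -[X in _ <= X%:R]card_ord -sumr_const; apply: ler_sum => g _.
rewrite (mean_sum _ hmu (M := 1) bk) sumrB sumr_const card_ord mulrBr; congr (_ - _).
by rewrite -[(mean p b * mm) *+ _]mulr_natl mulKf ?pnatr_eq0.
Qed.

(* A state dominated by a multiple of [w] sees the averages of [A - w A] in mean square, hence takes the value [w A] at [A]. *)
Lemma dominated_unit (v : cmat -> C) K0 k m (s t : conf) : invariant_state v -> 0 < K0 ->
  (forall X, quasilocal X -> sqnorm v X <= K0 * sqnorm w X) -> (0 < m)%N ->
  v (tensor k m (fun j => munit (s j) (t j))) = w (tensor k m (fun j => munit (s j) (t j))).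
Proof.
move=> iv K00 dom m0; have sv : state v by case: iv.
set A := tensor k m _; have qA : quasilocal A := quasilocal_tensor_munit k m s t.
have qu := quasilocal_centered qA; set u := centered A in qu.
have vu : v u = v A - w A.
  by rewrite /u /centered (state_lin _ sv (@quasilocal_id R I) qA) (state1 sv); ring.
suff h : forall e, 0 < e -> nc (v u) ^+ 2 <= e.
  apply/eqP; rewrite -subr_eq0 -vu; apply/eqP/nc_eq0/eqP; rewrite -(@sqrf_eq0 R).
  rewrite eq_le sqr_ge0 andbT; apply/ler_addgt0Pr => e e0; rewrite add0r; exact: h.
move=> e e0; have d0 : 0 < e / 2 / K0 by rewrite !divr_gt0.
have [K hK] := birkhoff_sqnorm_le iw qu (ltW d0) (centered_unit_bound k s t m0 d0).
(* Large enough for the linear term [K0 * K * n] to fall below [e / 2 * n ^ 2]; the slope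
   [e / 2 / K0] accounts for the other half. *)
pose n := (Num.bound (2 * K0 * `|K| / e)).+1.
have n0 : 0 < n%:R :> R by rewrite ltr0n.
have hn : 2 * K0 * `|K| / e < n%:R.
  apply: lt_le_trans (_ : (Num.bound (2 * K0 * `|K| / e))%:R <= _); last by rewrite ler_nat.
  by apply: archi_boundP; rewrite divr_ge0 ?(ltW e0)// !mulr_ge0 ?(ltW K00).
have h1 := state_cauchy_schwarz sv (quasilocal_birkhoff n qu).
rewrite (birkhoff_state iv n qu) ncM exprMn in h1.
have h2 : nc (n%:R : C) = n%:R.
  by have -> : (n%:R : C) = (n%:R : R)%:C%C by [rewrite rmorph_nat]; rewrite nc_real ger0_norm.
rewrite h2 in h1.
have h3 := le_trans h1 (dom _ (quasilocal_birkhoff n qu)).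
have h4 := le_trans h3 (ler_wpM2l (ltW K00) (hK n)).
have h5 : K0 * K <= n%:R * e / 2.
  apply: (@le_trans _ _ (K0 * `|K|)); first by rewrite ler_pM2l// ler_norm.
  by move: hn; rewrite ltr_pdivrMr// => /ltW ?; lra.
have n2 : 0 < n%:R ^+ 2 :> R by rewrite exprn_gt0.
rewrite -(ler_pM2l n2); apply: le_trans h4 _.
have -> : K0 * (e / 2 / K0 * n%:R ^+ 2 + K * n%:R) = e / 2 * n%:R ^+ 2 + K0 * K * n%:R.
  by field; rewrite gt_eqF.
have h6 : K0 * K * n%:R <= n%:R * e / 2 * n%:R by rewrite ler_pM2r.
by apply: le_trans (lerD (lexx _) h6) _; apply: le_of_eq; field.
Qed.

Lemma munit_as_tensor k m (x y : sites k m -> I) : exists s t : conf,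
  embed (@munit R _ x y) = tensor k m (fun j => munit (s j) (t j)).
Proof.
case: (pselect (exists z : conf, True)) => [[z _]|no].
  by exists (glue z x), (glue z y); rewrite -embed_munit !restr_glue.
(* An empty [conf] would mean an empty [I], against the total mass 1 of [p]. *)
by exfalso; apply: no; have [i _] : exists i : I, True;
  [have [_ p1 _] := hp; apply: contrapT => no; move: p1; rewrite esum1 => [/eqP|i _];
    [rewrite eqe eq_sym oner_eq0|exfalso; apply: no; exists i]|exists (fun=> i)].
Qed.

(** [v] is not known to be locally normal. The finite cut is obtained from the normality of [w], and
    the domination makes the discarded part small for [v] too; on the cut operators the two states
    agree by [dominated_unit]. *)
Lemma dominated_eq (v : cmat -> C) K0 : invariant_state v -> 0 < K0 ->
  (forall X, quasilocal X -> sqnorm v X <= K0 * sqnorm w X) ->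
  forall X, quasilocal X -> v X = w X.
Proof.
move=> iv K00 dom X qX; have sv : state v by case: iv.
have nw : locally_normal w by case: hw.
suff h e : 0 < e -> nc (v X - w X) <= e.
  apply/eqP; rewrite -subr_eq0; apply/eqP/nc_eq0/eqP; rewrite eq_le nc_ge0 andbT.
  by apply/ler_addgt0Pr => e e0; rewrite add0r; exact: h.
move=> e0; have e4 : 0 < e / 8 by lra.
have /quasilocalP /(_ _ e4)[J [A [M0 [hA hM0 hXA]]]] := qX.
have qA := quasilocal_local hA hM0.
have qXA : quasilocal (mat_sub X A) by exact: quasilocal_sub qX qA.
pose M := M0 + 1.
have M00 := opb_ge0 hM0.
have Mp : 0 < M by rewrite /M; lra.
have hM : opb A M by apply: opb_le hM0; rewrite /M; lra.
have [n0 /(_ n0 (leqnn _)) Jn] := fset_in_sites J.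
set k : int := (- n0%:Z)%R in Jn; set m := (n0 + n0.+1)%N in Jn.
have hA' : localm (sites k m) A := localm_mono Jn hA.
pose d := e / 4 / (8 * M * (1 + K0)).
have M8 : 0 < 8 * M * (1 + K0) by rewrite !mulr_gt0// ltr_wpDr// ltW.
have d0 : 0 < d by rewrite !divr_gt0.
have d20 : 0 < d ^+ 2 by rewrite exprn_gt0.
have [F hF] := locally_normal_approx (sites k m) sw nw d20.
pose b (s : conf) := restr (sites k m) s \in F.
have qb : quasilocal (prj (R := R) b) := quasilocal_prj_restr (fun x => x \in F).
have qb' : quasilocal (prj (R := R) (fun s => ~~ b s)) := quasilocal_prj_restr (fun x => x \notin F).
have hw' := state_cut_close sw qb qb' qA Mp hM (ltW d0) hF.
have dK : 0 <= (1 + K0) * d by rewrite mulr_ge0 ?(ltW d0)// addr_ge0// ltW.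
(* [1 + K0] stands in for the square root of [K0], since its square exceeds [K0]. *)
have hFv : sqnorm v (prj (fun s => ~~ b s)) <= ((1 + K0) * d) ^+ 2.
  apply: le_trans (dom _ qb') _; apply: (@le_trans _ _ (K0 * d ^+ 2)).
    by rewrite ler_pM2l.
  rewrite [((1 + K0) * d) ^+ 2]exprMn ler_pM2r//.
  have -> : (1 + K0) ^+ 2 = K0 + (1 + K0 + K0 ^+ 2) by ring.
  by rewrite lerDl !addr_ge0 ?sqr_ge0// ltW.
have hv' := state_cut_close sv qb qb' qA Mp hM dK hFv.
have eq_cut : v (cut b A) = w (cut b A).
  pose Q Y := quasilocal Y /\ v Y = w Y.
  suff [] : Q (cut b A) by [].
  have locA : local_algebra (sites k m) A.
    by apply/local_algebraP; split=> //; apply/boundedP; exists M.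
  apply: (@cut_span R I Q (sites k m) F A locA).
  - by split; [exact: quasilocal0|rewrite (state0 iv) (state0 iw)].
  - move=> c Y Z [qY eY] [qZ eZ]; split; first exact: quasilocal_lin.
    by rewrite (state_lin c sv qY qZ) (state_lin c sw qY qZ) eY eZ.
  - move=> x y; have [s [t ->]] := munit_as_tensor x y.
    split; first exact: quasilocal_tensor_munit.
    by apply: dominated_unit iv K00 dom _; rewrite /m addnS.
have E : v X - w X = v (mat_sub X A) - w (mat_sub X A) +
    ((v A - v (cut b A)) - (w A - w (cut b A))).
  by rewrite eq_cut (state_sub sv qX qA) (state_sub sw qX qA); ring.
have h1 := state_norm_le sv qXA e4 hXA; have h2 := state_norm_le sw qXA e4 hXA.
rewrite E; apply: le_trans (ncD _ _) _.
have h3 := le_trans (ncB (v (mat_sub X A)) (w (mat_sub X A))) (lerD h1 h2).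
have h4 := le_trans (ncB (v A - v (cut b A)) (w A - w (cut b A))) (lerD hv' hw').
apply: le_trans (lerD h3 h4) _.
have h5 : 8 * M * (1 + K0) * d = e / 4 by rewrite /d; field; rewrite !gt_eqF// ltr_wpDr// ltW.
have h6 : 4 * M * d <= 4 * M * ((1 + K0) * d).
  rewrite ler_pM2l ?mulr_gt0// -[X in X <= _]mul1r ler_pM2r// lerDl; exact: ltW.
lra.
Qed.

(** Each component of a convex decomposition is dominated by [w] up to the inverse of its
    coefficient. *)
Lemma ergodic_of_connected : ergodic w.
Proof.
split=> // w1 w2 t iw1 iw2 /andP[t0 t1] dec.
have s1 : state w1 by case: iw1.
have s2 : state w2 by case: iw2.
have t1' : 0 < 1 - t by lra.
have sq X : quasilocal X -> sqnorm w X = t * sqnorm w1 X + (1 - t) * sqnorm w2 X.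
  move=> qX; have qXX := quasilocal_mul (quasilocal_adj qX) qX.
  rewrite {1}/sqnorm (dec _ qXX) (sqnormE s1 qX) (sqnormE s2 qX).
  by rewrite -!rmorphM -rmorphD.
move=> X qX; split.
- apply: (@dominated_eq w1 t^-1) => // [|Y qY]; first by rewrite invr_gt0.
  rewrite (sq Y qY) ler_pdivlMl// lerDl mulr_ge0 ?(ltW t1')//; exact: sqnorm_ge0.
- apply: (@dominated_eq w2 (1 - t)^-1) => // [|Y qY]; first by rewrite invr_gt0.
  rewrite (sq Y qY) ler_pdivlMl// lerDr mulr_ge0 ?(ltW t0)//; exact: sqnorm_ge0.
Qed.

End Chain.
End ErgodicSufficiency.

(** * Strong clustering when the support is connected and aperiodic *)

Section Clustering.
#[local] Opaque quasilocal opb usum mat_mul.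
Context {R : realType} {I : choiceType}.
Local Notation C := R[i].
Local Notation nc := ComplexField.Normc.normc.
Local Notation conf := (int -> I).
Local Notation cmat := (@mat R conf conf).
Local Notation one := (@mat_id R conf).
Implicit Types (X Y Z A B T : cmat) (e M N : R) (b : conf -> bool).

Lemma complex_cvgP (u : nat -> C) (l : C) :
  ((fun n => u n : C^o) @ \oo --> (l : C^o)) <->
  forall e : R, 0 < e -> exists m, forall n, (m <= n)%N -> nc (u n - l) < e.
Proof.
split=> [/cvgrPdist_lt h e e0|h].
  have [|m _ hm] := h (e%:C)%C; first by rewrite ltcR.
  by exists m => n mn; have := hm n mn; rewrite normcEnc ltcR -ncN opprB.
apply/cvgrPdist_lt => -[e e']; rewrite ltcE /= => /andP[/eqP -> e0].
have [m hm] := h e e0; exists m => // n mn.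
by rewrite normcEnc ltcR -ncN opprB; exact: hm.
Qed.

Lemma sites_far k m n j : (m <= n)%N -> j \in sites k m ->
  (j + n%:Z)%R \notin sites k m /\ (j - n%:Z)%R \notin sites k m.
Proof.
move=> mn /sitesP[i hi ->]; split; apply/sitesP => -[i' hi'].
  by rewrite -addrA => /addrI; rewrite -PoszD => -[e]; lia.
by move=> e; lia.
Qed.

Lemma cut_mull b A T M N : opb A M -> opb T N -> (forall s t, T s t != 0 -> b s = b t) ->
  mat_mul (cut b A) T = cut b (mat_mul A T).
Proof.
move=> hA hT h; apply/funext => s; apply/funext => u; rewrite /cut.
apply: hsum_usum.
apply: hsum_eq (hsumZ (c := (b s)%:R * (b u)%:R) (mat_mul_hsum (s := s) (u := u) hA hT)) => [t|].
  have [->|/h ->] := eqVneq (T t u) 0; first by rewrite !mulr0.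
  by ring.
by ring.
Qed.

Lemma cut_mulr b A T M N : opb A M -> opb T N -> (forall s t, A s t != 0 -> b s = b t) ->
  mat_mul A (cut b T) = cut b (mat_mul A T).
Proof.
move=> hA hT h; apply/funext => s; apply/funext => u; rewrite /cut.
apply: hsum_usum.
apply: hsum_eq (hsumZ (c := (b s)%:R * (b u)%:R) (mat_mul_hsum (s := s) (u := u) hA hT)) => [t|].
  have [->|/h ->] := eqVneq (A s t) 0; first by rewrite !mul0r !mulr0.
  by ring.
by ring.
Qed.

Lemma iter_shift_cut n b A : iter n Defs.shift (cut b A) =
  cut (fun s => b (translate n%:Z s)) (iter n Defs.shift A).
Proof. by apply/funext => s; apply/funext => t; rewrite /cut !iter_shiftE. Qed.

Lemma iter_shift_prj n b : iter n Defs.shift (prj b) =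
  prj (R := R) (fun s => b (translate n%:Z s)).
Proof.
apply/funext => s; apply/funext => t; rewrite iter_shiftE /prj /diagm.
by rewrite (inj_eq (@translate_inj I n%:Z)).
Qed.

Section Sufficiency.
Variables (P : I -> I -> R) (p : I -> R) (w : cmat -> C).
Hypotheses (hP : stochastic P) (hp : stationary P p) (hw : entangled_markov_chain P p w).
Hypothesis conn : forall i j, 0 < p i -> 0 < p j -> reach P i j.
Hypothesis aper : forall i, 0 < p i -> exists n0 : nat, forall n, (n0 <= n)%N -> steps P n i i.

Let sw : state w. Proof. exact: chain_state hw. Qed.
Let iw : invariant_state w. Proof. by case: hw. Qed.

Definition clusters A B : Prop := forall e : R, 0 < e ->
  exists m, forall n, (m <= n)%N -> nc (delta_state w n A B) < e.

Lemma clusters_units k m (s t u v : conf) : (0 < m)%N ->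
  clusters (tensor k m (fun j => munit (s j) (t j))) (tensor k m (fun j => munit (u j) (v j))).
Proof.
move=> m0 e e0.
have [C0 [mu [mm [b [hmu b01 supp [wA wB] two]]]]] := chain_units hP hp hw k s t u v m0.
have E g : delta_state w (m + g.+1) (tensor k m (fun j => munit (s j) (t j)))
    (tensor k m (fun j => munit (u j) (v j))) =
    C0 * (mean mu (iter g (Pop P) b) - mean p b * mm)%:C%C.
  by rewrite /delta_state wA wB two rmorphB rmorphM /=; ring.
have [c0|c0] := eqVneq C0 0.
  exists m.+1 => n mn; have -> : n = (m + (n - m.+1).+1)%N by lia.
  by rewrite E c0 mul0r nc0.
have nc0' : 0 < nc C0 by rewrite lt_def nc_ge0 andbT; apply: contra_neq c0; exact: nc_eq0.
have bd n i : `|iter n (Pop P) b i| <= 1 := bounded01 (iter_Pop01 hP n b01) i.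
have lim : (fun n => mean mu (iter n (Pop P) b)) @ \oo --> mean p b * mm.
  apply: (mean_dominated_cvg hmu bd) => i mui; have pi := supp c0 i mui.
  exact: (iter_Pop_cvg hP hp conn b01 pi (aper pi)).
have d0 : 0 < e / nc C0 by rewrite divr_gt0.
move/cvgrPdist_lt: lim => /(_ _ d0)[g0 _ hg].
exists (m + g0.+1)%N => n mn; have -> : n = (m + (n - m.+1).+1)%N by lia.
rewrite E ncM nc_real mulrC -ltr_pdivlMr// distrC; apply: hg => /=; lia.
Qed.

Lemma clusters_linl c A B D : quasilocal A -> quasilocal B -> quasilocal D ->
  clusters A D -> clusters B D -> clusters (mat_add (mat_scale c A) B) D.
Proof.
move=> qA qB qD hA hB e e0; have c0 : 0 < nc c + 1 by rewrite ltr_wpDl ?nc_ge0.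
have d0 : 0 < e / 2 / (nc c + 1) by rewrite !divr_gt0.
have e2 : 0 < e / 2 by lra.
have [m hm] := hA _ d0; have [m' hm'] := hB _ e2.
exists (maxn m m') => n; rewrite geq_max => /andP[/hm h1 /hm' h2].
rewrite (delta_linl sw n c qA qB qD); apply: le_lt_trans (ncD _ _) _.
rewrite ncM [ltRHS]splitr; apply: ler_ltD => //.
apply: le_trans (ler_wpM2l (nc_ge0 c) (ltW h1)) _.
rewrite mulrA ler_pdivrMr// mulrC ler_pM2l//; lra.
Qed.

Lemma clusters_linr c A B D : quasilocal A -> quasilocal B -> quasilocal D ->
  clusters D A -> clusters D B -> clusters D (mat_add (mat_scale c A) B).
Proof.
move=> qA qB qD hA hB e e0; have c0 : 0 < nc c + 1 by rewrite ltr_wpDl ?nc_ge0.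
have d0 : 0 < e / 2 / (nc c + 1) by rewrite !divr_gt0.
have e2 : 0 < e / 2 by lra.
have [m hm] := hA _ d0; have [m' hm'] := hB _ e2.
exists (maxn m m') => n; rewrite geq_max => /andP[/hm h1 /hm' h2].
rewrite (delta_linr sw n c qA qB qD); apply: le_lt_trans (ncD _ _) _.
rewrite ncM [ltRHS]splitr; apply: ler_ltD => //.
apply: le_trans (ler_wpM2l (nc_ge0 c) (ltW h1)) _.
rewrite mulrA ler_pdivrMr// mulrC ler_pM2l//; lra.
Qed.

Lemma clusters0 A : quasilocal A ->
  clusters A (fun _ _ => 0) /\ clusters (fun _ _ => 0) A.
Proof.
move=> qA; have [M [_ hM]] := quasilocal_opb qA.
have Z : iter _ Defs.shift ((fun _ _ => 0) : cmat) = mat_scale 0 one.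
  by move=> n; rewrite mat_scale0; apply/funext => s; apply/funext => t; rewrite iter_shiftE.
have o1 := @opb_id R conf; have q1 := @quasilocal_id R I.
split=> e e0; exists 0%N => n _; rewrite /delta_state (state0 iw).
  rewrite Z (mat_mulZr 0 o1 hM) mat_scale0 (state0 iw) mulr0 subr0 nc0//.
have hn := opb_iter_shift n hM.
rewrite -(mat_scale0 one) (mat_mulZl 0 o1 hn) mat_scale0 (state0 iw) mul0r subr0 nc0//.
Qed.

Lemma clusters_cut k m (F : {fset (sites k m -> I)}) A B : (0 < m)%N ->
  local_algebra (sites k m) A -> local_algebra (sites k m) B ->
  clusters (cut (fun s => restr (sites k m) s \in F) A) (cut (fun s => restr (sites k m) s \in F) B).
Proof.
move=> m0 hA hB.
pose Q2 A' := quasilocal A' /\ clusters A' (cut (fun s => restr (sites k m) s \in F) B).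
have qF X : local_algebra (sites k m) X ->
    quasilocal (cut (fun s => restr (sites k m) s \in F) X).
  move=> /local_algebraP[lX /boundedP[M hM]].
  have qX := quasilocal_local lX hM.
  exact: (quasilocal_cut (quasilocal_prj_restr (fun x => x \in F)) qX).
have qB := qF B hB.
suff [] : Q2 (cut (fun s => restr (sites k m) s \in F) A) by [].
apply: (@cut_span R I Q2 (sites k m) F A hA).
- by split; [exact: quasilocal0|exact: (clusters0 qB).2].
- by move=> c X Y [qX cX] [qY cY]; split; [exact: quasilocal_lin|exact: clusters_linl].
move=> x y; have [s [t ->]] := munit_as_tensor hp x y.
split; first exact: quasilocal_tensor_munit.
have qU : quasilocal (tensor k m (fun j => @munit R I (s j) (t j))).
  exact: quasilocal_tensor_munit.
pose Q1 B' := quasilocal B' /\ clusters (tensor k m (fun j => munit (s j) (t j))) B'.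
suff [] : Q1 (cut (fun s => restr (sites k m) s \in F) B) by [].
apply: (@cut_span R I Q1 (sites k m) F B hB).
- by split; [exact: quasilocal0|exact: (clusters0 qU).1].
- by move=> c X Y [qX cX] [qY cY]; split; [exact: quasilocal_lin|exact: clusters_linr].
move=> x' y'; have [u [v ->]] := munit_as_tensor hp x' y'.
by split; [exact: quasilocal_tensor_munit|exact: clusters_units].
Qed.

(** [A] is cut by [b] and the translate of [B] by the translate [bn]. Invariance gives [bn] the same
    discarded mass as [b], so the errors are uniform in [n]. *)
Lemma clusters_local k m A B : (0 < m)%N ->
  local_algebra (sites k m) A -> local_algebra (sites k m) B -> clusters A B.
Proof.
move=> m0 lA lB e e0.
have [hA /boundedP[MA hMA]] := (local_algebraP _ _).1 lA.
have [hB /boundedP[MB hMB]] := (local_algebraP _ _).1 lB.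
have MA0 := opb_ge0 hMA; have MB0 := opb_ge0 hMB.
pose M := MA + MB + 1; have M0 : 0 < M by rewrite /M; lra.
have oA : opb A M by apply: opb_le hMA; rewrite /M; lra.
have oB : opb B M by apply: opb_le hMB; rewrite /M; lra.
have MM : 0 < M * M by exact: mulr_gt0.
(* 24 is 4 + 4 for the two cuts inside the correlation plus 16 for the cuts in [w A * w B]. *)
pose d := e / 2 / (24 * (M * M)).
have d0 : 0 < d by rewrite !divr_gt0// mulr_gt0.
have dE : 24 * (M * M) * d = e / 2 by rewrite /d; field; rewrite gt_eqF.
have d20 : 0 < d ^+ 2 by rewrite exprn_gt0.
have nw : locally_normal w by case: hw.
have [F hF] := locally_normal_approx (sites k m) sw nw d20.
pose b (s : conf) := restr (sites k m) s \in F.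
have qb : quasilocal (prj (R := R) b) := quasilocal_prj_restr (fun x => x \in F).
have qb' : quasilocal (prj (R := R) (fun s => ~~ b s)) := quasilocal_prj_restr (fun x => x \notin F).
have e2 : 0 < e / 2 by lra.
have [m1 hm1] := clusters_cut F m0 lA lB e2.
exists (maxn m m1) => n; rewrite geq_max => /andP[mn m1n].
have {hm1} hcut := hm1 n m1n; rewrite -/b in hcut.
have qA := quasilocal_local hA hMA; have qB := quasilocal_local hB hMB.
pose T := iter n Defs.shift B; have oT : opb T M := opb_iter_shift n oB.
have qT : quasilocal T := quasilocal_iter_shift n qB.
pose bn (s : conf) := b (translate n%:Z s).
have far j (hj : j \in sites k m) := sites_far mn hj.
(* [T] acts on sites disjoint from those read by [b], and [A] on sites disjoint from those read by
   [bn]; cutting one factor therefore cuts the whole product. *)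
have bT s t : T s t != 0 -> b s = b t.
  rewrite /T iter_shiftE => /(proj1 hB) h; rewrite /b; congr (_ \in F).
  apply/funext => j; have [_ h2] := far _ (fsvalP j).
  by have := h _ h2; rewrite /translate subrK.
have bA s t : cut b A s t != 0 -> bn s = bn t.
  move=> h; have {}h : A s t != 0 by apply: contra_neq h; rewrite /cut => ->; rewrite mulr0 mul0r.
  have {}h := proj1 hA _ _ h; rewrite /bn /b; congr (_ \in F).
  by apply/funext => j; have [h2 _] := far _ (fsvalP j); exact: h.
have qbn : quasilocal (prj (R := R) bn).
  by rewrite -(iter_shift_prj n b); exact: quasilocal_iter_shift.
have qbn' : quasilocal (prj (R := R) (fun s => ~~ bn s)).
  by rewrite -(iter_shift_prj n (fun s => ~~ b s)); exact: quasilocal_iter_shift.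
have hFn : sqnorm w (prj (fun s => ~~ bn s)) <= d ^+ 2.
  rewrite sqnorm_prj -(iter_shift_prj n (fun s => ~~ b s)) (invariant_iter iw n qb').
  by rewrite -sqnorm_prj.
have oA' : opb (cut b A) M := opb_cut b oA.
have qA' : quasilocal (cut b A) := quasilocal_cut qb qA.
have qB' : quasilocal (cut b B) := quasilocal_cut qb qB.
have h1 : nc (w (mat_mul A T) - w (mat_mul (cut b A) T)) <= 4 * (M * M) * d.
  rewrite (cut_mull oA oT bT).
  have h := state_cut_close sw qb qb' (quasilocal_mul qA qT) MM (opb_mul oA oT) (ltW d0) hF.
  exact: h.
have h2 : nc (w (mat_mul (cut b A) T) - w (mat_mul (cut b A) (cut bn T))) <= 4 * (M * M) * d.
  rewrite (cut_mulr oA' oT bA).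
  have h := state_cut_close sw qbn qbn' (quasilocal_mul qA' qT) MM (opb_mul oA' oT) (ltW d0) hFn.
  exact: h.
have h3 := state_cut_close sw qb qb' qA M0 oA (ltW d0) hF.
have h4 := state_cut_close sw qb qb' qB M0 oB (ltW d0) hF.
have h5 := state_norm_le sw qA M0 oA.
have h6 := state_norm_le sw qB' M0 (opb_cut b oB).
have E : delta_state w n A B = delta_state w n (cut b A) (cut b B) +
    ((w (mat_mul A T) - w (mat_mul (cut b A) T)) +
     (w (mat_mul (cut b A) T) - w (mat_mul (cut b A) (cut bn T)))) -
    (w A * (w B - w (cut b B)) + (w A - w (cut b A)) * w (cut b B)).
  by rewrite /delta_state iter_shift_cut -/T -/bn; ring.
rewrite E; apply: le_lt_trans (ncB _ _) _.
have k1 := le_trans (ncD (w (mat_mul A T) - w (mat_mul (cut b A) T)) 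
  (w (mat_mul (cut b A) T) - w (mat_mul (cut b A) (cut bn T)))) (lerD h1 h2).
have k2 : nc (w A * (w B - w (cut b B)) + (w A - w (cut b A)) * w (cut b B)) <= 16 * (M * M) * d.
  apply: le_trans (ncD _ _) _; rewrite !ncM.
  have l1 : nc (w A) * nc (w B - w (cut b B)) <= (2 * M) * (4 * M * d) by apply: ler_pM; rewrite ?nc_ge0.
  have l2 : nc (w A - w (cut b A)) * nc (w (cut b B)) <= (4 * M * d) * (2 * M) by apply: ler_pM; rewrite ?nc_ge0.
  by apply: le_trans (lerD l1 l2) _; apply: le_of_eq; ring.
have k3 := ncD (delta_state w n (cut b A) (cut b B))
  ((w (mat_mul A T) - w (mat_mul (cut b A) T)) +
     (w (mat_mul (cut b A) T) - w (mat_mul (cut b A) (cut bn T)))).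
lra.
Qed.

Lemma clusters_quasilocal X Y : quasilocal X -> quasilocal Y -> clusters X Y.
Proof.
move=> qX qY e e0.
have [MX [MX0 hMX]] := quasilocal_opb qX; have [MY [MY0 hMY]] := quasilocal_opb qY.
pose M := MX + MY + 1; have M0 : 0 < M by rewrite /M; lra.
(* Replacing one factor costs at most [6 * (M * d)] by [delta_norm_le], and there are two
   replacements. *)
pose d := Num.min 1 (e / (24 * M)).
have M24 : 0 < 24 * M by rewrite mulr_gt0.
have d0 : 0 < d by rewrite lt_min ltr01 divr_gt0.
have d1 : d <= 1 by rewrite ge_min lexx.
have dM : 12 * (M * d) <= e / 2.
  have : d <= e / (24 * M) by rewrite ge_min lexx orbT.
  by rewrite ler_pdivlMr// => ?; lra.
have [J1 [A [MA [lA hMA hXA]]]] := (quasilocalP X).1 qX d d0.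
have [J2 [B [MB [lB hMB hYB]]]] := (quasilocalP Y).1 qY d d0.
have [n1 hn1] := fset_in_sites J1; have [n2 hn2] := fset_in_sites J2.
pose n0 := maxn n1 n2.
have lA' := localm_mono (hn1 n0 (leq_maxl _ _)) lA.
have lB' := localm_mono (hn2 n0 (leq_maxr _ _)) lB.
have qA := quasilocal_local lA hMA; have qB := quasilocal_local lB hMB.
have oA : opb A M.
  apply: (opb_le (M := MX + d)); first by rewrite /M; lra.
  rewrite (_ : A = mat_sub X (mat_sub X A)); first exact: opb_sub.
  by apply/funext => s; apply/funext => t; rewrite /mat_sub; ring.
have oY : opb Y M by apply: opb_le hMY; rewrite /M; lra.
have e2 : 0 < e / 2 by lra.
have lAA : local_algebra (sites (- n0%:Z)%R (n0 + n0.+1)) A.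
  by apply/local_algebraP; split=> //; apply/boundedP; exists MA.
have lBB : local_algebra (sites (- n0%:Z)%R (n0 + n0.+1)) B.
  by apply/local_algebraP; split=> //; apply/boundedP; exists MB.
have pos : (0 < n0 + n0.+1)%N by rewrite addnS.
have [m hm] := clusters_local pos lAA lBB e2.
exists m => n /hm h.
have qXA := quasilocal_sub qX qA; have qYB := quasilocal_sub qY qB.
have E : delta_state w n X Y = delta_state w n (mat_sub X A) Y +
    (delta_state w n A (mat_sub Y B) + delta_state w n A B).
  have e1 := delta_linl sw n 1 qXA qA qY; have e3 := delta_linr sw n 1 qYB qB qA.
  rewrite mat_scale1 mat_subK mul1r in e1; rewrite mat_scale1 mat_subK mul1r in e3.
  by rewrite e1 e3.
have h1 := delta_norm_le sw n qXA qY d0 M0 hXA oY.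
have h2 := delta_norm_le sw n qA qYB M0 d0 oA hYB.
rewrite E; apply: le_lt_trans (ncD _ _) _.
have h3 := ncD (delta_state w n A (mat_sub Y B)) (delta_state w n A B).
lra.
Qed.

Lemma strongly_clustering_of_aperiodic : strongly_clustering w.
Proof.
move=> A B qA qB; apply/complex_cvgP => e e0; exact: clusters_quasilocal.
Qed.

End Sufficiency.
End Clustering.

(** * Restriction to a class *)

Section Necessity.
#[local] Opaque quasilocal opb usum mat_mul.
Context {R : realType} {I : choiceType}.
Local Notation C := R[i].
Local Notation nc := ComplexField.Normc.normc.
Local Notation conf := (int -> I).
Local Notation cmat := (@mat R conf conf).
Local Notation one := (@mat_id R conf).
Implicit Types (X Y Z A : cmat) (J : {fset int}) (e M N : R) (b c : conf -> bool).

Lemma mean_eq_support (mu f g : I -> R) m : weight mu m ->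
  (forall i, 0 < mu i -> f i = g i) -> mean mu f = mean mu g.
Proof.
move=> hmu h; congr usum; apply/funext => i.
by have := hmu.1 i; rewrite le_eqVlt => /orP[/eqP <-|/h ->//]; rewrite !mul0r.
Qed.

Section Restriction.
Variable w : cmat -> C.
Hypothesis sw : state w.

(** The two projections have the same GNS vector, so [w] cannot tell them apart at either end of a
    product ([indistinct_mul]). *)
Definition indistinct b c : Prop := sqnorm w (mat_sub (prj b) (prj c)) = 0.

Lemma indistinctE b c : quasilocal (prj (R := R) b) -> quasilocal (prj (R := R) c) ->
  w (mat_mul (prj b) (prj c)) = w (prj b) -> w (prj c) = w (prj b) -> indistinct b c.
Proof.
move=> qb qc e1 e2; rewrite /indistinct /sqnorm mat_adj_sub !prj_adj.
have qbc := quasilocal_mul qb qc.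
have -> : mat_mul (mat_sub (prj b) (prj c)) (mat_sub (prj b) (prj c)) =
    mat_add (mat_scale (- 2) (mat_mul (prj b) (prj c))) (mat_add (prj b) (prj c)) :> cmat.
  have -> : mat_sub (prj b) (prj c) = diagm (fun s => (b s)%:R - (c s)%:R) :> cmat.
    by apply/funext => s; apply/funext => t; rewrite /mat_sub /prj /diagm mulrBl.
  rewrite diagm_mul /prj diagm_mul; apply/funext => s; apply/funext => t.
  by rewrite /mat_add /mat_scale /diagm; case: (b s); case: (c s) => /=; ring.
rewrite (state_lin (- 2) sw qbc (quasilocal_add qb qc)) (state_add sw qb qc) e1 e2.
by case: (w _) => x y /=; ring.
Qed.

Lemma indistinct_mul b c X : quasilocal (prj (R := R) b) -> quasilocal (prj (R := R) c) ->
  indistinct b c -> quasilocal X ->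
  w (mat_mul (prj b) X) = w (mat_mul (prj c) X) /\
  w (mat_mul X (prj b)) = w (mat_mul X (prj c)).
Proof.
move=> qb qc bc qX; have qD := quasilocal_sub qb qc.
have [M [M0 hX]] := quasilocal_opb qX.
have hD := opb_sub (opb_prj (R := R) b) (opb_prj c).
have aD : mat_adj (mat_sub (prj b) (prj c)) = mat_sub (prj b) (prj c) :> cmat.
  by rewrite mat_adj_sub !prj_adj.
have z0 (z : C) (r : R) : nc z ^+ 2 <= r -> r = 0 -> z = 0.
  move=> h e; apply/nc_eq0/eqP; rewrite -(@sqrf_eq0 R) eq_le sqr_ge0 andbT.
  by rewrite -e.
have h1 : w (mat_mul (mat_sub (prj b) (prj c)) X) = 0.
  have [_] := form_cauchy_schwarz sw qD qX; rewrite aD => /z0; apply.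
  by rewrite bc mul0r.
have h2 : w (mat_mul X (mat_sub (prj b) (prj c))) = 0.
  have [_] := form_cauchy_schwarz sw (quasilocal_adj qX) qD; rewrite mat_adjK => /z0; apply.
  by rewrite bc mulr0.
have bE : prj b = mat_add (mat_scale 1 (mat_sub (prj b) (prj c))) (prj c) :> cmat.
  by rewrite mat_scale1 mat_subK.
split.
- by rewrite [in LHS]bE (state_mul_linl sw 1 qD qc qX) h1 mulr0 add0r.
- by rewrite [in LHS]bE (state_mul_linr sw 1 qD qc qX) h2 mulr0 add0r.
Qed.

Lemma cut_mulE b X M : opb X M -> cut b X = mat_mul (prj b) (mat_mul X (prj b)).
Proof.
move=> hX; apply/funext => s; apply/funext => t.
by rewrite mul_diagm mul_mat_diagm mulrA.
Qed.

Lemma indistinct_cut b c X : quasilocal (prj (R := R) b) -> quasilocal (prj (R := R) c) ->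
  indistinct b c -> quasilocal X -> w (cut b X) = w (cut c X).
Proof.
move=> qb qc bc qX; have [M [M0 hX]] := quasilocal_opb qX.
rewrite (cut_mulE b hX) (cut_mulE c hX).
rewrite (indistinct_mul qb qc bc (quasilocal_mul qX qb)).1.
have E (d : conf -> bool) : mat_mul (prj c) (mat_mul X (prj d)) = mat_mul (mat_mul (prj c) X) (prj d).
  by apply/funext => s; apply/funext => t; rewrite mul_diagm !mul_mat_diagm mul_diagm mulrA.
by rewrite !E (indistinct_mul qb qc bc (quasilocal_mul qc qX)).2.
Qed.

End Restriction.

Section RestrictedState.
Variable w : cmat -> C.
Hypothesis iw : invariant_state w.
Let sw : state w. Proof. by case: iw. Qed.
Variables (b : conf -> bool) (a : R).
Hypotheses (a0 : 0 < a) (qb : quasilocal (prj (R := R) b)) (wb : w (prj b) = a%:C%C).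
Hypothesis shift_b : indistinct w b (fun s => b (translate 1 s)).

(** [w] conditioned on the event [b] of mass [a]. *)
Definition restricted X : C := (a^-1)%:C%C * w (cut b X).

Lemma cut_square X M : opb X M ->
  mat_mul (mat_adj (mat_mul X (prj b))) (mat_mul X (prj b)) = cut b (mat_mul (mat_adj X) X).
Proof.
move=> hX; rewrite (mat_mul_adj hX (opb_prj b)) prj_adj.
rewrite /prj (diagm_mulA _ (opb_adj hX) (opb_mul hX (opb_prj b))) (mul_diagmA _ (opb_adj hX) hX).
by apply/funext => s; apply/funext => t; rewrite mul_diagm mul_mat_diagm mulrA.
Qed.

Lemma restricted_state : invariant_state restricted.
Proof.
have qc X : quasilocal X -> quasilocal (cut b X) := fun qX => quasilocal_cut qb qX.
split; first split.
- move=> c X Y qX qY; rewrite /restricted.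
  have -> : cut b (mat_add (mat_scale c X) Y) = mat_add (mat_scale c (cut b X)) (cut b Y).
    by apply/funext => s; apply/funext => t; rewrite /cut /mat_add /mat_scale; ring.
  by rewrite (state_lin c sw (qc X qX) (qc Y qY)); ring.
- move=> X qX; have [M [_ hX]] := quasilocal_opb qX.
  rewrite /restricted -(cut_square hX); apply: mulr_ge0.
    by rewrite lecR invr_ge0 ltW.
  by case: sw => _ h _; apply: h; exact: quasilocal_mul qX qb.
- rewrite /restricted (_ : cut b (mat_id _) = prj b).
    by rewrite wb -rmorphM mulVf// gt_eqF.
  apply/funext => s; apply/funext => t; rewrite mat_id_diagm /cut /prj /diagm mul1r.
  case: (s =P t) => [<-|_]; last by rewrite !mulr0 mul0r.
  by case: (b s); rewrite ?mulr1 ?mul0r.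
move=> X qX; rewrite /restricted; congr (_ * _).
have qb1 : quasilocal (prj (R := R) (fun s => b (translate 1 s))).
  by rewrite -(iter_shift_prj 1 b); exact: quasilocal_iter_shift.
(* Cutting by the translated event instead makes the cut of [shift X] the shift of [cut b X], and
   invariance of [w] applies. *)
rewrite (indistinct_cut sw qb qb1 shift_b (quasilocal_shift qX)).
have := iter_shift_cut 1 b X => /= <-.
exact: (invariant_iter iw 1 (qc X qX)).
Qed.

Lemma restricted_prj : restricted (prj b) = 1.
Proof.
rewrite /restricted (_ : cut b (prj b) = prj b).
  by rewrite wb -rmorphM mulVf// gt_eqF.
by rewrite cutE !prj_idem.
Qed.

End RestrictedState.

(** The off-diagonal corners vanish: [b] may be replaced by a translate beyond the support of a
    local approximation of [X], where it commutes with that approximation. *)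
Lemma state_dichotomy (w : cmat -> C) b : invariant_state w ->
  quasilocal (prj (R := R) b) ->
  (forall n, (0 < n)%N -> indistinct w b (fun s => b (translate n%:Z s))) ->
  (forall s t, s 0 = t 0 -> b s = b t) ->
  forall X, quasilocal X -> w X = w (cut b X) + w (cut (fun s => ~~ b s) X).
Proof.
move=> iw qb hb loc X qX; have sw : state w by case: iw.
have prjN b' : prj (fun s => ~~ b' s) = mat_add (mat_scale (-1) (prj b')) one :> cmat.
  apply/funext => s; apply/funext => t; rewrite mat_id_diagm /mat_add /mat_scale /prj /diagm.
  by case: (b' s); rewrite /=; ring.
have qN b' : quasilocal (prj (R := R) b') -> quasilocal (prj (R := R) (fun s => ~~ b' s)).
  by move=> q; rewrite prjN; exact: quasilocal_lin q (@quasilocal_id R I).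
(* Stated for an arbitrary event so as to serve for [b] and for its complement, one per corner. *)
have cross0 b' Y : (forall n, (0 < n)%N -> indistinct w b' (fun s => b' (translate n%:Z s))) ->
    (forall s t, s 0 = t 0 -> b' s = b' t) -> quasilocal (prj (R := R) b') -> quasilocal Y ->
    w (mat_mul (mat_mul (prj b') Y) (prj (fun s => ~~ b' s))) = 0.
  move=> hb' loc' qb' qY; have qNb' := qN _ qb'.
  have key e : 0 < e -> nc (w (mat_mul (mat_mul (prj b') Y) (prj (fun s => ~~ b' s)))) <= 2 * e.
    move=> e0; have [J [A [M [lA hA hYA]]]] := (quasilocalP Y).1 qY e e0.
    have qA := quasilocal_local lA hA; have qYA := quasilocal_sub qY qA.
    have [n0 hn0] : exists n0 : nat, forall n, (n0 <= n)%N -> n%:Z \notin J.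
      exists (\max_(j <- J) `|j|%N).+1 => n hn; apply/negP => nJ.
      have := @leq_bigmax_seq _ _ xpredT (fun j : int => `|j|%N) n%:Z nJ isT.
      by rewrite absz_nat leqNgt hn.
    pose bn (s : conf) := b' (translate n0.+1%:Z s).
    have qbn : quasilocal (prj (R := R) bn).
      by rewrite -(iter_shift_prj n0.+1 b'); exact: quasilocal_iter_shift.
    have ind : indistinct w b' bn by exact: hb'.
    have A0 : w (mat_mul (mat_mul (prj b') A) (prj (fun s => ~~ b' s))) = 0.
      have q1 := quasilocal_mul qb' qA; have q2 := quasilocal_mul qbn qA.
      have o1 := opb_mul (opb_prj (R := R) b') hA.
      rewrite prjN (state_mul_linr sw (-1) qb' (@quasilocal_id R I) q1) mat_mul1.
      rewrite (indistinct_mul sw qb' qbn ind q1).2.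
      (* Both copies of the projection become [bn], which passes through [A] and is idempotent; what
         remains is the value of the product of [b'] with [A], and the difference is 0. *)
      have E1 : mat_mul (mat_mul (prj b') A) (prj bn) = mat_mul (prj b') (mat_mul A (prj bn)) :> cmat.
        by rewrite /prj (diagm_mulA _ hA (opb_prj bn)).
      rewrite E1 (indistinct_mul sw qb' qbn ind (quasilocal_mul qA qbn)).1.
      rewrite (indistinct_mul sw qb' qbn ind qA).1.
      suff -> : mat_mul (prj bn) (mat_mul A (prj bn)) = mat_mul (prj bn) A :> cmat.
        by rewrite mulN1r addNr.
      apply/funext => s; apply/funext => t; rewrite !mul_diagm mul_mat_diagm.
      have [->|h] := eqVneq (A s t) 0; first by rewrite mul0r !mulr0.
      have st := proj1 lA s t h (n0.+1%:Z) (hn0 _ (leqnSn _)).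
      have -> : bn s = bn t by apply: loc'; rewrite /translate add0r.
      by case: (bn t); rewrite ?mulr1 ?mul0r.
    have YE : Y = mat_add (mat_scale 1 (mat_sub Y A)) A by rewrite mat_scale1 mat_subK.
    have [MY [_ hY']] := quasilocal_opb qY.
    have E2 : mat_mul (mat_mul (prj b') Y) (prj (fun s => ~~ b' s)) =
        mat_add (mat_scale 1 (mat_mul (mat_mul (prj b') (mat_sub Y A)) (prj (fun s => ~~ b' s))))
          (mat_mul (mat_mul (prj b') A) (prj (fun s => ~~ b' s))).
      apply/funext => s; apply/funext => t; rewrite /mat_add /mat_scale !mul_mat_diagm !mul_diagm.
      by rewrite /mat_sub; ring.
    have q3 := quasilocal_mul (quasilocal_mul qb' qYA) qNb'.
    have q4 := quasilocal_mul (quasilocal_mul qb' qA) qNb'.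
    rewrite E2 (state_lin 1 sw q3 q4) A0 addr0 mul1r.
    have o3 := opb_mul (opb_mul (opb_prj (R := R) b') hYA) (opb_prj (fun s => ~~ b' s)).
    rewrite mul1r mulr1 in o3; exact: (state_norm_le sw q3 e0 o3).
  apply/nc_eq0/eqP; rewrite eq_le nc_ge0 andbT; apply/ler_addgt0Pr => e e0; rewrite add0r.
  have e2 : 0 < e / 2 by lra.
  by apply: le_trans (key _ e2) _; lra.
have hN n : (0 < n)%N -> indistinct w (fun s => ~~ b s) (fun s => ~~ b (translate n%:Z s)).
  move=> n0; have := hb n n0; rewrite /indistinct => <-.
  have -> : mat_sub (prj (fun s => ~~ b s)) (prj (fun s => ~~ b (translate n%:Z s))) =
      mat_scale (-1) (mat_sub (prj b) (prj (fun s => b (translate n%:Z s)))) :> cmat.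
    apply/funext => s; apply/funext => t; rewrite /mat_sub /mat_scale /prj /diagm.
    by case: (b s); case: (b (translate _ s)); rewrite /=; ring.
  have hD := opb_sub (opb_prj (R := R) b) (opb_prj (fun s => b (translate n%:Z s))).
  rewrite /sqnorm mat_adj_scale (mat_mulZl _ (opb_adj hD) (opb_scale (-1) hD)).
  rewrite (mat_mulZr _ hD (opb_adj hD)); congr (complex.Re (w _)).
  apply/funext => s; apply/funext => t; rewrite /mat_scale mulrA.
  have -> : ((-1 : C)^*)%C * -1 = 1 by rewrite rmorphN1 mulrNN mulr1.
  by rewrite mul1r.
have c1 := cross0 b X hb loc qb qX.
have locN s t : s 0 = t 0 -> ~~ b s = ~~ b t by move=> /loc ->.
have c2 := cross0 (fun s => ~~ b s) X hN locN (qN _ qb) qX.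
have NN : prj (fun s => ~~ ~~ b s) = prj b :> cmat.
  by congr prj; apply/funext => s; rewrite negbK.
rewrite NN in c2; have qNb := qN _ qb.
have E : X = mat_add (mat_add (cut b X) (cut (fun s => ~~ b s) X))
    (mat_add (mat_mul (mat_mul (prj b) X) (prj (fun s => ~~ b s)))
      (mat_mul (mat_mul (prj (fun s => ~~ b s)) X) (prj b))).
  apply/funext => s; apply/funext => t.
  rewrite /mat_add /cut !mul_mat_diagm !mul_diagm.
  by case: (b s); case: (b t); rewrite /=; ring.
have q1 := quasilocal_cut qb qX; have q2 := quasilocal_cut qNb qX.
have q3 := quasilocal_mul (quasilocal_mul qb qX) qNb.
have q4 := quasilocal_mul (quasilocal_mul qNb qX) qb.
rewrite [in LHS]E (state_add sw (quasilocal_add q1 q2) (quasilocal_add q3 q4)).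
by rewrite (state_add sw q1 q2) (state_add sw q3 q4) c1 c2 !addr0.
Qed.

End Necessity.

(** * Mass and period of a class *)

Section Classes.
#[local] Opaque quasilocal opb usum mat_mul.
Context {R : realType} {I : choiceType}.
Local Notation C := R[i].
Local Notation conf := (int -> I).
Local Notation cmat := (@mat R conf conf).
Variables (P : I -> I -> R) (p : I -> R) (w : cmat -> C).
Hypotheses (hP : stochastic P) (hp : stationary P p) (hw : entangled_markov_chain P p w).
Implicit Types (L : set I) (i j : I).

Let sw : state w. Proof. exact: chain_state hw. Qed.
Let iw : invariant_state w. Proof. by case: hw. Qed.

Definition indicator L : I -> R := fun i => (`[< L i >])%:R.

Lemma indicator01 L : in01 (indicator L).
Proof. by move=> i; rewrite /indicator ler0n lern1 leq_b1. Qed.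

(** On the support an edge neither leaves nor enters a class: classes are closed, and by
    [support_edge] every edge can be travelled back. *)
Lemma iter_Pop_indicator L n i : Lambda P p L -> 0 < p i ->
  iter n (Pop P) (indicator L) i = indicator L i.
Proof.
move=> hL; elim: n i => [//|n IH] i pi; rewrite iterS /Pop.
transitivity (mean (P i) (fun=> indicator L i)); last first.
  by rewrite (mean_cst _ (weight_row hP i)) mulr1.
apply: mean_eq_support (weight_row hP i) _ => j Pij.
have [pj ji] := support_edge hP hp pi Pij; rewrite IH// /indicator; congr (nat_of_bool _)%:R.
apply/asboolP/asboolP => [Lj|Li]; last exact: (Lambda_closed hP hp hL Li Pij).
rewrite (Lambda_eq hP hp hL Lj); apply/(communicateE hP); split=> //.
by exists 1%N; apply/(stepsS hP); exists j; split=> //; exact/steps0.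
Qed.

Definition in_class L (s : conf) : bool := `[< L (s 0) >].

Lemma prj_in_class L : prj (in_class L) = site (indicator L).
Proof.
by congr diagm; apply/funext => s; rewrite /indicator rmorph_nat.
Qed.

Lemma quasilocal_in_class L : quasilocal (prj (R := R) (in_class L)).
Proof.
apply: (@quasilocal_local R I (sites 0 1) _ 1); last exact: opb_prj.
apply: localm_diagm => s t st; congr (nat_of_bool _)%:R; rewrite /in_class.
have h0 : (0 : int) \in sites 0 1 by apply/sitesP; exists 0%N.
by have := congr1 (@^~ [` h0]%fset) st; rewrite /restr /= => ->.
Qed.

Lemma chain_in_class L : w (prj (in_class L)) = (mean p (indicator L))%:C%C.
Proof. by rewrite prj_in_class (chain_site hP hp hw (indicator01 L)). Qed.

Lemma chain_in_class_two_point L n : Lambda P p L -> (0 < n)%N ->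
  w (mat_mul (prj (in_class L)) (iter n Defs.shift (prj (in_class L)))) = w (prj (in_class L)).
Proof.
move=> hL n0; rewrite prj_in_class.
rewrite (chain_site_two_point hP hp hw n0 (indicator01 L) (indicator01 L)).
rewrite (chain_site hP hp hw (indicator01 L)); congr (_%:C%C).
apply: mean_eq_support (weight_stationary hp) _ => i pi.
by rewrite iter_Pop_indicator// /indicator; case: asboolP => _; rewrite ?mulr1 ?mulr0.
Qed.

Lemma mass_gt0 L : Lambda P p L -> 0 < mean p (indicator L).
Proof.
move=> hL; have [i pi e] := Lambda_class hP hp hL.
apply: lt_le_trans (mean_ge_term i (weight_stationary hp) (indicator01 L)).
rewrite /indicator asboolT ?mulr1// e; apply/(communicateE hP); split; exact: reach_refl.
Qed.

Lemma mass_le1 L : mean p (indicator L) <= 1.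
Proof. by have /andP[] := mean01 (weight_stationary hp) (indicator01 L). Qed.

Lemma in_class_indistinct L n : Lambda P p L -> (0 < n)%N ->
  indistinct w (in_class L) (fun s => in_class L (translate n%:Z s)).
Proof.
move=> hL n0; have q := quasilocal_in_class L.
have E := iter_shift_prj (R := R) n (in_class L).
have qn : quasilocal (prj (R := R) (fun s => in_class L (translate n%:Z s))).
  by rewrite -E; exact: quasilocal_iter_shift.
apply: (indistinctE sw q qn).
  by rewrite -E; exact: chain_in_class_two_point.
by rewrite -E; exact: (invariant_iter iw n q).
Qed.

(** If the mass [a] were below 1, [w] would be a mixture of its restrictions to the class and to the
    complement. Extremality gives both the same value at the projection, but the first gives 1 and
    [w] gives [a]. *)
Lemma ergodic_mass L : ergodic w -> Lambda P p L -> mean p (indicator L) = 1.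
Proof.
move=> [_ ext] hL; set a := mean p (indicator L).
have a0 : 0 < a := mass_gt0 hL; have a1 : a <= 1 := mass_le1 L.
apply/eqP; rewrite eq_le a1 /= leNgt; apply/negP => {}a1.
have q := quasilocal_in_class L; have wa := chain_in_class L; rewrite -/a in wa.
have ind n (n0 : (0 < n)%N) := in_class_indistinct hL n0.
have i1 := restricted_state iw a0 q wa (ind 1%N isT).
pose b' (s : conf) := ~~ in_class L s.
have loc s t : s 0 = t 0 -> in_class L s = in_class L t by rewrite /in_class => ->.
have prjN (d : conf -> bool) : prj (fun s => ~~ d s) = mat_add (mat_scale (-1) (prj d)) (mat_id _) :> cmat.
  apply/funext => s; apply/funext => t; rewrite mat_id_diagm /mat_add /mat_scale /prj /diagm.
  by case: (d s) => /=; ring.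
have q' : quasilocal (prj (R := R) b').
  by rewrite /b' prjN; exact: quasilocal_lin q (@quasilocal_id R I).
have wa' : w (prj b') = (1 - a)%:C%C.
  rewrite /b' prjN (state_lin (-1) sw q (@quasilocal_id R I)) (state1 sw) wa.
  by rewrite rmorphB rmorph1 mulN1r addrC.
have a0' : 0 < 1 - a by lra.
have ind' : indistinct w b' (fun s => b' (translate 1 s)).
  have E := iter_shift_prj (R := R) 1 b'.
  have q1 : quasilocal (prj (R := R) (fun s => b' (translate 1 s))).
    by rewrite -[prj _]E; exact: quasilocal_iter_shift.
  have qn : quasilocal (prj (R := R) (fun s => in_class L (translate 1 s))).
    by rewrite -[prj _](iter_shift_prj 1 (in_class L)); exact: quasilocal_iter_shift.
  apply: (indistinctE sw q' q1); last by rewrite -[prj _]E; exact: (invariant_iter iw 1 q').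
  rewrite /b' (prjN (fun s => in_class L (translate 1 s))).
  have qN : quasilocal (prj (R := R) (fun s => ~~ in_class L s)) := q'.
  rewrite (state_mul_linr sw (-1) qn (@quasilocal_id R I) qN) mat_mul1 prjN.
  rewrite (state_mul_linl sw (-1) q (@quasilocal_id R I) qn) mat_1mul.
  have -> : w (mat_mul (prj (in_class L)) (prj (fun s => in_class L (translate 1 s)))) = w (prj (in_class L)).
    by have := chain_in_class_two_point hL (n := 1) isT; rewrite iter_shift_prj.
  have -> : w (prj (fun s => in_class L (translate 1 s))) = w (prj (in_class L)).
    by have := invariant_iter iw 1 q; rewrite iter_shift_prj.
  by ring.
have i2 := restricted_state iw a0' q' wa' ind'.
have dec X : quasilocal X -> w X = a%:C%C * restricted w (in_class L) a X +
    (1 - a)%:C%C * restricted w b' (1 - a) X.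
  move=> qX; rewrite (state_dichotomy iw q ind loc qX) /restricted !mulrA -!rmorphM.
  by rewrite !mulfV ?gt_eqF// !mul1r.
have t01 : 0 < a < 1 by rewrite a0 a1.
have [e _] := ext _ _ a i1 i2 t01 dec _ q.
rewrite (restricted_prj a0 wa) wa in e.
have := congr1 (@complex.Re R) e => /= e'; lra.
Qed.

(** The autocorrelation of the class is constantly [a] and must converge to [a * a], with [a]
    positive. *)
Lemma clustering_mass L : strongly_clustering w -> Lambda P p L -> mean p (indicator L) = 1.
Proof.
move=> cl hL; have q := quasilocal_in_class L; have wa := chain_in_class L.
set a := mean p (indicator L) in wa *; have a0 : 0 < a := mass_gt0 hL.
have /complex_cvgP h := cl _ _ q q.
suff h0 : forall e, 0 < e -> `|a - a * a| <= e.
  have : `|a - a * a| = 0 by apply/eqP; rewrite eq_le normr_ge0 andbT; apply/ler_addgt0Pr => e /h0; rewrite add0r.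
  move=> /normr0_eq0 /eqP; rewrite -{1}[a]mulr1 -mulrBr mulf_eq0 gt_eqF//= subr_eq0 => /eqP <- //.
move=> e e0; have [m hm] := h e e0; have := hm m.+1 (leqnSn m).
rewrite (chain_in_class_two_point hL (ltn0Sn m)) wa -rmorphM -rmorphB nc_real.
exact: ltW.
Qed.

(** Two disjoint classes of full mass would give [p] total mass 2. *)
Lemma Lambda_singleton : Lambda P p !=set0 ->
  (forall L, Lambda P p L -> mean p (indicator L) = 1) ->
  exists L, Lambda P p = [set L].
Proof.
move=> [L hL] mass; exists L; apply/seteqP; split=> [L' hL'|_ ->//] /=.
have [i [Li L'i]] : exists i, L i /\ L' i.
  apply: contrapT => no.
  have disj01 : in01 (fun i => indicator L i + indicator L' i).
    move=> i; rewrite /indicator; case: asboolP => Li; case: asboolP => L'i /=;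
      rewrite ?addr0 ?add0r ?ler01 ?lexx//.
    by exfalso; apply: no; exists i.
  have /andP[_] := mean01 (weight_stationary hp) disj01.
  rewrite (meanD (weight_stationary hp) (bounded01 (indicator01 L)) (bounded01 (indicator01 L'))).
  by rewrite !mass//; lra.
by rewrite (Lambda_eq hP hp hL Li) (Lambda_eq hP hp hL' L'i).
Qed.

Lemma clustering_aperiodic L : strongly_clustering w -> Lambda P p L ->
  aperiodic (block P (L := L)).
Proof.
move=> cl hL; apply/(aperiodic_block hP hp hL) => i Li e he.
have pi := Lambda_support hP hp hL Li.
pose b (s : conf) := s 0 == i.
have bE : prj b = site (dl (R := R) i).
  by congr diagm; apply/funext => s; rewrite /dl rmorph_nat.
have q : quasilocal (site (dl (R := R) i)).
  rewrite -bE; apply: (@quasilocal_local R I (sites 0 1) _ 1); last exact: opb_prj.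
  apply: localm_diagm => s t st; congr (nat_of_bool _)%:R; rewrite /b.
  have h0 : (0 : int) \in sites 0 1 by apply/sitesP; exists 0%N.
  by have := congr1 (@^~ [` h0]%fset) st; rewrite /restr /= => ->.
have d01 : in01 (dl (R := R) i) by exact: dl01.
have /complex_cvgP h := cl _ _ q q.
(* With the limit itself as tolerance, the correlations stay positive, so [i] is revisited at every
   time beyond [m]. *)
have p2 : 0 < p i * p i by rewrite mulr_gt0.
have [m hm] := h _ p2.
have ret n : (m < n)%N -> steps P n i i.
  move=> mn; have := hm n (ltnW mn).
  have n0 : (0 < n)%N by exact: leq_ltn_trans mn.
  rewrite (chain_site_two_point hP hp hw n0 d01 d01) (chain_site hP hp hw d01).
  rewrite (mean_dl _ (weight_stationary hp)) -rmorphM -rmorphB nc_real.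
  have -> : mean p (fun k => dl i k * iter n (Pop P) (dl i) k) = p i * iter n (Pop P) (dl i) i.
    apply: meanE; have := @hsum1 R I i (fun k => p k * (dl i k * iter n (Pop P) (dl i) k)).
    by rewrite /dl eqxx mul1r; apply => k /negbTE ->; rewrite mul0r mulr0.
  rewrite -mulrBr normrM (gtr0_norm pi) ltr_pM2l// ltr_norml => /andP[h1 _].
  by rewrite /steps; lra.
(* Two consecutive return times have no common divisor but 1. *)
have h1 := he m.+1 isT (ret m.+1 (ltnSn m)).
have h2 := he m.+2 isT (ret m.+2 (leqnSn _)).
by move: h2; rewrite -addn1 dvdn_addr.
Qed.

End Classes.

Theorem theorem4p1 (R : realType) (I : choiceType)
    (P : I -> I -> R) (p : I -> R)
    (w : @mat R (int -> I) (int -> I) -> R[i])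
    (hP : stochastic P) (hp : stationary P p) (hL : Lambda P p !=set0)
    (hw : entangled_markov_chain P p w) :
  (ergodic w <-> exists L : set I, Lambda P p = [set L]) /\
  (strongly_clustering w <->
     exists L : set I, Lambda P p = [set L] /\ aperiodic (block P (L := L))).
Proof.
split; split.
- by move=> erg; apply: (Lambda_singleton hP hp hL) => L hLL; exact: (ergodic_mass hP hp hw erg hLL).
- by move=> [L e]; exact: (ergodic_of_connected hP hp hw (Lambda_unique hP hp e)).
- move=> cl; have [|L e] := Lambda_singleton hP hp hL.
    by move=> L hLL; exact: (clustering_mass hP hp hw cl hLL).
  have hLL : Lambda P p L by rewrite e.
  by exists L; split=> //; exact: (clustering_aperiodic hP hp hw cl hLL).
- move=> [L [e ap]]; have hLL : Lambda P p L by rewrite e.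
  apply: (strongly_clustering_of_aperiodic hP hp hw (Lambda_unique hP hp e)) => i pi.
  apply: (aperiodic_eventually hP); apply: ((aperiodic_block hP hp hLL).1 ap).
  have := class_in_Lambda hP hp pi; rewrite e /= => <-.
  by apply/(communicateE hP); split; exact: reach_refl.
Qed.
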